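(* Let $q>0$, $q\notin\{2,4,6,\dots\}$. Then ${\rm Pos}(C_q)$ consists exactly of those functions $h\in C_e^\infty(S^{n-1})$ such that the Fourier transform of the distribution $\frac{1}{\Gamma(-q/2)}\,h\cdot r^q$ is positive on $\mathbb{R}^n\setminus\{0\}$.
   Context: $C_e^\infty(S^{n-1})$ is the space of even real-valued infinitely differentiable functions on $S^{n-1}$, ordered pointwise. For a linear operator $T:C_e^\infty(S^{n-1})\to C_e^\infty(S^{n-1})$, ${\rm Pos}(T)$ is the set of $h\in C_e^\infty(S^{n-1})$ such that $\int_{S^{n-1}}f(x)h(x)\,dx\ge 0$ for every $f\in C_e^\infty(S^{n-1})$ satisfying $Tf(x)\ge0$ for all $x\in S^{n-1}$. The $q$-cosine transform is $C_qf(\xi)=\int_{S^{n-1}}|(x,\xi)|^qf(x)\,dx$. For $h$ on $S^{n-1}$, $h\cdot r^s(x)=|x|_2^s h(x/|x|_2)$ on $\mathbb{R}^n\setminus\{0\}$, viewed as a Schwartz distribution. Fourier transform: $\hat\phi(x)=\int_{\mathbb{R}^n}\phi(\xi)e^{-i(x,\xi)}d\xi$, extended to distributions by $\langle\hat h,\phi\rangle=\langle h,\hat\phi\rangle$. A distribution is positive on $\mathbb{R}^n\setminus\{0\}$ if it is nonnegative on every nonnegative test function supported in $\mathbb{R}^n\setminus\{0\}$. *)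

(* Defs.v *)
From HB Require Import structures.
From mathcomp Require Import all_boot all_order all_algebra.
From mathcomp Require Import all_classical all_reals all_analysis.
Set Implicit Arguments. Unset Strict Implicit. Unset Printing Implicit Defensive.
Import Order.TTheory GRing.Theory Num.Theory.
Import numFieldNormedType.Exports.
Local Open Scope classical_set_scope.
Local Open Scope ring_scope.

Section Defs.
Variable R : realType.

Definition dotp (n : nat) (x y : 'rV[R]_n) : R := \sum_(i < n) x ord0 i * y ord0 i.
Definition enorm (n : nat) (x : 'rV[R]_n) : R := Num.sqrt (dotp x x).

Definition radial (n : nat) (h : 'rV[R]_n -> R) (x : 'rV[R]_n) : R :=
  h ((enorm x)^-1 *: x).

Fixpoint iderive (n : nat) (vs : seq 'rV[R]_n) (f : 'rV[R]_n -> R) : 'rV[R]_n -> R :=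
  match vs with
  | [::] => f
  | v :: vs' => fun x => 'D_v (iderive vs' f) x
  end.

Definition smooth_on (n : nat) (U : set 'rV[R]_n) (f : 'rV[R]_n -> R) : Prop :=
  forall vs : seq 'rV[R]_n, forall x, U x ->
    {for x, continuous (iderive vs f)} /\ (forall v, derivable (iderive vs f) x v).

(* h in C_e^infinity(S^{n-1}): h is a function whose restriction to the unit
   sphere is what matters; smoothness on S^{n-1} is expressed by smoothness of
   its 0-homogeneous extension on R^n \ {0}; evenness is h(-x) = h(x) on S^{n-1}. *)
Definition Ce_inf (n : nat) (h : 'rV[R]_n -> R) : Prop :=
  (forall x, enorm x = 1 -> h (- x) = h x) /\
  smooth_on [set x | x != 0] (radial h).

(* Lebesgue integral over R^n, written as iterated one-dimensional Lebesgue
   integrals (by Fubini this is the Lebesgue integral on R^n for integrable f). *)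
Fixpoint intRn (n : nat) : ('rV[R]_n -> R) -> R :=
  match n return ('rV[R]_n -> R) -> R with
  | 0 => fun f => f 0
  | n'.+1 => fun f =>
      Rintegral (@lebesgue_measure R) setT
        (fun t : R => intRn (fun y : 'rV[R]_n' => f (row_mx (t%:M : 'rV[R]_1) y)))
  end.

(* Integral over S^{n-1} w.r.t. the standard surface measure, via
   int_{S^{n-1}} f dx = n * int_{|x|_2 <= 1} f(x/|x|_2) dx. *)
Definition sphere_int (n : nat) (f : 'rV[R]_n -> R) : R :=
  n%:R * intRn (fun x => if enorm x <= 1 then radial f x else 0).

Definition cosine_transform (n : nat) (q : R) (f : 'rV[R]_n -> R) (xi : 'rV[R]_n) : R :=
  sphere_int (fun x => (`|dotp x xi| `^ q) * f x).

Definition Pos_Cq (n : nat) (q : R) (h : 'rV[R]_n -> R) : Prop :=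
  Ce_inf h /\
  forall f : 'rV[R]_n -> R, Ce_inf f ->
    (forall xi, enorm xi = 1 -> 0 <= cosine_transform q f xi) ->
    0 <= sphere_int (fun x => f x * h x).

(* Gamma(s) = (int_0^oo t^{s+k-1} e^{-t} dt) / (s (s+1) ... (s+k-1)),
   with k = floor|s| + 1 so that s + k > 0 (Euler integral for s > 0, extended
   by the functional equation; meaningful for s not in {0,-1,-2,...}). *)
Definition Gamma (s : R) : R :=
  let k := (Num.truncn `|s|).+1 in
  Rintegral (@lebesgue_measure R) [set t : R | 0 < t]
    (fun t => t `^ (s + k%:R - 1) * expR (- t))
  / \prod_(j < k) (s + j%:R).

Definition nonneg_test_fun_off0 (n : nat) (phi : 'rV[R]_n -> R) : Prop :=
  smooth_on setT phi /\
  (forall x, 0 <= phi x) /\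
  (exists M : R, forall x, M < enorm x -> phi x = 0) /\
  (exists2 e : R, 0 < e & forall x, enorm x < e -> phi x = 0).

(* For a locally integrable tempered function g (viewed as a distribution),
   <\hat g, phi> = <g, \hat phi> = int g(x) (int phi(xi) e^{-i(x,xi)} dxi) dx
                 = int g(x) (int phi(xi) cos(x,xi) dxi) dx
                   - i * int g(x) (int phi(xi) sin(x,xi) dxi) dx.
   The Fourier transform of g is positive on R^n \ {0} iff this complex
   number is a nonnegative real for every such phi. *)
Definition fourier_pos_off0 (n : nat) (g : 'rV[R]_n -> R) : Prop :=
  forall phi, nonneg_test_fun_off0 phi ->
    0 <= intRn (fun x => g x * intRn (fun xi => phi xi * cos (dotp x xi))) /\
    intRn (fun x => g x * intRn (fun xi => phi xi * sin (dotp x xi))) = 0.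

Definition hrs (n : nat) (h : 'rV[R]_n -> R) (s : R) (x : 'rV[R]_n) : R :=
  enorm x `^ s * radial h x.

End Defs.

(* Main.v *)
(** For a test function f supported away from 0 put
    F_f(x) = Gamma(-q/2)^-1 * int_0^oo r^(q+n-1) (f^)(r x) dr.
    In polar coordinates the pairing of Gamma(-q/2)^-1 h.r^q with f^ is the integral of
    h F_f over the sphere, and C_q F_f(xi) is Gamma(-q/2)^-1 times the integral of
    |(x,xi)|^q f^(x), which by the one-dimensional formula for the Fourier transform of
    |t|^q equals P * int_0^oo s^(-1-q) (f(s xi) + f(-s xi)) ds.  The constant P is positive
    because Gamma(-q/2) has the sign (-1)^(m+1) when 2m < q < 2m+2.

    Hence f >= 0 gives C_q F_f >= 0, so a member h of Pos(C_q) has a positive Fourier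
    transform.  Conversely, let chi be radial and supported in an annulus.  With
    f = chi * (h extended radially) one gets C_q F_f = A h with A > 0; write F0 for this
    F_f.  Testing positivity on chi * b(-F0), where b vanishes exactly on (-oo, 0] and is
    positive elsewhere, and using that C_q is symmetric, one finds that the integral of
    F0 * b(-F0) <= 0 over the sphere is nonnegative, so F0 >= 0 almost everywhere.  Then
    A * int f h = int f C_q(F0) = int (C_q f) F0 >= 0 whenever C_q f >= 0. *)

Require Import Defs.
From HB Require Import structures.
From mathcomp Require Import all_boot all_order all_algebra.
From mathcomp Require Import all_classical all_reals all_analysis measurable_realfun.
From mathcomp Require Import ring lra.
Set Implicit Arguments. Unset Strict Implicit. Unset Printing Implicit Defensive.
Import Order.TTheory GRing.Theory Num.Theory.
Import numFieldNormedType.Exports.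
Local Open Scope classical_set_scope.
Local Open Scope ring_scope.

(** * Lebesgue measure on row vectors *)

(** Supporting the test functions away from 0 removes two divergences at once: the integral of
    s^(-1-q) along a line meets no singularity, and f^ decays faster than any power, so it can be
    integrated against |x|^q. For q >= 2 the integral of s^(-1-q) (1 - cos(s t)), which represents
    |t|^q below 2, diverges at s = 0 and would call for Taylor corrections. Instead q is lowered by
    2 by putting two derivatives along xi on f. Each descent costs a factor -1, matched by one more
    negative factor in Gamma(-q/2); this is how the sign of P comes out right for every admissible
    q.

    In the converse, A depends on chi, q and n but not on the function that is extended radially, so
    the same A serves for h and for b(-F0). A smooth b stands for the negative part of F0 because
    test functions must be smooth, and one vanishing integral gives F0 >= 0 almost everywhere.

    The iterated integrals of the definitions are compared with a genuine measure [mu] on row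
    vectors; the comparison holds for functions dominated by an integrable product, which is why so
    much of the development consists of explicit majorants. *)

Definition rV_display : measure_display. Proof. exact: default_measure_display. Qed.

Section rV_measurable.
Variables (R : realType) (n : nat).

(** Generators of the product sigma-algebra: with this choice measurability of a map into row
    vectors is checked coordinate by coordinate, and open sets are shown to be measurable
    afterwards. *)
Definition cylinders : set (set 'rV[R]_n) :=
  [set A | exists i, exists2 B : set R, measurable B & A = (fun x : 'rV[R]_n => x ord0 i) @^-1` B].

Let cyl0 : <<s cylinders >> set0. Proof. exact: sigma_algebra0. Qed.
Let cylC A : <<s cylinders >> A -> <<s cylinders >> (~` A).
Proof. by move=> h; rewrite -setTD; exact: sigma_algebraCD. Qed.
Let cyl_bigcup (F : (set 'rV[R]_n)^nat) : (forall i, <<s cylinders >> (F i)) ->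
  <<s cylinders >> (\bigcup_i (F i)).
Proof. exact: sigma_algebra_bigcup. Qed.

HB.instance Definition _ := @isMeasurable.Build rV_display 'rV[R]_n
  <<s cylinders >> cyl0 cylC cyl_bigcup.

Lemma measurable_coord (i : 'I_n) : measurable_fun setT (fun x : 'rV[R]_n => x ord0 i).
Proof.
by move=> _ B mB; rewrite setTI; apply: sub_sigma_algebra; exists i, B.
Qed.

Lemma measurable_rV d (T : measurableType d) (f : T -> 'rV[R]_n) :
  (forall i, measurable_fun setT (fun t => f t ord0 i)) -> measurable_fun setT f.
Proof.
move=> mf; apply: (@measurability _ _ _ _ _ _ cylinders) => //.
move=> _ [_ [i [B mB ->]] <-].
exact: mf.
Qed.
End rV_measurable.

Section mu_step.
Variables (R : realType) (n : nat).
(** The new coordinate is put in front, exactly as in the argument of the integrand of [intRn], so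
    that the iterated integral matches the product measure without any reindexing. *)
Definition rcons_mx (p : measurableTypeR R * 'rV[R]_n) : 'rV[R]_n.+1 := row_mx ((p.1 : R)%:M : 'rV[R]_1) p.2.

Lemma rcons_mx0 (t : R) (y : 'rV[R]_n) : rcons_mx (t, y) ord0 ord0 = t.
Proof.
have e : (ord0 : 'I_n.+1) = lshift n (ord0 : 'I_1) by exact/val_inj.
by rewrite /rcons_mx /= [X in _ _ X = _]e (@row_mxEl _ 1 1 n) mxE eqxx.
Qed.

Lemma rcons_mxS (t : R) (y : 'rV[R]_n) j : rcons_mx (t, y) ord0 (lift ord0 j) = y ord0 j.
Proof.
have e : (lift ord0 j : 'I_n.+1) = rshift 1 j by exact/val_inj.
by rewrite /rcons_mx /= [X in _ _ X = _]e (@row_mxEr _ 1 1 n).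
Qed.

Lemma measurable_rcons_mx : measurable_fun setT rcons_mx.
Proof.
apply: measurable_rV => i; case: (unliftP ord0 i) => [j ->|->].
  rewrite (_ : (fun _ => _) = (fun y : 'rV[R]_n => y ord0 j) \o snd).
    by apply: measurableT_comp => //; exact: measurable_coord.
  by apply/funext => -[t y] /=; rewrite rcons_mxS.
rewrite (_ : (fun _ => _) = fst) //.
by apply/funext => -[t y] /=; rewrite rcons_mx0.
Qed.

Definition runcons (x : 'rV[R]_n.+1) : measurableTypeR R * 'rV[R]_n := (x ord0 ord0, \row_j x ord0 (lift ord0 j)).
Lemma rcons_mxK : cancel rcons_mx runcons.
Proof.
move=> [t y]; rewrite /runcons rcons_mx0; congr (_, _).
by apply/rowP => j; rewrite mxE rcons_mxS.
Qed.
Lemma runconsK : cancel runcons rcons_mx.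
Proof.
move=> x; apply/rowP => i; case: (unliftP ord0 i) => [j ->|->]; last by rewrite rcons_mx0.
by rewrite rcons_mxS mxE.
Qed.
Lemma measurable_runcons : measurable_fun setT runcons.
Proof.
apply: measurable_fun_pair; first exact: measurable_coord.
apply: measurable_rV => j.
rewrite (_ : (fun _ => _) = fun x : 'rV[R]_n.+1 => x ord0 (lift ord0 j)); first exact: measurable_coord.
by apply/funext => x; rewrite mxE.
Qed.

Variable m : {sigma_finite_measure set 'rV[R]_n -> \bar R}.
Definition mu_step := pushforward (@lebesgue_measure R \x m)%E rcons_mx.
HB.instance Definition _ := Measure.copy mu_step
  (@measure_function_pushforward__canonical__measure_function_Measure _ _ _ _ _ (@lebesgue_measure R \x m)%E _ measurable_rcons_mx).

Let mu_step_sigma_finite : sigma_finite setT mu_step.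
Proof.
have /sigma_finiteP[G [GT ndG Goo]] := sigma_finiteT m.
pose A k := `[- k%:R, k%:R]%classic `*` G k : set (measurableTypeR R * 'rV[R]_n).
have mA k : measurable (A k) by apply: measurableX => //; exact: (Goo k).1.
exists (fun k => runcons @^-1` A k); last first.
  move=> k; split; first by rewrite -[X in measurable X]setTI; apply: measurable_runcons => //; exact: mA.
  rewrite /mu_step /pushforward -comp_preimage.
  rewrite (_ : runcons \o rcons_mx = id); last by apply/funext => x /=; rewrite rcons_mxK.
  rewrite preimage_id product_measure1E//; last exact: (Goo k).1.
  rewrite lte_mul_pinfty//; last exact: (Goo k).2.
  have -> : (lebesgue_measure_lebesgue_measure__canonical__measure_function_Measure R
    `[- k%:R, k%:R]%classic) = lebesgue_measure `[- k%:R, k%:R]%classic by [].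
  by rewrite lebesgue_measure_itv/=; case: ifP.
apply/seteqP; split => // x _; have : setT (runcons x).2 by [].
rewrite GT => -[i _ Gi].
(* G is nondecreasing, so a single index can both bound the first coordinate and keep the second one
   in G. *)
pose k := maxn i (Num.truncn `|(runcons x).1|).+1; exists k => //=; split => /=.
  rewrite in_itv/= -ler_norml (le_trans (ltW (truncnS_gt _)))// ler_nat; exact: leq_maxr.
by move: Gi; apply/subsetPset; apply: ndG; exact: leq_maxl.
Qed.

HB.instance Definition _ := Measure_isSigmaFinite.Build _ _ _ mu_step
  mu_step_sigma_finite.
End mu_step.

Fixpoint mu (R : realType) n : {sigma_finite_measure set 'rV[R]_n -> \bar R} :=
  match n with
  | 0 => dirac (0 : 'rV[R]_0)
  | n.+1 => mu_step (mu R n)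
  end.
Arguments mu {R n} : simpl never.

(** * Affine substitutions on the line *)

Section affine1.
Variable R : realType.
Notation leb := (@lebesgue_measure R).
Local Open Scope ereal_scope.

Definition aff1 (c a t : R) : R := (c * t + a)%R.

Lemma measurable_aff1 c a : measurable_fun setT (aff1 c a).
Proof. by apply: measurable_funD => //; exact: measurable_funM. Qed.

(** Lebesgue measure is determined by its values on half-open intervals, and the preimage of such an
    interval under an increasing affine map is again one. *)
Lemma lebesgue_measure_affine (c a : R) (c0 : (0 < c)%R) (A : set R) : measurable A ->
  leb A = c%:E * pushforward leb (aff1 c a : measurableTypeR R -> measurableTypeR R) A.
Proof.
have mf : measurable_fun setT (aff1 c a : measurableTypeR R -> measurableTypeR R).
  exact: measurable_aff1.
pose m := mscale (NngNum (ltW c0)) (@measure_function_pushforward__canonical__measure_function_Measure _ _ _ _ _ leb _ mf).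
move=> mA; apply: (@lebesgue_measure_unique R m) => //= _ [[u v]] _ <-.
rewrite /m /mscale/= /pushforward.
rewrite [X in _ * leb X](_ : _ = `](u - a) / c, (v - a) / c]%classic)%R; last first.
  apply/seteqP; split => t /=; rewrite !in_itv/= /aff1 ltr_pdivrMr// ler_pdivlMr// => /andP[h1 h2]; apply/andP; split; lra.
rewrite !lebesgue_measure_itv/= !lte_fin ltr_pM2r ?invr_gt0// ltrD2r.
case: ifPn => uv; last by rewrite mule0.
by rewrite -!EFinB -EFinM; congr EFin; field; rewrite gt_eqF.
Qed.

Lemma ge0_integral_affine1 (f : R -> \bar R) (c a : R) : c != 0%R ->
  measurable_fun setT f -> (forall x, 0 <= f x) ->
  \int[leb]_t f (c * t + a)%R = (`|c|^-1)%:E * \int[leb]_t f t.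
Proof.
(* A negative c is replaced by -c through the invariance of Lebesgue measure under reflection. *)
move=> c0; wlog {c0} c0 : c f / (0 < c)%R => [ih mf f0|mf f0].
  have [cp|cn] : (0 < c)%R \/ (c < 0)%R by apply/orP; rewrite orbC -neq_lt.
    exact: ih.
  have mfa : measurable_fun setT (fun t => f (- c * t + a)%R).
    exact: (measurableT_comp mf (measurable_aff1 (- c) a)).
  have /= := ih (- c)%R f; rewrite oppr_gt0 normrN => /(_ cn mf f0) <-.
  transitivity (\int[pushforward leb (-%R : _ -> measurableTypeR R)]_t (f (- c * t + a)%R)).
    rewrite ge0_integral_pushforward//; first by apply: eq_integral => t _ /=; rewrite mulrNN.
  by apply: eq_measure_integral => A mA _; exact: lebesgue_measureN.
have mg : measurable_fun setT (aff1 c a : measurableTypeR R -> measurableTypeR R).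
  exact: measurable_aff1.
transitivity (\int[pushforward leb (aff1 c a : measurableTypeR R -> measurableTypeR R)]_t (f t)).
  by rewrite ge0_integral_pushforward.
rewrite [in RHS](eq_measure_integral (mscale (NngNum (ltW c0))
   (@measure_function_pushforward__canonical__measure_function_Measure _ _ _ _ _ leb _ mg))); last first.
  by move=> A mA _; exact: lebesgue_measure_affine.
rewrite ge0_integral_mscale//= muleA -EFinM gtr0_norm// mulVf ?gt_eqF// mul1e.
by [].
Qed.
End affine1.

Section mu_theory.
Variable R : realType.
Notation leb := (@lebesgue_measure R).
Local Open Scope ereal_scope.

Lemma ge0_integral_muS n (f : 'rV[R]_n.+1 -> \bar R) : measurable_fun setT f ->
  (forall x, 0 <= f x) ->
  \int[mu]_x f x = \int[leb]_t \int[mu]_y f (rcons_mx (t, y)).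
Proof.
move=> mf f0.
rewrite /mu -/mu /mu_step.
rewrite (@ge0_integral_pushforward _ _ _ _ _ _ (@measurable_rcons_mx R n) (leb \x mu)%E)//.
rewrite preimage_setT fubini_tonelli1//.
  by apply: measurableT_comp => //; exact: measurable_rcons_mx.
by move=> x /=.
Qed.

Lemma integral_mu0 (f : 'rV[R]_0 -> \bar R) : \int[mu]_x f x = f 0%R.
Proof.
rewrite /mu integral_dirac//; first by rewrite diracT mul1e.
move=> _ Y mY; rewrite setTI.
have [h|h] := pselect (Y (f 0%R)).
  rewrite (_ : _ @^-1` _ = setT) //; apply/seteqP; split => // x _ /=.
  by rewrite (thinmx0 x).
rewrite (_ : _ @^-1` _ = set0) //; apply/seteqP; split => // x /=.
by rewrite (thinmx0 x).
Qed.

Lemma measurable_affine n (c : R) (a : 'rV[R]_n) :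
  measurable_fun setT (fun x : 'rV[R]_n => c *: x + a)%R.
Proof.
apply: measurable_rV => i.
rewrite (_ : (fun _ => _) = fun x : 'rV[R]_n => c * x ord0 i + a ord0 i)%R; last first.
  by apply/funext => x; rewrite !mxE.
apply: measurable_funD => //; apply: measurable_funM => //; exact: measurable_coord.
Qed.

Lemma ge0_integral_affine n (f : 'rV[R]_n -> \bar R) (c : R) a : c != 0%R ->
  measurable_fun setT f -> (forall x, 0 <= f x) ->
  \int[mu]_x f (c *: x + a)%R = (`|c| ^- n)%:E * \int[mu]_x f x.
Proof.
move=> c0; elim: n f a => [|n ih] f a mf f0.
  by rewrite !integral_mu0 expr0 invr1 mul1e; congr f; exact: (etrans (thinmx0 _)).
have mf' : measurable_fun setT (fun p => f (rcons_mx p)).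
  by apply: measurableT_comp => //; exact: measurable_rcons_mx.
have mf1 t : measurable_fun setT (fun y => f (rcons_mx (t, y))).
  by apply: (measurableT_comp mf') => //; exact: pair1_measurable.
rewrite !ge0_integral_muS//; last first.
  by apply: measurableT_comp => //; exact: measurable_affine.
have affE k (x b : 'rV[R]_k) i : ((c *: x + b) ord0 i = c * x ord0 i + b ord0 i)%R.
  by rewrite !mxE.
have E t y : (c *: rcons_mx (t, y) + a = rcons_mx (c * t + (runcons a).1, c *: y + (runcons a).2))%R.
  apply: (can_inj (@runconsK _ _)); rewrite rcons_mxK /runcons /=; congr (_, _).
    by rewrite affE rcons_mx0.
  by apply/rowP => j; rewrite affE [LHS]mxE affE rcons_mxS mxE.
pose G t := \int[mu]_y f (rcons_mx (t, y)).
have mG : measurable_fun setT G.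
  exact: (measurable_fun_fubini_tonelli_F (m2 := mu) _ mf' (fun=> f0 _)).
have G0 t : 0 <= G t by exact: integral_ge0.
have mGa : measurable_fun setT (fun t => G (aff1 c (runcons a).1 t)).
  exact: (measurableT_comp mG (measurable_aff1 _ _)).
transitivity (\int[leb]_t ((`|c| ^- n)%:E * G (aff1 c (runcons a).1 t))).
  apply: eq_integral => t _; under eq_integral do rewrite E.
  by rewrite (ih (fun y => f (rcons_mx (c * t + (runcons a).1, y))))%R.
have c0' : 0 <= (`|c| ^- n)%:E by rewrite lee_fin invr_ge0 exprn_ge0.
rewrite [LHS](ge0_integralZl leb measurableT mGa (fun t _ => G0 _) c0').
rewrite [X in _ * X](ge0_integral_affine1 (runcons a).1 c0 mG G0) muleA -EFinM.
by rewrite -exprVn -exprSr -exprVn.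
Qed.
End mu_theory.

(** * Open sets and continuous functions are measurable *)

Section rV_topology.
Variables (R : realType) (n : nat).

(** Second countability: U is the union of the countably many boxes with rational centre and radius
    1/(k+1) that it contains. *)
Lemma open_measurable_rV (U : set 'rV[R]_n) : open U -> measurable U.
Proof.
move=> oU.
pose B (p : 'rV[rat]_n * nat) : set 'rV[R]_n :=
  [set x | forall i, `|x ord0 i - ratr (p.1 ord0 i)| < p.2.+1%:R^-1].
have mB p : measurable (B p).
  rewrite (_ : B p = \bigcap_(i in [set: 'I_n])
      (fun x : 'rV[R]_n => x ord0 i) @^-1` [set r : R | `|r - ratr (p.1 ord0 i)| < p.2.+1%:R^-1]).
    apply: fin_bigcap_measurable => [|i _]; first exact: finite_finset.
    rewrite -[X in measurable X]setTI; apply: measurable_coord => //.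
    rewrite (_ : [set _ | _] = ball (ratr (p.1 ord0 i) : R) p.2.+1%:R^-1); first exact: measurable_ball.
    by apply/seteqP; split => r; rewrite -ball_normE /= distrC.
  by apply/seteqP; split => [x h i _|x h i]; [exact: h|exact: (h i I)].
pose F p := if `[< B p `<=` U >] then B p else set0.
have -> : U = \bigcup_p F p.
  apply/seteqP; split => [x Ux|x [p _]]; last first.
    by rewrite /F; case: ifPn => // /asboolP h /h.
  have /nbhs_ballP[e /= e0 eU] : nbhs x U by exact: open_nbhs_nbhs.
  (* A box of radius d = 1/(k+1) whose centre is within d of x lies within 2 d of x; this k makes 2
     d < e. *)
  pose k := (Num.truncn (2 / e)).
  have k1 : (0 : R) < k.+1%:R^-1 by rewrite invr_gt0 ltr0n.
  have ke : 2 * (k.+1%:R^-1) < e.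
    rewrite ltr_pdivrMr ?ltr0n// -ltr_pdivrMl// mulrC; exact: truncnS_gt.
  move: k1 ke; set d : R := k.+1%:R^-1 => k1 ke.
  have /choice[q qP] : forall i : 'I_n, exists q : rat, `|x ord0 i - ratr q| < d.
    move=> i; have h : x ord0 i - d < x ord0 i + d by lra.
    have [q] := rat_in_itvoo h; rewrite in_itv/= => /andP[h1 h2].
    by exists q; rewrite ltr_norml; apply/andP; split; lra.
  exists (\row_i q i, k) => //; rewrite /F; case: ifPn => [_ i|/negP[]].
    by rewrite mxE; exact: qP.
  apply/asboolP => y By; apply: eU; split => // i j; rewrite (ord1 i).
  have := By j; rewrite /= mxE -/d => h.
  rewrite -ball_normE /=; have := qP j => h'.
  have : `|x ord0 j - y ord0 j| <= `|x ord0 j - ratr (q j)| + `|y ord0 j - ratr (q j)|.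
    by rewrite [X in _ <= _ + X]distrC; exact: ler_distD.
  move=> h2; lra.
by apply: countable_bigcupT_measurable => // p; rewrite /F; case: ifP.
Qed.

Lemma open_neq0 : open [set x : 'rV[R]_n | x != 0].
Proof.
rewrite (_ : [set _ | _] = ~` [set 0]).
  apply: closed_openC; apply: accessible_closed_set1.
  by apply: hausdorff_accessible; exact: norm_hausdorff.
by apply/seteqP; split => x /=; [move/eqP|move=> h; apply/eqP].
Qed.

Lemma continuous_measurable_rV (U : set 'rV[R]_n) (f : 'rV[R]_n -> R) : open U ->
  {in U, continuous f} -> measurable_fun U f.
Proof.
move=> oU cf; apply: (measurability _ (RGenOpens.measurableE R)).
move=> _ [_ [a [b ->] <-]]; apply: open_measurable_rV.
rewrite openE => x [Ux fx]; apply: filterI; first exact: open_nbhs_nbhs.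
apply: cf; first exact: mem_set.
by apply: open_nbhs_nbhs; split => //; exact: interval_open.
Qed.

(** Radial extensions are continuous off the origin only; the remaining point is a measurable set on
    which every function is measurable. *)
Lemma continuous_neq0_measurable (f : 'rV[R]_n -> R) :
  (forall x, x != 0 -> {for x, continuous f}) -> measurable_fun setT f.
Proof.
move=> cf.
have m0 : measurable [set x : 'rV[R]_n | x != 0] by apply: open_measurable_rV; exact: open_neq0.
have -> : setT = [set x : 'rV[R]_n | x != 0] `|` [set 0].
  by apply/seteqP; split => // x _; case: (eqVneq x 0) => [->|h]; [right|left].
apply/measurable_funU => //.
  rewrite (_ : [set 0] = ~` [set x : 'rV[R]_n | x != 0]); first exact: measurableC.
  by apply/seteqP; split => x /=; [move=> ->; rewrite eqxx|move/negP; rewrite negbK => /eqP].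
split; last exact: measurable_fun_set1.
apply: continuous_measurable_rV; first exact: open_neq0.
by move=> x /set_mem; exact: cf.
Qed.

Lemma continuousT_measurable (f : 'rV[R]_n -> R) : continuous f -> measurable_fun setT f.
Proof. by move=> cf; apply: continuous_neq0_measurable => x _; exact: cf. Qed.

End rV_topology.

(* The iterated integral [intRn] agrees with the integral against [mu] for functions
   dominated by a multiple of the integrable product [weight]. *)
Section weight.
Variable R : realType.
Notation leb := (@lebesgue_measure R).

Lemma integral_oneDsqrV : (\int[leb]_t ((1 + t ^+ 2)^-1)%:E = pi%:E)%E.
Proof.
rewrite ge0_symfun_integralT; last 3 first.
- by move=> x; rewrite invr_ge0 addr_ge0// sqr_ge0.
- exact: (@continuous_oneDsqrV R).
- by move=> x /=; rewrite sqrrN.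
have := @integral0y_oneDsqr R; rewrite set_itvcy => ->.
by rewrite -EFinM; congr EFin; lra.
Qed.

Lemma measurable_oneDsqrV : measurable_fun setT (fun t : R => (1 + t ^+ 2)^-1).
Proof.
have h : continuous (fun t : R => (1 + t ^+ 2)^-1) by exact: (@continuous_oneDsqrV R).
exact: continuous_measurable_fun h.
Qed.

Definition weight n (x : 'rV[R]_n) : R := \prod_(i < n) (1 + x ord0 i ^+ 2)^-1.

Lemma weight_gt0 n (x : 'rV[R]_n) : 0 < weight x.
Proof. by apply: prodr_gt0 => i _; rewrite invr_gt0 ltr_pwDl// sqr_ge0. Qed.

Lemma weight_rcons n t (x : 'rV[R]_n) : weight (rcons_mx (t, x)) = (1 + t ^+ 2)^-1 * weight x.
Proof.
rewrite /weight big_ord_recl rcons_mx0; congr (_ * _).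
by apply: eq_bigr => i _; rewrite rcons_mxS.
Qed.

Lemma measurable_weight n : measurable_fun setT (@weight n).
Proof.
apply: measurable_prod => i _.
apply: (measurableT_comp (f := fun t : R => (1 + t ^+ 2)^-1)).
  exact: measurable_oneDsqrV.
exact: measurable_coord.
Qed.

Lemma integral_weight n : (\int[mu]_x (@weight n x)%:E = (pi ^+ n)%:E)%E.
Proof.
elim: n => [|n ih]; first by rewrite integral_mu0 /weight big_ord0.
rewrite ge0_integral_muS; last 2 first.
- by apply/measurable_EFinP; exact: measurable_weight.
- by move=> x; rewrite lee_fin ltW// weight_gt0.
transitivity (\int[leb]_t ((1 + t ^+ 2)^-1 * pi ^+ n)%:E)%E.
  apply: eq_integral => t _.
  under eq_integral do rewrite weight_rcons EFinM.
  rewrite ge0_integralZl//.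
  - by rewrite ih.
  - by apply/measurable_EFinP; exact: measurable_weight.
  - by move=> x _; rewrite lee_fin ltW// weight_gt0.
  - by rewrite lee_fin invr_ge0 addr_ge0// sqr_ge0.
under eq_integral do rewrite EFinM muleC.
rewrite ge0_integralZl//.
- by rewrite integral_oneDsqrV -EFinM exprSr.
- by apply/measurable_EFinP; exact: measurable_oneDsqrV.
- by move=> x _; rewrite lee_fin invr_ge0 addr_ge0// sqr_ge0.
- by rewrite lee_fin exprn_ge0// pi_ge0.
Qed.

Lemma integrable_weight n : mu.-integrable setT (EFin \o @weight n).
Proof.
apply/integrableP; split; first by apply/measurable_EFinP; exact: measurable_weight.
under eq_integral do rewrite /= gtr0_norm ?weight_gt0//.
by rewrite integral_weight ltry.
Qed.

Definition dominated n (f : 'rV[R]_n -> R) :=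
  measurable_fun setT f /\ exists C, forall x, `|f x| <= C * weight x.

Lemma dominated_integrable n (f : 'rV[R]_n -> R) : dominated f -> mu.-integrable setT (EFin \o f).
Proof.
move=> [mf [C fC]].
apply: (@le_integrable _ _ _ mu _ measurableT _ (fun x => (C%:E * (weight x)%:E)%E)).
- exact/measurable_EFinP.
- move=> x _ /=; rewrite lee_fin (le_trans (fC x))// ler_norm//.
- by apply: integrableZl => //; exact: integrable_weight.
Qed.

Lemma integral_muS n (f : 'rV[R]_n.+1 -> R) : mu.-integrable setT (EFin \o f) ->
  (\int[mu]_x (f x)%:E = \int[leb]_t \int[mu]_y (f (rcons_mx (t, y)))%:E)%E.
Proof.
move=> fi.
have mf : measurable_fun setT (EFin \o f \o @rcons_mx R n).
  by apply: measurableT_comp; [exact: measurable_int fi|exact: measurable_rcons_mx].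
have mpf := measurable_int _ fi.
have fir : (leb \x mu)%E.-integrable setT (EFin \o f \o @rcons_mx R n).
  apply/integrableP; split => //.
  have /integrableP[_] := fi.
  rewrite ge0_integral_muS//; last exact: measurableT_comp.
  move=> /(le_lt_trans _); apply.
  rewrite fubini_tonelli1//; exact: measurableT_comp.
rewrite {1}/mu -/mu /mu_step.
rewrite (@integral_pushforward _ _ _ _ _ _ (@measurable_rcons_mx R n) (leb \x mu)%E setT _ mpf)//.
by rewrite preimage_setT -integral12_prod_meas1.
Qed.

(** Integrability would pass to almost every slice only. Domination passes to every slice, with C /
    (1 + t^2) in place of C, so the induction on n can be applied at each value t of the first
    coordinate. *)
Lemma intRn_Rintegral n (f : 'rV[R]_n -> R) : dominated f -> intRn f = \int[mu]_x f x.
Proof.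
elim: n f => [|n ih] f df; first by rewrite /= /Rintegral integral_mu0.
rewrite /= /Rintegral (integral_muS (dominated_integrable df)).
congr fine; apply: eq_integral => t _.
have [mf [C fC]] := df.
have df' : dominated (fun y => f (rcons_mx (t, y))).
  split.
    apply: measurableT_comp => //.
    by apply: (measurableT_comp (measurable_rcons_mx (n := n))); exact: pair1_measurable.
  exists (C * (1 + t ^+ 2)^-1) => y; rewrite (le_trans (fC _))// weight_rcons mulrA//.
rewrite ih// /Rintegral fineK//.
by apply: integrable_fin_num => //; exact: dominated_integrable.
Qed.

End weight.

(** * Changes of variables, extended from nonnegative to integrable functions *)

Section transfer.
Context d (T : measurableType d) (R : realType) (m : {measure set T -> \bar R}).
Variables (phi : T -> T) (k : R).
Hypothesis mphi : measurable_fun setT phi.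
Hypothesis phik : forall f : T -> \bar R, measurable_fun setT f -> (forall x, 0 <= f x)%E ->
  (\int[m]_x f (phi x) = k%:E * \int[m]_x f x)%E.

Lemma integrable_transfer (f : T -> R) :
  m.-integrable setT (EFin \o f) -> m.-integrable setT (EFin \o (f \o phi)).
Proof.
move=> fi; have mf := measurable_int _ fi.
apply/integrableP; split; first exact: (measurableT_comp mf mphi).
have mfa : measurable_fun setT (abse \o (EFin \o f))%E by apply: measurableT_comp.
have -> : (fun x => `|(EFin \o (f \o phi)) x|)%E = (fun x => (abse \o (EFin \o f)) (phi x))%E by [].
rewrite phik//; last by move=> x; exact: abse_ge0.
have /integrableP[_ fo] := fi.
have h : (\int[m]_x (abse \o (EFin \o f)) x \is a fin_num)%E.
  by rewrite ge0_fin_numE//; apply: integral_ge0 => x _; exact: abse_ge0.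
by rewrite -(fineK h) -EFinM ltry.
Qed.

Lemma Rintegral_transfer (f : T -> R) : m.-integrable setT (EFin \o f) ->
  \int[m]_x f (phi x) = k * \int[m]_x f x.
Proof.
move=> fi; have mf := measurable_int _ fi.
rewrite /Rintegral.
have -> : (\int[m]_x (f (phi x))%:E = k%:E * \int[m]_x (f x)%:E)%E.
  rewrite integralE [in RHS]integralE.
  have -> : ((fun x => (f (phi x))%:E)^\+ = (fun x => ((EFin \o f)^\+ (phi x))))%E.
    by apply/funext => x; rewrite !funeposE.
  have -> : ((fun x => (f (phi x))%:E)^\- = (fun x => ((EFin \o f)^\- (phi x))))%E.
    by apply/funext => x; rewrite !funenegE.
  rewrite (phik (measurable_funepos mf) (fun x => funepos_ge0 _ x)).
  rewrite (phik (measurable_funeneg mf) (fun x => funeneg_ge0 _ x)).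
  apply/esym/muleBr => //; apply: fin_num_adde_defr; exact: integrable_pos_fin_num.
by rewrite fineM//; exact: integrable_fin_num.
Qed.
End transfer.

Section real_affine.
Variable R : realType.
Notation leb := (@lebesgue_measure R).

Section rV.
Variables (n : nat) (c : R) (a : 'rV[R]_n).
Hypothesis c0 : c != 0.
Let H := fun f => @ge0_integral_affine R n f c a c0.
Lemma integrable_affine (f : 'rV[R]_n -> R) : mu.-integrable setT (EFin \o f) ->
  mu.-integrable setT (EFin \o (fun x => f (c *: x + a))).
Proof. exact: (integrable_transfer (measurable_affine c a) H). Qed.
Lemma Rintegral_affine (f : 'rV[R]_n -> R) : mu.-integrable setT (EFin \o f) ->
  \int[mu]_x f (c *: x + a) = `|c| ^- n * \int[mu]_x f x.
Proof. exact: (Rintegral_transfer H). Qed.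
End rV.

Section line.
Variables (c a : R).
Hypothesis c0 : c != 0.
Let H := fun f => @ge0_integral_affine1 R f c a c0.
Lemma integrable_affine1 (f : R -> R) : leb.-integrable setT (EFin \o f) ->
  leb.-integrable setT (EFin \o (fun x => f (c * x + a))).
Proof. exact: (integrable_transfer (m := leb) (measurable_aff1 c a) H). Qed.
Lemma Rintegral_affine1 (f : R -> R) : leb.-integrable setT (EFin \o f) ->
  \int[leb]_x f (c * x + a) = `|c|^-1 * \int[leb]_x f x.
Proof. exact: (Rintegral_transfer (m := leb) H). Qed.
End line.
End real_affine.

(** * Fubini for real integrals under a product majorant a(x) b(y) *)

Section Rfubini.
Context d1 d2 (T1 : measurableType d1) (T2 : measurableType d2) (R : realType).
Variables (m1 : {sigma_finite_measure set T1 -> \bar R}) (m2 : {sigma_finite_measure set T2 -> \bar R}).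
Variables (f : T1 -> T2 -> R) (a : T1 -> R) (b : T2 -> R).
Hypothesis mf : measurable_fun setT (fun p : T1 * T2 => f p.1 p.2).
Hypothesis ia : m1.-integrable setT (EFin \o a).
Hypothesis ib : m2.-integrable setT (EFin \o b).
Hypothesis fab : forall x y, `|f x y| <= a x * b y.

Lemma integrable_section1 x : m2.-integrable setT (EFin \o f x).
Proof.
apply: (@le_integrable _ _ _ m2 _ measurableT _ (fun y => ((a x)%:E * (b y)%:E)%E)).
- by apply/measurable_EFinP; exact: (measurableT_comp mf (pair1_measurable x)).
- by move=> y _ /=; rewrite lee_fin (le_trans (fab x y))// ler_norm.
- exact: integrableZl.
Qed.

Lemma integrable_section2 y : m1.-integrable setT (EFin \o f ^~ y).
Proof.
apply: (@le_integrable _ _ _ m1 _ measurableT _ (fun x => ((b y)%:E * (a x)%:E)%E)).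
- by apply/measurable_EFinP; exact: (measurableT_comp mf (pair2_measurable y)).
- by move=> x _ /=; rewrite lee_fin mulrC (le_trans (fab x y))// ler_norm.
- exact: integrableZl.
Qed.

Lemma integrable_prod : (m1 \x m2)%E.-integrable setT (EFin \o (fun p => f p.1 p.2)).
Proof.
apply/integrable12ltyP; first exact/measurable_EFinP.
have B0 y : (0 <= `|b y|%:E)%E by rewrite lee_fin.
have mB : measurable_fun setT (fun y => `|b y|%:E).
  have /integrableP[/measurable_EFinP h _] := ib.
  by apply/measurable_EFinP; apply: measurableT_comp.
have b0 : (0 <= \int[m2]_y (`|b y|)%:E)%E by apply: integral_ge0 => y _; rewrite lee_fin.
apply: (@le_lt_trans _ _ (\int[m1]_x ((fine (\int[m2]_y (`|b y|)%:E)%E)%:E * `|(a x)%:E|)%E)%E).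
  apply: ge0_le_integral => //.
  - by move=> x _; exact: integral_ge0.
  - apply: (measurable_fun_fubini_tonelli_F (m2 := m2) (fun p => `|(f p.1 p.2)%:E|)%E) => //.
    by apply: measurableT_comp => //; exact/measurable_EFinP.
  - apply: emeasurable_funM => //; apply: measurableT_comp => //.
    exact: measurable_int ia.
  - move=> x _; rewrite fineK; last first.
      have /integrableP[_ h] := ib.
      by rewrite ge0_fin_numE.
    rewrite muleC -[leRHS](ge0_integralZl m2 measurableT mB (fun y _ => B0 y) (abse_ge0 _)).
    apply: ge0_le_integral => //.
    + apply: measurableT_comp => //; apply/measurable_EFinP.
      exact: (measurableT_comp mf (pair1_measurable x)).
    + exact: emeasurable_funM.
    + move=> y _; rewrite -EFinM lee_fin -normrM (le_trans (fab x y))//.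
      exact: ler_norm.
rewrite ge0_integralZl//.
- have /integrableP[_ h] := ia.
  have h' : (\int[m1]_x `|(a x)%:E| \is a fin_num)%E by rewrite ge0_fin_numE// integral_ge0.
  by rewrite -(fineK h') -EFinM ltry.
- apply: measurableT_comp => //; exact: measurable_int ia.
- by rewrite lee_fin fine_ge0.
Qed.

Lemma Rintegral_fubini :
  \int[m1]_x \int[m2]_y f x y = \int[m2]_y \int[m1]_x f x y.
Proof.
rewrite /Rintegral; congr fine.
transitivity (\int[m1]_x \int[m2]_y (f x y)%:E)%E.
  apply: eq_integral => x _; rewrite fineK//.
  by apply: integrable_fin_num => //; exact: integrable_section1.
rewrite (Fubini integrable_prod).
apply: eq_integral => y _; rewrite fineK//.
by apply: integrable_fin_num => //; exact: integrable_section2.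
Qed.

Lemma integrable_Rintegral1 : m1.-integrable setT (EFin \o (fun x => \int[m2]_y f x y)).
Proof.
have := integrable_fubini_F integrable_prod; apply: eq_integrable => // x _.
rewrite /fubini_F /= /Rintegral fineK//.
by apply: integrable_fin_num => //; exact: integrable_section1.
Qed.
End Rfubini.

(** * Scalar product and Euclidean norm *)

Section euclidean.
Variables (R : realType) (n : nat).
Implicit Types x y z : 'rV[R]_n.

Lemma dotpC x y : dotp x y = dotp y x.
Proof. by apply: eq_bigr => i _; rewrite mulrC. Qed.
Lemma dotpDl x y z : dotp (x + y) z = dotp x z + dotp y z.
Proof. by rewrite -big_split/=; apply: eq_bigr => i _; rewrite mxE mulrDl. Qed.
Lemma dotpZl (c : R) x y : dotp (c *: x) y = c * dotp x y.
Proof. by rewrite /dotp mulr_sumr; apply: eq_bigr => i _; rewrite mxE mulrA. Qed.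
Lemma dotpDr x y z : dotp x (y + z) = dotp x y + dotp x z.
Proof. by rewrite dotpC dotpDl ![dotp _ x]dotpC. Qed.
Lemma dotpZr (c : R) x y : dotp x (c *: y) = c * dotp x y.
Proof. by rewrite dotpC dotpZl dotpC. Qed.
Lemma dotpNl x y : dotp (- x) y = - dotp x y.
Proof. by rewrite -scaleN1r dotpZl mulN1r. Qed.
Lemma dotpNr x y : dotp x (- y) = - dotp x y.
Proof. by rewrite dotpC dotpNl dotpC. Qed.
Lemma dotp0l y : dotp 0 y = 0.
Proof. by rewrite -(scale0r y) dotpZl mul0r. Qed.
Lemma dotp_ge0 x : 0 <= dotp x x.
Proof. by apply: sumr_ge0 => i _; rewrite -expr2 sqr_ge0. Qed.
Lemma sqr_coord_le x i : x ord0 i ^+ 2 <= dotp x x.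
Proof.
rewrite /dotp (bigD1 i)//= -expr2 lerDl sumr_ge0// => j _.
by rewrite -expr2 sqr_ge0.
Qed.
Lemma dotp_eq0 x : (dotp x x == 0) = (x == 0).
Proof.
apply/eqP/eqP => [x0|->]; last exact: dotp0l.
apply/rowP => i; have := sqr_coord_le x i; rewrite x0 mxE => h.
by apply/eqP; rewrite -sqrf_eq0 eq_le h sqr_ge0.
Qed.
Lemma dotp_gt0 x : (0 < dotp x x) = (x != 0).
Proof. by rewrite lt_neqAle dotp_ge0 andbT eq_sym dotp_eq0. Qed.
Lemma enorm_ge0 x : 0 <= enorm x. Proof. exact: sqrtr_ge0. Qed.
Lemma sqr_enorm x : enorm x ^+ 2 = dotp x x.
Proof. by rewrite sqr_sqrtr// dotp_ge0. Qed.
Lemma enorm_gt0 x : (0 < enorm x) = (x != 0).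
Proof. by rewrite sqrtr_gt0 dotp_gt0. Qed.
Lemma enorm0 : enorm (0 : 'rV[R]_n) = 0.
Proof. by rewrite /enorm dotp0l sqrtr0. Qed.
Lemma enormZ (c : R) x : enorm (c *: x) = `|c| * enorm x.
Proof. by rewrite /enorm dotpZl dotpZr mulrA -expr2 sqrtrM ?sqr_ge0// sqrtr_sqr. Qed.
Lemma enormN x : enorm (- x) = enorm x.
Proof. by rewrite -scaleN1r enormZ normrN1 mul1r. Qed.
Lemma enorm_normalize x : x != 0 -> enorm ((enorm x)^-1 *: x) = 1.
Proof.
by move=> x0; rewrite enormZ ger0_norm ?invr_ge0 ?enorm_ge0// mulVf// gt_eqF// enorm_gt0.
Qed.
Lemma normr_coord_le x i : `|x ord0 i| <= enorm x.
Proof. by rewrite -sqrtr_sqr ler_sqrt ?dotp_ge0// sqr_coord_le. Qed.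
Lemma dotp_le x y : `|dotp x y| <= (dotp x x + dotp y y) / 2.
Proof.
have h1 := dotp_ge0 (x + y); have h2 := dotp_ge0 (x - y).
rewrite ler_norml; move: h1 h2; rewrite !dotpDl !dotpDr !dotpNl !dotpNr (dotpC y x) opprK => h1 h2.
apply/andP; split; lra.
Qed.

Lemma continuous_dotp (v : 'rV[R]_n) : continuous (fun x : 'rV[R]_n => dotp x v).
Proof.
rewrite /dotp; apply: continuous_big => [|i _ x]; first exact: add_continuous.
by apply: continuousM; [exact: coord_continuous|exact: cst_continuous].
Qed.
Lemma continuous_sqrnorm : continuous (fun x : 'rV[R]_n => dotp x x).
Proof.
rewrite /dotp; apply: continuous_big => [|i _ x]; first exact: add_continuous.
by apply: continuousM; exact: coord_continuous.
Qed.
Lemma continuous_enorm : continuous (@enorm R n).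
Proof.
move=> x; apply: (@continuous_comp _ _ _ (fun x => dotp x x) Num.sqrt).
  exact: continuous_sqrnorm.
exact: sqrt_continuous.
Qed.
Lemma measurable_enorm : measurable_fun setT (@enorm R n).
Proof. by apply: continuousT_measurable; exact: continuous_enorm. Qed.
Lemma measurable_dotp d (T : measurableType d) (f g : T -> 'rV[R]_n) :
  measurable_fun setT f -> measurable_fun setT g ->
  measurable_fun setT (fun t => dotp (f t) (g t)).
Proof.
move=> mf mg; apply: measurable_sum => i; apply: measurable_funM.
  exact: (measurableT_comp (measurable_coord i) mf).
exact: (measurableT_comp (measurable_coord i) mg).
Qed.
Lemma measurable_scale d (T : measurableType d) (r : T -> R) (f : T -> 'rV[R]_n) :
  measurable_fun setT r -> measurable_fun setT f ->
  measurable_fun setT (fun t => r t *: f t).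
Proof.
move=> mr mf; apply: measurable_rV => i.
rewrite (_ : (fun _ => _) = (fun t => r t * f t ord0 i)); last by apply/funext => t; rewrite mxE.
by apply: measurable_funM => //; exact: (measurableT_comp (measurable_coord i) mf).
Qed.

Lemma weight_lb (M : R) x : enorm x <= M -> (1 + M ^+ 2)^-1 ^+ n <= weight x.
Proof.
move=> xM; have -> : (1 + M ^+ 2)^-1 ^+ n = \prod_(i < n) (1 + M ^+ 2)^-1.
  by rewrite prodr_const card_ord.
apply: ler_prod => i _.
have h : x ord0 i ^+ 2 <= M ^+ 2.
  rewrite (le_trans (sqr_coord_le x i))// -sqr_enorm ler_sqr ?nnegrE ?enorm_ge0//.
  exact: le_trans (enorm_ge0 x) xM.
have p (r : R) : 0 < 1 + r ^+ 2 by rewrite ltr_pwDl// sqr_ge0.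
by rewrite invr_ge0 (ltW (p _))/= lef_pV2 ?posrE ?p// lerD2l.
Qed.

(** On the ball of radius M the weight is at least e > 0, so C / e times the weight exceeds C there;
    outside the ball the function vanishes. *)
Lemma dominated_bounded (f : 'rV[R]_n -> R) (M C : R) : measurable_fun setT f ->
  (forall x, `|f x| <= C) -> (forall x, M < enorm x -> f x = 0) -> dominated f.
Proof.
move=> mf fC fM; split => //.
have C0 : 0 <= C by apply: le_trans (fC 0).
pose e : R := (1 + M ^+ 2)^-1 ^+ n.
have e0 : 0 < e by rewrite exprn_gt0// invr_gt0 ltr_pwDl// sqr_ge0.
exists (C / e) => x.
have [xM|xM] := leP (enorm x) M; last first.
  by rewrite fM// normr0 mulr_ge0// ?divr_ge0// ltW// weight_gt0.
rewrite (le_trans (fC x))// -mulrA ler_peMr//.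
by rewrite mulrC ler_pdivlMr// mul1r weight_lb.
Qed.

Lemma compact_ball (M : R) : compact [set x : 'rV[R]_n | enorm x <= M].
Proof.
apply: bounded_closed_compact; last first.
  apply: (@preimage_closed _ _ (@enorm R n) [set r | r <= M]).
    by move=> x _; exact: continuous_enorm.
  exact: closed_le.
exists M; split; first exact: num_real.
move=> x Mx y /= yM; rewrite (_ : `|y| = mx_norm y)// mx_normrE; apply: bigmax_le => [|[i j] _ /=].
  by rewrite (le_trans _ (ltW Mx))// (le_trans (enorm_ge0 y)).
by rewrite (ord1 i) (le_trans (normr_coord_le _ _))// (le_trans yM)// ltW.
Qed.

Lemma continuous_bounded_ball (f : 'rV[R]_n -> R) (K : set 'rV[R]_n) : compact K ->
  (forall x, K x -> {for x, continuous f}) -> exists C, 0 <= C /\ forall x, K x -> `|f x| <= C.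
Proof.
move=> cK cf.
have cpt : compact (f @` K).
  apply: continuous_compact => //; apply: continuous_in_subspaceT => x /set_mem; exact: cf.
have [M [_ hM]] := compact_bounded cpt.
exists (`|M| + 1); split => [|x Kx]; first by rewrite addr_ge0.
apply: (hM (`|M| + 1)); last by exists x.
by rewrite (le_lt_trans (ler_norm _))// ltrDl.
Qed.
End euclidean.

(** * Smooth functions *)

Section smooth_calculus.
Variables (R : realType) (n : nat).
Notation V := 'rV[R]_n.
Implicit Types (f g u : V -> R) (U : set V).

Lemma dotp0r (x : V) : dotp x 0 = 0.
Proof. by rewrite dotpC dotp0l. Qed.

Lemma iderive_cat (vs ws : seq V) f : iderive (vs ++ ws) f = iderive vs (iderive ws f).
Proof. by elim: vs => //= v vs ->. Qed.

Lemma near_eq_continuous f g x : (\near x, f x = g x) -> {for x, continuous f} -> {for x, continuous g}.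
Proof.
move=> fg cf; rewrite /prop_for /continuous_at -(nbhs_singleton fg).
exact: (cvg_trans (near_eq_cvg fg) cf).
Qed.

Lemma iderive_eq_on U f g vs : open U -> (forall x, U x -> f x = g x) ->
  forall x, U x -> iderive vs f x = iderive vs g x.
Proof.
move=> oU fg; elim: vs => //= v vs ih x Ux.
apply: near_eq_derive; apply: filterS ih _; exact: open_nbhs_nbhs.
Qed.

Lemma smooth_on_eq U f g : open U -> (forall x, U x -> f x = g x) ->
  smooth_on U g -> smooth_on U f.
Proof.
move=> oU fg sg vs x Ux.
have e : \near x, iderive vs g x = iderive vs f x.
  apply: (@filterS _ (nbhs x) _ U); last exact: open_nbhs_nbhs.
  by move=> y Uy; apply/esym; exact: iderive_eq_on Uy.
have [c d] := sg vs x Ux; split; first exact: near_eq_continuous c.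
by move=> v; apply: near_eq_derivable (d v).
Qed.

Lemma smooth_onS U U' f : U' `<=` U -> smooth_on U f -> smooth_on U' f.
Proof. by move=> UU sf vs x /UU; exact: sf. Qed.

Lemma smooth_onU U U' f : smooth_on U f -> smooth_on U' f -> smooth_on (U `|` U') f.
Proof. by move=> sf sf' vs x [|]; [exact: sf|exact: sf']. Qed.

Lemma smooth_continuous U f : smooth_on U f -> forall x, U x -> {for x, continuous f}.
Proof. by move=> sf x Ux; exact: (sf [::] x Ux).1. Qed.

Lemma smooth_derivable U f : smooth_on U f -> forall x v, U x -> derivable f x v.
Proof. by move=> sf x v Ux; exact: (sf [::] x Ux).2. Qed.

Lemma smooth_derive U f v : smooth_on U f -> smooth_on U (fun x => 'D_v f x).
Proof. by move=> sf vs; have := sf (vs ++ [:: v]); rewrite iderive_cat. Qed.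

(** Smoothness by coinduction: it suffices to exhibit a class of continuous, directionally derivable
    functions that is closed under 'D_v. Closure is asked only up to equality on U; since U is open,
    such an equality survives further derivation. *)
Lemma smooth_coind (P : (V -> R) -> Prop) U : open U ->
  (forall f, P f -> forall x, U x -> {for x, continuous f} /\ forall v, derivable f x v) ->
  (forall f v, P f -> exists2 g, P g & forall x, U x -> 'D_v f x = g x) ->
  forall f, P f -> smooth_on U f.
Proof.
move=> oU P0 P1 f Pf.
have H vs : exists2 g, P g & forall x, U x -> iderive vs f x = g x.
  elim: vs => [|v vs [g Pg fg]]; first by exists f.
  have [g' Pg' gg'] := P1 g v Pg; exists g' => // x Ux.
  by rewrite -gg'//; exact: (@iderive_eq_on U (iderive vs f) g [:: v]).
move=> vs x Ux; have [g Pg fg] := H vs.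
have e : \near x, g x = iderive vs f x.
  apply: (@filterS _ (nbhs x) _ U); last exact: open_nbhs_nbhs.
  by move=> y Uy; rewrite fg.
have [c d] := P0 g Pg x Ux; split; first exact: near_eq_continuous c.
by move=> v; apply: near_eq_derivable (d v).
Qed.

Inductive algebra_gen (B : (V -> R) -> Prop) : (V -> R) -> Prop :=
| gen_base f : B f -> algebra_gen B f
| gen_add f g : algebra_gen B f -> algebra_gen B g -> algebra_gen B (fun x => f x + g x)
| gen_mul f g : algebra_gen B f -> algebra_gen B g -> algebra_gen B (fun x => f x * g x).

(** By the Leibniz rule, sums of products of generators are closed under derivation as soon as the
    derivatives of the generators are again sums of products of generators. *)
Lemma smooth_algebra (B : (V -> R) -> Prop) U : open U ->
  (forall f, B f -> forall x, U x -> {for x, continuous f} /\ forall v, derivable f x v) ->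
  (forall f v, B f -> exists2 g, algebra_gen B g & forall x, U x -> 'D_v f x = g x) ->
  forall f, algebra_gen B f -> smooth_on U f.
Proof.
move=> oU B0 B1.
have P0 f : algebra_gen B f -> forall x, U x -> {for x, continuous f} /\ forall v, derivable f x v.
  elim=> {f} [f Bf|f g _ ihf _ ihg|f g _ ihf _ ihg] x Ux; first exact: B0.
  - have [cf df] := ihf x Ux; have [cg dg] := ihg x Ux.
    by split=> [|v]; [exact: continuousD|exact: derivableD].
  - have [cf df] := ihf x Ux; have [cg dg] := ihg x Ux.
    by split=> [|v]; [exact: continuousM|exact: derivableM].
apply: smooth_coind => // f v; elim=> {f} [f Bf|f g Pf [f' Pf' ff'] Pg [g' Pg' gg']|
    f g Pf [f' Pf' ff'] Pg [g' Pg' gg']]; first exact: B1.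
- exists (fun x => f' x + g' x); first exact: gen_add.
  move=> x Ux; rewrite -ff'// -gg'//; apply: deriveD; [exact: (P0 f Pf x Ux).2|exact: (P0 g Pg x Ux).2].
- exists (fun x => f x * g' x + g x * f' x).
    by apply: gen_add; apply: gen_mul.
  move=> x Ux; rewrite -ff'// -gg'//.
  by rewrite (@deriveM _ _ f g x v)//; [exact: (P0 f Pf x Ux).2|exact: (P0 g Pg x Ux).2].
Qed.

Let smooth_gen U f : open U -> algebra_gen (smooth_on U) f -> smooth_on U f.
Proof.
move=> oU; apply: smooth_algebra => // {}f.
  by move=> sf x Ux; split=> [|v]; [exact: smooth_continuous sf x Ux|exact: smooth_derivable sf x v Ux].
by move=> v sf; exists (fun x => 'D_v f x) => //; apply: gen_base; exact: smooth_derive.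
Qed.

Lemma smoothD U f g : open U -> smooth_on U f -> smooth_on U g -> smooth_on U (fun x => f x + g x).
Proof. by move=> oU sf sg; apply: smooth_gen => //; apply: gen_add; apply: gen_base. Qed.

Lemma smoothM U f g : open U -> smooth_on U f -> smooth_on U g -> smooth_on U (fun x => f x * g x).
Proof. by move=> oU sf sg; apply: smooth_gen => //; apply: gen_mul; apply: gen_base. Qed.

Lemma is_derive_dotp (w x v : V) : is_derive x v (fun x => dotp x w) (dotp v w).
Proof.
have c : (fun h => h^-1 *: (((fun x => dotp x w) \o shift x) (h *: v) - dotp x w)) @ 0^' --> dotp v w.
  apply: (cvg_trans _ (@cvg_cst _ (dotp v w) _ (0^' : set_system R) _)).
  apply: near_eq_cvg; near=> h.
  rewrite /= dotpDl dotpZl addrK /GRing.scale/= mulKf//.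
  by near: h; exact: nbhs_dnbhs_neq.
by apply: DeriveDef; [apply/cvg_ex; exists (dotp v w)|exact: cvg_lim].
Unshelve. all: by end_near. Qed.

Lemma smooth_affine U (c : R) (w : V) : open U -> smooth_on U (fun x => c + dotp x w).
Proof.
move=> oU.
have D d (w' x v : V) : is_derive x v (fun x => d + dotp x w') (dotp v w').
  have := is_deriveD (is_derive_cst d x v) (is_derive_dotp w' x v).
  by rewrite add0r.
apply: (@smooth_coind (fun f => exists d w', f = fun x => d + dotp x w')) => //.
- move=> _ [d [w' ->]] x _; split=> [|v]; last exact: ex_derive.
  by apply: continuousD; [exact: cst_continuous|exact: continuous_dotp].
- move=> _ v [d [w' ->]]; exists (fun x => dotp v w' + dotp x 0).
    by exists (dotp v w'), 0.
  by move=> x _; rewrite derive_val dotp0r addr0.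
- by exists c, w.
Qed.

Lemma smooth_cst U (c : R) : open U -> smooth_on U (fun=> c).
Proof.
move=> oU; have := @smooth_affine U c 0 oU; apply: smooth_on_eq => // x _.
by rewrite dotp0r addr0.
Qed.

Lemma smooth_dotp U (w : V) : open U -> smooth_on U (fun x => dotp x w).
Proof.
by move=> oU; have := @smooth_affine U 0 w oU; apply: smooth_on_eq => // x _; rewrite add0r.
Qed.

Lemma smooth_sum U m (F : 'I_m -> V -> R) : open U -> (forall i, smooth_on U (F i)) ->
  smooth_on U (fun x => \sum_(i < m) F i x).
Proof.
move=> oU; elim: m F => [|m ih] F sF.
  by have := @smooth_cst U 0 oU; apply: smooth_on_eq => // x _; rewrite big_ord0.
have := smoothD oU (sF ord0) (ih _ (fun i => sF (lift ord0 i))).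
by apply: smooth_on_eq => // x _; rewrite big_ord_recl.
Qed.

Lemma dotp_delta (x : V) i : dotp x (delta_mx 0 i) = x ord0 i.
Proof.
rewrite /dotp (bigD1 i)//= mxE !eqxx mulr1 big1 ?addr0// => j ji.
by rewrite mxE (negbTE ji) andbF mulr0.
Qed.

Lemma smooth_sqrnorm U : open U -> smooth_on U (fun x => dotp x x).
Proof.
move=> oU; apply: smooth_sum => // i.
have := @smooth_dotp U (delta_mx 0 i) oU => s.
by have := smoothM oU s s; apply: smooth_on_eq => // x _; rewrite dotp_delta.
Qed.

Lemma derive_line f (x v : V) : 'D_v f x = 'D_1 (fun h : R => f (h *: v + x)) 0.
Proof.
rewrite /derive; set g1 := fun h => h^-1 *: _; set g2 := fun h => h^-1 *: _.
suff -> : g1 = g2 by [].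
by apply/funext => h; rewrite /g1 /g2 /= addr0 scale0r add0r [_%:A]mulr1.
Qed.

Lemma is_derive_line f (x v : V) (l : R) :
  is_derive x v f l <-> is_derive (0 : R) 1 (fun h : R => f (h *: v + x)) l.
Proof.
split=> -[d e]; apply: DeriveDef.
- exact: (derivable1P f x v).1 d.
- by rewrite -e derive_line.
- exact: (derivable1P f x v).2 d.
- by rewrite -e derive_line.
Qed.

Lemma is_derive_comp1 (b : R -> R) (b' : R) u x v : derivable u x v ->
  is_derive (u x) 1 b b' -> is_derive x v (b \o u) (b' * 'D_v u x).
Proof.
move=> du db; apply/is_derive_line.
have dl := (is_derive_line u x v _).1 (derivableP du).
apply: (@is_derive1_comp _ b (fun h : R => u (h *: v + x))) => //.
by rewrite scale0r add0r.
Qed.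

(** The chain rule gives b'(u) 'D_v u, a product of a composite from the same family and a smooth
    function; the algebra generated by both kinds of functions is thus closed under derivation. Q is
    a family of functions of one variable that is stable under derivation on I, such as c t^r on t >
    0 or cos(t + c). *)
Lemma smooth_comp (Q : (R -> R) -> Prop) (I : set R) U u : open U ->
  (forall b, Q b -> exists2 b', Q b' & forall t, I t -> is_derive t 1 b (b' t)) ->
  smooth_on U u -> (forall x, U x -> I (u x)) ->
  forall b, Q b -> smooth_on U (b \o u).
Proof.
move=> oU Qd su uI b Qb.
pose B f := smooth_on U f \/ exists2 b, Q b & f = b \o u.
apply: (@smooth_algebra B) => //; last by apply: gen_base; right; exists b.
- move=> f [sf|[c Qc ->]] x Ux.
    by split=> [|v]; [exact: smooth_continuous sf x Ux|exact: smooth_derivable sf x v Ux].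
  have [c' _ cc'] := Qd c Qc.
  have dux v : derivable u x v by apply: (smooth_derivable su).
  have h := cc' _ (uI x Ux).
  split=> [|v]; last by apply: ex_derive; exact: is_derive_comp1.
  apply: continuous_comp; first exact: smooth_continuous su x Ux.
  by apply: differentiable_continuous; apply/derivable1_diffP; exact: ex_derive.
- move=> f v [sf|[c Qc ->]].
    by exists (fun x => 'D_v f x) => //; apply: gen_base; left; exact: smooth_derive.
  have [c' Qc' cc'] := Qd c Qc.
  exists (fun x => c' (u x) * 'D_v u x).
    apply: (gen_mul (f := c' \o u)); apply: gen_base; first by right; exists c'.
    by left; exact: smooth_derive.
  move=> x Ux; have dux : derivable u x v by apply: (smooth_derivable su).
  have := is_derive_comp1 dux (cc' _ (uI x Ux)).
  by move=> h; rewrite derive_val.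
Qed.

Lemma is_derive_powR (c r t : R) : 0 < t ->
  is_derive t 1 (fun t => c * t `^ r) (c * r * t `^ (r - 1)).
Proof.
move=> t0.
have d : derivable (fun t : R => t `^ r) t 1.
  by apply: derivable_powR; rewrite in_itv/= t0.
have e : 'D_1 (fun t : R => t `^ r) t = r * t `^ (r - 1).
  by rewrite -derive1E powR_derive1// in_itv/= t0.
have := is_deriveZ c (DeriveDef d e).
by rewrite /GRing.scale/= mulrA.
Qed.

Lemma enorm_powR (x : V) (s : R) : enorm x `^ s = (dotp x x) `^ (s / 2).
Proof. by rewrite /enorm -powR12_sqrt ?dotp_ge0// -powRrM mulrC. Qed.

Lemma smooth_enorm_pow (s : R) : smooth_on [set x : V | x != 0] (fun x => enorm x `^ s).
Proof.
have o := @open_neq0 R n.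
pose Q (b : R -> R) := exists c r, b = fun t => c * t `^ r.
have : smooth_on [set x : V | x != 0] ((fun t => 1 * t `^ (s / 2)) \o (fun x : V => dotp x x)).
  apply: (@smooth_comp Q [set t : R | 0 < t]) => //.
  - move=> _ [c [r ->]]; exists (fun t => c * r * t `^ (r - 1)); first by exists (c * r), (r - 1).
    by move=> t /=; exact: is_derive_powR.
  - exact: smooth_sqrnorm.
  - by move=> x /=; rewrite dotp_gt0.
  - by exists 1, (s / 2).
by apply: smooth_on_eq => // x _ /=; rewrite mul1r enorm_powR.
Qed.

Lemma open_enorm_lt (e : R) : open [set x : V | enorm x < e].
Proof.
apply: (@open_comp _ _ (@enorm R n) [set r | r < e]); last exact: open_lt.
by move=> x _; exact: continuous_enorm.
Qed.

Lemma smooth_extend0 f (e : R) : 0 < e -> smooth_on [set x | x != 0] f ->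
  (forall x, enorm x < e -> f x = 0) -> smooth_on setT f.
Proof.
move=> e0 sf f0.
have s0 : smooth_on [set x : V | enorm x < e] f.
  have := @smooth_cst [set x : V | enorm x < e] 0 (@open_enorm_lt e).
  by apply: smooth_on_eq => //; exact: open_enorm_lt.
apply: smooth_onS (smooth_onU sf s0) => x _ /=.
by have [->|x0] := eqVneq x 0; [right; rewrite enorm0|left].
Qed.
End smooth_calculus.

(** * A smooth function vanishing exactly on the nonpositive half line *)

Section bump.
Variable R : realType.

(** This is u/k <= exp(u/k) raised to the power k; for k = 0 the convention 0^0 = 1 gives 1 <=
    exp(u). *)
Lemma exprn_le_expR (k : nat) (u : R) : 0 <= u -> u ^+ k <= k%:R ^+ k * expR u.
Proof.
move=> u0; case: k => [|k]; first by rewrite !expr0 mul1r -expR0 ler_expR.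
have k0 : (0 : R) < k.+1%:R by rewrite ltr0n.
have h : u / k.+1%:R <= expR (u / k.+1%:R).
  by rewrite (le_trans _ (expR_ge1Dx _))// lerDr.
have : (u / k.+1%:R) ^+ k.+1 <= expR (u / k.+1%:R) ^+ k.+1.
  by rewrite ler_pXn2r// nnegrE ?expR_ge0// divr_ge0// ltW.
rewrite -expRM_natl [k.+1%:R * _]mulrC divfK ?gt_eqF// expr_div_n ler_pdivrMr ?exprn_gt0//.
by rewrite mulrC.
Qed.

Lemma poly_le_expR (p : {poly R}) : exists2 C, 0 <= C & forall u, 0 <= u -> `|p.[u]| <= C * expR u.
Proof.
exists (\sum_(i < size p) `|p`_i| * i%:R ^+ i).
  by apply: sumr_ge0 => i _; rewrite mulr_ge0// exprn_ge0.
move=> u u0; rewrite horner_coef (le_trans (ler_norm_sum _ _ _))// mulr_suml.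
apply: ler_sum => i _; rewrite normrM -mulrA ler_wpM2l// ger0_norm ?exprn_ge0//.
exact: exprn_le_expR.
Qed.

(* The functions p(1/t) exp(-1/t) on t > 0, extended by 0, are closed under derivation. *)
Definition poly_bump (p : {poly R}) (t : R) : R :=
  if 0 < t then p.[t^-1] * expR (- t^-1) else 0.

(** With X standing for 1/t, the inner derivative of 1/t is -X^2, while exp(-1/t) contributes +X^2
    p. *)
Definition bump_deriv (p : {poly R}) : {poly R} := 'X^2 * (p - p^`()).

Lemma is_derive0_sqr (f : R -> R) (C : R) : (forall h, `|f h - f 0| <= C * h ^+ 2) ->
  is_derive (0 : R) 1 f 0.
Proof.
move=> fC.
have C0 : 0 <= C by have := fC 1; rewrite expr1n mulr1; apply: le_trans.
have c : (fun h => h^-1 *: ((f \o shift 0) (h *: (1 : R)) - f 0)) @ (0 : R)^' --> (0 : R).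
  apply/cvgrPdist_lt => e e0; near=> h.
  have h0 : h != 0 by near: h; exact: nbhs_dnbhs_neq.
  rewrite /= sub0r normrN addr0 [_%:A]mulr1 normrM normfV mulrC.
  rewrite ltr_pdivrMr ?normr_gt0// (le_lt_trans (fC h))//.
  have -> : C * h ^+ 2 = C * `|h| * `|h| by rewrite -mulrA -expr2 real_normK// num_real.
  rewrite ltr_pM2r ?normr_gt0//.
  (* C may be 0, so the division is by C + 1. *)
  have hd : `|h| < e / (C + 1).
    near: h; apply: cvg_within; apply/nbhs_ballP; exists (e / (C + 1)) => /=.
      by rewrite divr_gt0// ltr_wpDl.
    by move=> y; rewrite -ball_normE /= sub0r normrN.
  rewrite (@le_lt_trans _ _ ((C + 1) * `|h|))//; first by rewrite ler_wpM2r// lerDl.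
  by rewrite mulrC -ltr_pdivlMr// ltr_wpDl.
by apply: DeriveDef; [apply/cvg_ex; exists 0|exact: cvg_lim].
Unshelve. all: by end_near. Qed.

Lemma is_derive_poly_bump (p : {poly R}) (t : R) :
  is_derive t 1 (poly_bump p) (poly_bump (bump_deriv p) t).
Proof.
have [t0|t0|->] := ltgtP t 0.
- apply: (@near_eq_is_derive _ _ _ (cst 0)).
    near=> s; rewrite /poly_bump ifF//; apply/negbTE; rewrite -leNgt ltW//.
    by near: s; exact: lt_nbhsl.
  rewrite /poly_bump ifF//; last by apply/negbTE; rewrite -leNgt ltW.
  exact: is_derive_cst.
- pose g (s : R) : R := p.[s^-1] * expR (- s^-1).
  apply: (@near_eq_is_derive _ _ _ g).
    near=> s; rewrite /poly_bump ifT//.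
    by near: s; exact: lt_nbhsr.
  rewrite /poly_bump t0.
  have t0' : t != 0 by rewrite gt_eqF.
  have di : is_derive t 1 (fun s : R => s^-1) (- t ^- 2).
    have := is_deriveV t0' (is_derive_id t 1); rewrite /GRing.scale/= mulr1.
    by [].
  have dn : is_derive t 1 (fun s : R => - s^-1) (t ^- 2).
    by have := is_deriveN di; rewrite opprK.
  have d1 := is_derive1_comp (is_derive_poly p t^-1) di.
  have d2 := @is_derive1_comp R expR (fun s : R => - s^-1) t _ _ (is_derive_expR (- t^-1)) dn.
  have d := is_deriveM d1 d2; apply: (is_derive_eq d).
  rewrite /bump_deriv hornerM hornerXn hornerD hornerN -!exprVn.
  by rewrite /GRing.scale /=; ring.
- rewrite /poly_bump ltxx -/(poly_bump p).
  (* At t = 0 it is X^2 p, not p, that is compared with the exponential: the two extra powers of 1/h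
     become the bound C h^2, which forces derivative 0. *)
  have [C C0 hC] := poly_le_expR ('X^2 * p).
  apply: (@is_derive0_sqr _ C) => h.
  rewrite {2}/poly_bump ltxx subr0 /poly_bump.
  case: ifPn => h0; last by rewrite normr0 mulr_ge0// sqr_ge0.
  have hi : 0 <= h^-1 by rewrite invr_ge0 ltW.
  have := hC _ hi; rewrite !hornerE normrM (ger0_norm (sqr_ge0 _)) => hh.
  rewrite normrM (ger0_norm (expR_ge0 _)) expRN ler_pdivrMr ?expR_gt0//.
  have E : `|p.[h^-1]| <= C * expR h^-1 * h ^+ 2.
    by rewrite -ler_pdivrMr ?exprn_gt0// (le_trans _ hh)// [leRHS]mulrC exprVn.
  have e : C * expR h^-1 * h ^+ 2 = C * h * h * expR h^-1 by ring.
  by rewrite e in E.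
Unshelve. all: by end_near. Qed.

Definition bump : R -> R := poly_bump 1.

Lemma bump_ge0 t : 0 <= bump t.
Proof. by rewrite /bump /poly_bump; case: ifP => // _; rewrite hornerC mul1r expR_ge0. Qed.

Lemma bump_gt0 t : (0 < bump t) = (0 < t).
Proof. by rewrite /bump /poly_bump; case: ifP => //; rewrite hornerC mul1r expR_gt0. Qed.

Lemma bump_le0 t : t <= 0 -> bump t = 0.
Proof. by rewrite /bump /poly_bump leNgt; case: ifP. Qed.

Lemma smooth_bump n (U : set 'rV[R]_n) (u : 'rV[R]_n -> R) : open U -> smooth_on U u ->
  smooth_on U (bump \o u).
Proof.
move=> oU su.
apply: (@smooth_comp _ _ (fun b => exists p, b = poly_bump p) setT) => //; last by exists 1.
move=> _ [p ->]; exists (poly_bump (bump_deriv p)); first by exists (bump_deriv p).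
by move=> t _; exact: is_derive_poly_bump.
Qed.
End bump.

(** * One-dimensional integrals *)

Section half_line_power.
Variable R : realType.
Notation leb := (@lebesgue_measure R).

(** The distribution s_+^a as a function: cutting it off at s <= 0 turns integrals over the half
    line into integrals over R, where affine substitutions and Fubini apply directly. *)
Definition ppow (a s : R) : R := if 0 < s then s `^ a else 0.

Lemma measurable_ppow a : measurable_fun setT (ppow a).
Proof.
apply: measurable_fun_ifT.
- exact: (measurable_fun_ltr (f := cst 0)).
- exact: measurable_powR.
- exact: measurable_cst.
Qed.

Lemma ppow_ge0 a s : 0 <= ppow a s.
Proof. by rewrite /ppow; case: ifP => // _; exact: powR_ge0. Qed.

Lemma ppow_gt0E a s : 0 < s -> ppow a s = s `^ a.
Proof. by rewrite /ppow => ->. Qed.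

Lemma ppow_le0E a s : s <= 0 -> ppow a s = 0.
Proof. by rewrite /ppow leNgt => /negbTE ->. Qed.

Lemma ppowM a c s : 0 < c -> ppow a (c * s) = c `^ a * ppow a s.
Proof.
move=> c0; rewrite /ppow pmulr_rgt0//; case: ifPn => s0; last by rewrite mulr0.
by rewrite powRM// ltW.
Qed.

Lemma ppowD a b s : ppow (a + b) s = ppow a s * ppow b s.
Proof.
rewrite /ppow; case: ifPn => s0; last by rewrite mulr0.
by rewrite powRD//; apply/implyP => _; rewrite gt_eqF.
Qed.

Lemma ppow_mul a s : ppow (a + 1) s = ppow a s * s.
Proof.
rewrite ppowD; have [s0|s0] := leP s 0; first by rewrite !(ppow_le0E _ s0) !mul0r.
by rewrite (ppow_gt0E 1 s0) powRr1// ltW.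
Qed.

Lemma is_derive_powR_div (a t : R) : a + 1 != 0 -> 0 < t ->
  is_derive t 1 (fun t => (a + 1)^-1 * t `^ (a + 1)) (t `^ a).
Proof.
move=> a0 t0; have := is_derive_powR ((a + 1)^-1) (a + 1) t0.
by rewrite mulVf// mul1r addrK.
Qed.

Lemma continuous_powR (a t : R) : 0 < t -> {for t, continuous (fun t : R => t `^ a)}.
Proof.
move=> t0; apply: differentiable_continuous; apply/derivable1_diffP.
by apply: derivable_powR; rewrite in_itv/= t0.
Qed.

Lemma integrable_powR_near0 (a : R) : -1 < a -> leb.-integrable `]0, 1] (fun s => (s `^ a)%:E).
Proof.
move=> a1; apply/integrableP; split.
  by apply/measurable_EFinP; apply: measurable_funTS; exact: measurable_powR.
under eq_integral do rewrite gee0_abs ?lee_fin ?powR_ge0//.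
(* Monotone convergence along these segments, each integrated by the fundamental theorem of
   calculus. The shift by 2 keeps the left endpoint strictly below 1. *)
pose F (i : nat) : set R := `[i.+2%:R^-1, 1]%classic.
have p i : (0 : R) < i.+2%:R^-1 by rewrite invr_gt0 ltr0n.
have l1 i : (i.+2%:R^-1 : R) < 1 by rewrite invf_lt1 ?ltr0n// ltr1n.
have FE : `]0, 1]%classic = \bigcup_i F i.
  apply/seteqP; split => [s|s [i _]]; rewrite /F /= !in_itv/=; last first.
    by move=> /andP[h ->]; rewrite (lt_le_trans (p i)).
  move=> /andP[s0 s1]; exists (Num.truncn s^-1) => //=; rewrite in_itv/= s1 andbT.
  rewrite -[leRHS]invrK lef_pV2 ?posrE ?invr_gt0 ?ltr0n//.
  by rewrite (le_trans (ltW (truncnS_gt _)))// ler_nat.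
have nd : nondecreasing_seq F.
  move=> i j ij; apply/subsetPset => s; rewrite /F /= !in_itv/= => /andP[h ->].
  by rewrite andbT (le_trans _ h)// lef_pV2 ?posrE ?ltr0n// ler_nat.
rewrite FE.
have cv := @ge0_nondecreasing_set_cvg_integral _ (measurableTypeR R) R F (fun s : R => (s `^ a)%:E) leb nd.
have {}cv : (\int[leb]_(x in F i) (x `^ a)%:E @[i --> \oo] --> \int[leb]_(x in \bigcup_i F i) (x `^ a)%:E)%E.
  apply: cv => [i|i|i x _]; first exact: measurable_itv.
  - by apply/measurable_EFinP; apply: measurable_funTS; exact: measurable_powR.
  - by rewrite lee_fin powR_ge0.
have a10 : 0 < a + 1 by lra.
have a1n : a + 1 != 0 by rewrite gt_eqF.
apply: (@le_lt_trans _ _ ((a + 1)^-1)%:E); last exact: ltry.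
rewrite -(cvg_lim _ cv)//; apply: lime_le; first by apply/cvg_ex; eexists; exact: cv.
apply: nearW => i.
rewrite /F (@continuous_FTC2 _ _ (fun t => (a + 1)^-1 * t `^ (a + 1)) _ _ (l1 i)).
- rewrite powR1 mulr1 -EFinB lee_fin gerBl// mulr_ge0 ?powR_ge0// invr_ge0; exact: ltW.
- apply: continuous_in_subspaceT => x; rewrite inE /= in_itv/= => /andP[h _].
  by apply: continuous_powR; exact: lt_le_trans h.
- have d (x : R) : 0 < x -> derivable (fun t => (a + 1)^-1 * t `^ (a + 1)) x 1.
    by move=> x0; have := is_derive_powR_div a1n x0.
  have c (x : R) : 0 < x -> {for x, continuous (fun t => (a + 1)^-1 * t `^ (a + 1))}.
    by move=> x0; apply: differentiable_continuous; apply/derivable1_diffP; exact: d.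
  split.
  + by move=> x; rewrite in_itv/= => /andP[h _]; apply: d; exact: lt_trans h.
  + by apply: cvg_at_right_filter; apply: c.
  + by apply: cvg_at_left_filter; apply: c.
- move=> x; rewrite in_itv/= => /andP[h _].
  have x0 : 0 < x by exact: lt_trans h.
  have := is_derive_powR_div a1n x0.
  by move=> dx; rewrite derive1E derive_val.
Qed.

Lemma cvg_powR_infty (b : R) : b < 0 -> (t `^ b @[t --> +oo]) --> (0 : R).
Proof.
move=> b0; apply/cvgrPdist_lt => e e0; near=> t.
have t0 : 0 < t by near: t; exact: nbhs_pinfty_gt.
rewrite sub0r normrN ger0_norm ?powR_ge0//.
have h : e `^ (b^-1) < t by near: t; apply: nbhs_pinfty_gt; exact: num_real.
have -> : e = (e `^ (b^-1)) `^ b by rewrite -powRrM mulVf ?lt_eqF// powRr1// ltW.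
rewrite -[b]opprK !(powRN _ (- b)) ltf_pV2 ?posrE ?powR_gt0//.
by rewrite gt0_ltr_powR ?oppr_gt0// nnegrE ?powR_ge0// ltW.
Unshelve. all: by end_near. Qed.

Lemma integral_powR_far (a r : R) : a < -1 -> 0 < r ->
  (\int[leb]_(s in `[r, +oo[) (s `^ a)%:E = (- (a + 1)^-1 * r `^ (a + 1))%:E)%E.
Proof.
move=> a1 r0.
have a10 : a + 1 < 0 by lra.
pose F t : R := (a + 1)^-1 * t `^ (a + 1).
have D (x : R) : 0 < x -> is_derive x 1 F (x `^ a).
  by move=> x0; apply: is_derive_powR_div => //; rewrite lt_eqF.
have CF (x : R) : 0 < x -> {for x, continuous F}.
  by move=> x0; apply: differentiable_continuous; apply/derivable1_diffP; have := D x x0.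
rewrite (@ge0_continuous_FTC2y _ (fun s : R => s `^ a) F r 0).
- by rewrite sub0e /F -EFinN mulNr.
- by move=> x _; exact: powR_ge0.
- apply/continuous_within_itvcyP; split.
    by move=> x; rewrite in_itv/= andbT => h; apply: continuous_powR; exact: lt_trans h.
  by apply: cvg_at_right_filter; exact: continuous_powR.
- rewrite -(mulr0 ((a + 1)^-1)); apply: cvgM; [exact: cvg_cst|exact: cvg_powR_infty].
- by move=> x rx; have := D x (lt_trans r0 rx).
- by apply: cvg_at_right_filter; exact: CF.
- move=> x; rewrite in_itv/= andbT => rx; have := D x (lt_trans r0 rx).
  by move=> dx; rewrite derive1E derive_val.
Qed.

(** The standard integrable majorant on the half line: a > -1 controls s near 0 and b < -1 controls
    s near infinity. *)
Definition ppow2 (a b s : R) : R := if s <= 1 then ppow a s else ppow b s.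

Lemma ppow2_ge0 a b s : 0 <= ppow2 a b s.
Proof. by rewrite /ppow2; case: ifP => _; exact: ppow_ge0. Qed.

Lemma integrable_ppow2 (a b : R) : -1 < a -> b < -1 ->
  leb.-integrable setT (EFin \o ppow2 a b).
Proof.
move=> a1 b1.
have m1 : measurable (`]0, 1]%classic : set (measurableTypeR R)) by exact: measurable_itv.
have m2 : measurable (`[1, +oo[%classic : set (measurableTypeR R)) by exact: measurable_itv.
have i1 := (integrable_mkcond (mu := leb) _ m1).1 (integrable_powR_near0 a1).
have i20 : leb.-integrable `[1, +oo[ (fun s => (s `^ b)%:E).
  apply/integrableP; split.
    by apply/measurable_EFinP; apply: measurable_funTS; exact: measurable_powR.
  under eq_integral do rewrite gee0_abs ?lee_fin ?powR_ge0//.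
  by rewrite integral_powR_far// ltry.
have i2 := (integrable_mkcond (mu := leb) _ m2).1 i20.
apply: (le_integrable measurableT _ _ (integrableD measurableT i1 i2)).
  apply/measurable_EFinP; apply: measurable_fun_ifT; try exact: measurable_ppow.
  exact: (measurable_fun_ler (g := cst 1)).
move=> s _ /=; rewrite ger0_norm ?ppow2_ge0// !patchE /ppow2.
have [s1|s1] /= := leP s 1.
- have [s0|s0] := leP s 0; first by rewrite ppow_le0E// abse_ge0.
  rewrite ppow_gt0E// ifT; last by rewrite inE/= in_itv/= s0 s1.
  case: ifPn => _; last by rewrite adde0 lee_fin ler_norm.
  by rewrite -EFinD lee_fin (le_trans _ (ler_norm _))// lerDl powR_ge0.
- case: ifPn => [|_]; first by rewrite inE/= in_itv/= => /andP[_]; rewrite leNgt s1.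
  have s0 : 0 < s by lra.
  rewrite ifT; last by rewrite inE/= in_itv/= andbT ltW.
  by rewrite add0e ppow_gt0E// lee_fin ler_norm.
Qed.

Lemma sin_le_norm (x : R) : `|sin x| <= `|x|.
Proof.
wlog x0 : x / 0 <= x => [h|].
  have [/h//|x0] := leP 0 x.
  by rewrite -normrN -sinN -[leRHS]normrN; apply: h; rewrite oppr_ge0 ltW.
have d (y : R) : is_derive y 1 (@sin R) (cos y) by exact: is_derive_sin.
have [|c _] := @MVT_segment R (@sin R) (@cos R) 0 x x0 (fun y _ => d y).
  by apply: continuous_subspaceT; exact: continuous_sin.
by rewrite sin0 !subr0 => ->; rewrite normrM ler_piMl// cos_max.
Qed.

Lemma one_sub_cosE (s : R) : 1 - cos s = 2 * sin (s / 2) ^+ 2.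
Proof.
have -> : cos s = cos ((s / 2) *+ 2) by congr cos; rewrite -mulr_natr divfK.
by rewrite cos_mulr2n cos2sin2 mulr2n; ring.
Qed.

Lemma one_sub_cos_ge0 (s : R) : 0 <= 1 - cos s.
Proof. by rewrite subr_ge0 cos_le1. Qed.

Lemma one_sub_cos_le2 (s : R) : 1 - cos s <= 2.
Proof. have := cos_geN1 s; lra. Qed.

Lemma one_sub_cos_le (s : R) : 1 - cos s <= s ^+ 2.
Proof.
rewrite one_sub_cosE.
have : sin (s / 2) ^+ 2 <= (s / 2) ^+ 2.
  by rewrite -[leLHS]real_normK ?num_real// -[leRHS]real_normK ?num_real// lerXn2r ?nnegrE// sin_le_norm.
rewrite expr_div_n => h; have := sqr_ge0 s; lra.
Qed.

(** For 0 < q < 2 its integral over s is a positive multiple of |t|^q; this expresses |t|^q as a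
    superposition of cosines. *)
Definition coskern (q t s : R) : R := ppow (-1 - q) s * (1 - cos (s * t)).

Lemma measurable_coskern q t : measurable_fun setT (coskern q t).
Proof.
apply: measurable_funM; first exact: measurable_ppow.
apply: measurable_funB => //; apply: (measurableT_comp (f := @cos R)).
  by apply: continuous_measurable_fun; exact: continuous_cos.
exact: measurable_funM.
Qed.

Lemma coskern_ge0 q t s : 0 <= coskern q t s.
Proof. by rewrite mulr_ge0 ?ppow_ge0 ?one_sub_cos_ge0. Qed.

(** For s <= 1 the estimate 1 - cos u <= u^2 gains two powers of s; for s > 1 the estimate 1 - cos u
    <= 2 suffices. *)
Lemma coskern_le q t s : coskern q t s <= 2 * (1 + t ^+ 2) * ppow2 (1 - q) (-1 - q) s.
Proof.
rewrite /coskern /ppow2; have t20 := sqr_ge0 t.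
case: ifPn => s1.
- have -> : ppow (1 - q) s = ppow (-1 - q) s * s ^+ 2.
    rewrite (_ : 1 - q = -1 - q + 1 + 1); last by ring.
    by rewrite !ppow_mul mulrA.
  rewrite mulrCA ler_wpM2l ?ppow_ge0// (le_trans (one_sub_cos_le _))// exprMn mulrC.
  rewrite ler_wpM2r ?sqr_ge0//; lra.
- rewrite mulrC ler_wpM2r ?ppow_ge0// (le_trans (one_sub_cos_le2 _))//; lra.
Qed.

Lemma integrable_coskern q t : 0 < q < 2 -> leb.-integrable setT (EFin \o coskern q t).
Proof.
move=> /andP[q0 q2].
have h : leb.-integrable setT (EFin \o (fun s => 2 * (1 + t ^+ 2) * ppow2 (1 - q) (-1 - q) s)).
  have i : leb.-integrable setT (EFin \o ppow2 (1 - q) (-1 - q)) by apply: integrable_ppow2; lra.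
  exact: (integrableZl measurableT (2 * (1 + t ^+ 2)) i).
apply: (le_integrable measurableT _ _ h).
  by apply/measurable_EFinP; exact: measurable_coskern.
move=> s _ /=; rewrite lee_fin ger0_norm ?coskern_ge0// (le_trans (coskern_le _ _ _))// ler_norm//.
Qed.

Definition coskern_cst q : R := \int[leb]_s coskern q 1 s.

(** Replacing s by |t| s reduces the kernel at t to the kernel at 1, with a factor |t|^(1+q) from
    the power and |t|^-1 from the measure. The constant is left unevaluated, as only its sign
    matters. *)
Lemma integral_coskern q t : 0 < q < 2 ->
  \int[leb]_s coskern q t s = `|t| `^ q * coskern_cst q.
Proof.
move=> q02; have /andP[q0 q2] := q02.
have [->|t0] := eqVneq t 0.
  rewrite normr0 powR0 ?gt_eqF// mul0r.
  under eq_Rintegral do rewrite /coskern mulr0 cos0 subrr mulr0.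
  by rewrite Rintegral_cst// mul0r.
have t0' : 0 < `|t| by rewrite normr_gt0.
have e s : coskern q t s = `|t| `^ (1 + q) * coskern q 1 (`|t| * s + 0).
  rewrite /coskern addr0 mulr1 ppowM// mulrA mulrA -powRD; last by apply/implyP => _; rewrite gt_eqF.
  rewrite (_ : 1 + q + (-1 - q) = 0); last by ring.
  rewrite powRr0 mul1r; congr (_ * (1 - _)).
  by rewrite -cos_norm normrM -(cos_norm (`|t| * s)) normrM normr_id mulrC.
under eq_Rintegral do rewrite e.
have it : `|t| != 0 by rewrite gt_eqF.
rewrite RintegralZl//; last first.
  exact: (integrable_affine1 0 it (integrable_coskern 1 q02)).
rewrite (Rintegral_affine1 0 it (integrable_coskern 1 q02)) normr_id mulrA.
congr (_ * _); rewrite powRD; last by apply/implyP.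
by rewrite powRr1// mulrAC divff// mul1r.
Qed.

Lemma coskern_cst_gt0 q : 0 < q < 2 -> 0 < coskern_cst q.
Proof.
move=> q02; have /andP[q0 q2] := q02.
(* On this interval cos s <= 0, hence the integrand is at least s^(-1-q) >= pi^(-1-q). *)
pose D : set R := `[pi / 2, pi]%classic.
have pi0 := @pi_gt0 R.
have p0 : 0 < pi `^ (-1 - q) :> R by rewrite powR_gt0.
have lD : leb D = (pi / 2)%:E.
  rewrite /D lebesgue_measure_itv/= lte_fin ltr_pdivrMr// ltr_pMr// ltr1n.
  by rewrite -EFinB; congr EFin; lra.
apply: (@lt_le_trans _ _ (\int[leb]_(s in D) (pi `^ (-1 - q)))).
  rewrite Rintegral_cst; last exact: measurable_itv.
  by rewrite pmulr_rgt0// [X in fine X]lD /= divr_gt0.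
have mD : measurable (D : set (measurableTypeR R)) by exact: measurable_itv.
have iD : leb.-integrable D (EFin \o cst (pi `^ (-1 - q) : R)).
  apply/integrableP; split; first by apply/measurable_EFinP.
  rewrite [X in (X < _)%E](_ : _ = \int[leb]_(s in D) (pi `^ (-1 - q))%:E)%E; last first.
    by apply: eq_integral => s _ /=; rewrite ger0_norm ?(ltW p0).
  by rewrite integral_cst// [X in (_ * X)%E]lD -EFinM ltry.
rewrite Rintegral_mkcond; apply: le_Rintegral => //.
- have := (integrable_mkcond (mu := leb) _ mD).1 iD.
  by apply: eq_integrable => // s _; rewrite restrict_EFin.
- exact: integrable_coskern.
- move=> s _; rewrite patchE; case: ifPn => [|_]; last exact: coskern_ge0.
  rewrite inE /D/= in_itv/= => /andP[h1 h2].
  have s0 : 0 < s by lra.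
  rewrite /coskern mulr1 ppow_gt0E//.
  have c0 : cos s <= 0.
    rewrite -(@cos_pihalf R); have [->//|hs] := eqVneq s (pi / 2).
    by rewrite ltW// ltr_cos ?in_itv/=; [rewrite lt_neqAle eq_sym hs|lra|lra].
  rewrite (@le_trans _ _ (s `^ (-1 - q)))//; last by rewrite ler_peMr ?powR_ge0//; lra.
  rewrite (_ : -1 - q = - (1 + q)); last by ring.
  rewrite !powRN lef_pV2 ?posrE ?powR_gt0//.
  by apply: ge0_ler_powR; rewrite ?nnegrE//; lra.
Qed.

End half_line_power.

(* exp(-|x|) plays the role usually given to the Gaussian: its Fourier transform
   2/(1+u^2) is elementary and is an approximate identity after scaling. *)
Section laplace_kernel.
Variable R : realType.
Notation leb := (@lebesgue_measure R).

Definition lap1 (x : R) : R := expR (- `|x|).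

Lemma lap1_gt0 x : 0 < lap1 x. Proof. exact: expR_gt0. Qed.

Lemma continuous_lap1 : continuous lap1.
Proof.
move=> x; apply: continuous_comp; last exact: continuous_expR.
by apply: continuousN; exact: norm_continuous.
Qed.

Lemma measurable_lap1 : measurable_fun setT lap1.
Proof. by apply: continuous_measurable_fun; exact: continuous_lap1. Qed.

(** Antiderivative of exp(-x) (a + b cos(u x)). The constant a >= |b| keeps the integrand
    nonnegative, so that improper integrals can be evaluated; comparing b = 1 with b = 0 then
    isolates the cosine integral. *)
Let prim (a b u x : R) : R :=
  expR (- x) * (- a + b * ((1 + u ^+ 2)^-1 * (u * sin (u * x) - cos (u * x)))).

Let is_derive_prim (a b u x : R) :
  is_derive x 1 (prim a b u) (expR (- x) * (a + b * cos (u * x))).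
Proof.
have u0 : 1 + u ^+ 2 != 0 by rewrite gt_eqF// ltr_pwDl// sqr_ge0.
have dm : is_derive x 1 (fun x : R => u * x) u.
  by have := is_deriveZ u (is_derive_id x 1); rewrite /GRing.scale/= mulr1.
have dn : is_derive x 1 (fun x : R => - x) (- 1).
  exact: is_deriveNid.
have de := @is_derive1_comp R expR (fun x : R => - x) x _ _ (is_derive_expR (- x)) dn.
have ds := @is_derive1_comp R sin (fun x : R => u * x) x _ _ (is_derive_sin (u * x)) dm.
have dc := @is_derive1_comp R cos (fun x : R => u * x) x _ _ (is_derive_cos (u * x)) dm.
have d1 := is_deriveB (is_deriveZ u ds) dc.
have d2 := is_deriveD (is_derive_cst (- a) x 1) (is_deriveZ b (is_deriveZ ((1 + u ^+ 2)^-1) d1)).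
have d := is_deriveM de d2.
apply: (is_derive_eq d); rewrite /GRing.scale /= !fctE /= /GRing.scale /=; field.
exact: u0.
Qed.

Let integral_half (a b u : R) : `|b| <= a ->
  (\int[leb]_(x in `[0%R, +oo[) (expR (- x) * (a + b * cos (u * x)))%:E = (a + b * (1 + u ^+ 2)^-1)%:E)%E.
Proof.
move=> ba.
have u0 : 0 < 1 + u ^+ 2 by rewrite ltr_pwDl// sqr_ge0.
have C x : {for x, continuous (fun x => expR (- x) * (a + b * cos (u * x)))}.
  apply: continuousM.
    by apply: continuous_comp; [exact: opp_continuous|exact: continuous_expR].
  apply: continuousD; first exact: cst_continuous.
  apply: continuousM; first exact: cst_continuous.
  by apply: continuous_comp; [exact: mulrl_continuous|exact: continuous_cos].
have CP x : {for x, continuous (prim a b u)}.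
  by apply: differentiable_continuous; apply/derivable1_diffP; have := is_derive_prim a b u x.
rewrite (@ge0_continuous_FTC2y _ _ (prim a b u) 0 0).
- rewrite /prim mulr0 sin0 cos0 mulr0 oppr0 expR0 mul1r -EFinB; congr EFin; ring.
- move=> x _; rewrite mulr_ge0 ?expR_ge0//.
  have : - a <= b * cos (u * x); last lra.
  rewrite lerNl (le_trans (ler_norm _))// normrN normrM (le_trans _ ba)// ler_piMr// cos_max//.
- by apply: continuous_subspaceT => x; exact: C.
- pose M := `|a| + `|b| * ((1 + u ^+ 2)^-1 * (`|u| + 1)).
  have M0 : 0 <= M by rewrite addr_ge0// mulr_ge0// mulr_ge0 ?addr_ge0// invr_ge0 ltW.
  apply: norm_cvg0.
  apply: (@squeeze_cvgr _ _ _ _ (cst 0) (fun x => expR (- x) * M)).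
  + apply: nearW => x; rewrite /= normr_ge0/= normrM ger0_norm ?expR_ge0//.
    rewrite ler_wpM2l ?expR_ge0// (le_trans (ler_normD _ _))// normrN lerD2l.
    rewrite normrM ler_wpM2l// normrM ger0_norm ?invr_ge0 ?(ltW u0)// ler_wpM2l ?invr_ge0 ?(ltW u0)//.
    rewrite (le_trans (ler_normB _ _))// lerD ?cos_max// normrM ler_piMr// sin_max//.
  + exact: cvg_cst.
  + by rewrite -(mul0r M); apply: cvgM; [exact: cvgr_expR|exact: cvg_cst].
- by move=> x _; have := is_derive_prim a b u x.
- by apply: cvg_at_right_filter; exact: CP.
- by move=> x _; rewrite derive1E; have := is_derive_prim a b u x => h; rewrite derive_val.
Qed.

Let integral_full (a b u : R) : `|b| <= a ->
  (\int[leb]_x (lap1 x * (a + b * cos (u * x)))%:E = (2 * (a + b * (1 + u ^+ 2)^-1))%:E)%E.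
Proof.
move=> ba; rewrite ge0_symfun_integralT.
- rewrite EFinM -(integral_half u ba) set_itvcy; congr (_ * _)%E.
  apply: eq_integral => x; rewrite inE/= => x0.
  by rewrite /lap1 ger0_norm.
- move=> x; rewrite mulr_ge0 ?expR_ge0//.
  have : - a <= b * cos (u * x); last lra.
  rewrite lerNl (le_trans (ler_norm _))// normrN normrM (le_trans _ ba)// ler_piMr// cos_max//.
- move=> x; apply: continuousM; first exact: continuous_lap1.
  apply: continuousD; first exact: cst_continuous.
  apply: continuousM; first exact: cst_continuous.
  by apply: continuous_comp; [exact: mulrl_continuous|exact: continuous_cos].
- by move=> x /=; rewrite /lap1 normrN mulrN cosN.
Qed.

Lemma integrable_lap1 : leb.-integrable setT (EFin \o lap1).
Proof.
apply/integrableP; split; first by apply/measurable_EFinP; exact: measurable_lap1.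
rewrite [X in (X < _)%E](_ : _ = \int[leb]_x (lap1 x * (1 + 0 * cos (0 * x)))%:E)%E.
  by rewrite integral_full ?normr0// ltry.
by apply: eq_integral => x _ /=; rewrite mul0r addr0 mulr1 ger0_norm// ltW// lap1_gt0.
Qed.

Let mcos (c u : R) : measurable_fun setT (fun x : R => cos (u * x + c)).
Proof.
apply: (measurableT_comp (f := @cos R)).
  by apply: continuous_measurable_fun; exact: continuous_cos.
exact: measurable_aff1.
Qed.

Lemma integrable_lap1_cos (c u : R) : leb.-integrable setT (EFin \o (fun x => lap1 x * cos (u * x + c))).
Proof.
apply: (le_integrable measurableT _ _ integrable_lap1).
  by apply/measurable_EFinP; apply: measurable_funM; [exact: measurable_lap1|exact: mcos].
by move=> x _ /=; rewrite lee_fin normrM ler_piMr// cos_max.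
Qed.

Lemma integral_lap1_cos0 (u : R) : \int[leb]_x (lap1 x * cos (u * x)) = 2 * (1 + u ^+ 2)^-1.
Proof.
have aux (I w : R) : 2 * (1 + 1 * w) = 2 * (1 + 0 * w) + I -> I = 2 * w by move=> h; lra.
have h1 : \int[leb]_x (lap1 x * (1 + 1 * cos (u * x))) = 2 * (1 + 1 * (1 + u ^+ 2)^-1).
  by rewrite /Rintegral integral_full ?normr1.
have h2 : \int[leb]_x (lap1 x * (1 + 0 * cos (u * x))) = 2 * (1 + 0 * (1 + u ^+ 2)^-1).
  by rewrite /Rintegral integral_full ?normr0.
have i2 : leb.-integrable setT (EFin \o (fun x => lap1 x * cos (u * x))).
  by have := integrable_lap1_cos 0 u; under eq_fun do rewrite /= addr0.
have : \int[leb]_x (lap1 x + lap1 x * cos (u * x)) = \int[leb]_x lap1 x + \int[leb]_x (lap1 x * cos (u * x)).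
  by rewrite RintegralD//; exact: integrable_lap1.
under eq_Rintegral do rewrite -{1}[lap1 _]mulr1 -mulrDr -[X in 1 + X]mul1r.
rewrite h1.
have -> : \int[leb]_x lap1 x = \int[leb]_x (lap1 x * (1 + 0 * cos (u * x))).
  by apply: eq_Rintegral => x _; rewrite mul0r addr0 mulr1.
by rewrite h2 => /aux.
Qed.

Lemma integral_lap1_cos (c u : R) :
  \int[leb]_x (lap1 x * cos (u * x + c)) = cos c * (2 * (1 + u ^+ 2)^-1).
Proof.
have aux (I : R) : I = - I -> I = 0 by move=> h; lra.
have i1 := integrable_lap1_cos 0 u.
have i2 := integrable_lap1_cos (- (pi / 2)) u.
have e x : lap1 x * cos (u * x + c) =
    cos c * (lap1 x * cos (u * x + 0)) - sin c * (lap1 x * cos (u * x - pi / 2)).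
  by rewrite addr0 cosBpihalf cosD; ring.
under eq_Rintegral do rewrite e.
have i1' := integrableZl measurableT (cos c) i1.
have i2' := integrableZl measurableT (sin c) i2.
rewrite RintegralB// !RintegralZl//.
have -> : \int[leb]_x (lap1 x * cos (u * x + 0)) = 2 * (1 + u ^+ 2)^-1.
  by rewrite -integral_lap1_cos0; apply: eq_Rintegral => x _; rewrite addr0.
(* Reflection x -> -x: the sine part, written as cos(u x - pi/2), is odd, so its integral equals its
   own opposite. *)
have n1 : (-1 : R) != 0 by rewrite oppr_eq0 oner_eq0.
have h := Rintegral_affine1 0 n1 i2.
have : \int[leb]_x (lap1 (-1 * x + 0) * cos (u * (-1 * x + 0) - pi / 2)) = - \int[leb]_x (lap1 x * cos (u * x - pi / 2)).
  rewrite -[RHS]mulN1r -RintegralZl//; apply: eq_Rintegral => x _.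
  by rewrite addr0 mulN1r /lap1 normrN !cosBpihalf mulrN sinN; ring.
rewrite h normrN normr1 invr1 mul1r => /aux ->.
by rewrite mulr0 subr0.
Qed.

Definition lap n (x : 'rV[R]_n) : R := \prod_(i < n) lap1 (x ord0 i).

Lemma lap_gt0 n (x : 'rV[R]_n) : 0 < lap x.
Proof. by apply: prodr_gt0 => i _; exact: lap1_gt0. Qed.


Lemma lap_le1 n (x : 'rV[R]_n) : lap x <= 1.
Proof.
apply: (big_rec (fun y => y <= 1)) => // i y _ y1.
rewrite (le_trans (y := lap1 (x ord0 i)))//; first by rewrite ler_piMr// ltW// lap1_gt0.
by rewrite /lap1 -[leRHS]expR0 ler_expR oppr_le0.
Qed.

Lemma lap_rcons n t (x : 'rV[R]_n) : lap (rcons_mx (t, x)) = lap1 t * lap x.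
Proof.
rewrite /lap big_ord_recl rcons_mx0; congr (_ * _).
by apply: eq_bigr => i _; rewrite rcons_mxS.
Qed.

Lemma dotp_rcons n t (x : 'rV[R]_n) s y :
  dotp (rcons_mx (t, x)) (rcons_mx (s, y)) = t * s + dotp x y.
Proof.
rewrite /dotp big_ord_recl !rcons_mx0; congr (_ + _).
by apply: eq_bigr => i _; rewrite !rcons_mxS.
Qed.

Lemma measurable_lap n : measurable_fun setT (@lap n).
Proof.
apply: measurable_prod => i _.
by apply: (measurableT_comp measurable_lap1); exact: measurable_coord.
Qed.

Lemma measurable_cos_dotp n (w : 'rV[R]_n) c : measurable_fun setT (fun x => cos (dotp x w + c)).
Proof.
apply: (measurableT_comp (f := @cos R)).
  by apply: continuous_measurable_fun; exact: continuous_cos.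
by apply: measurable_funD => //; exact: measurable_dotp.
Qed.

Lemma integrable_lap n : mu.-integrable setT (EFin \o @lap n).
Proof.
have e m : (\int[mu]_x (@lap m x)%:E < +oo)%E.
  elim: m => [|m ih]; first by rewrite integral_mu0 ltry.
  rewrite ge0_integral_muS; last 2 first.
  - by apply/measurable_EFinP; exact: measurable_lap.
  - by move=> x; rewrite lee_fin ltW// lap_gt0.
  have fi : (\int[mu]_x (@lap m x)%:E \is a fin_num)%E.
    by rewrite ge0_fin_numE// integral_ge0// => x _; rewrite lee_fin ltW// lap_gt0.
  under eq_integral => t _.
    under eq_integral do rewrite lap_rcons EFinM.
    rewrite ge0_integralZl//; last 3 first.
    - by apply/measurable_EFinP; exact: measurable_lap.
    - by move=> x _; rewrite lee_fin ltW// lap_gt0.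
    - by rewrite lee_fin ltW// lap1_gt0.
    rewrite -(fineK fi) muleC; over.
  rewrite /= ge0_integralZl//; last 3 first.
  - by apply/measurable_EFinP; exact: measurable_lap1.
  - by move=> x _; rewrite lee_fin ltW// lap1_gt0.
  - by rewrite lee_fin fine_ge0// integral_ge0// => x _; rewrite lee_fin ltW// lap_gt0.
  have := integrable_fin_num measurableT integrable_lap1 => h.
  by rewrite -(fineK h) -EFinM ltry.
apply/integrableP; split; first by apply/measurable_EFinP; exact: measurable_lap.
by under eq_integral do rewrite /= gtr0_norm ?lap_gt0//.
Qed.

Lemma integrable_lap_cos n (w : 'rV[R]_n) c :
  mu.-integrable setT (EFin \o (fun x => lap x * cos (dotp x w + c))).
Proof.
apply: (le_integrable measurableT _ _ (integrable_lap n)).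
  by apply/measurable_EFinP; apply: measurable_funM; [exact: measurable_lap|exact: measurable_cos_dotp].
by move=> x _ /=; rewrite lee_fin normrM ler_piMr// cos_max.
Qed.

(** The free phase c carries the induction on n: once the first coordinate s is fixed, t s + c is
    the phase of the integral over the others. For c = 0 this says that the Fourier transform of
    [lap] is 2^n times [weight]. *)
Lemma integral_lap_cos n (w : 'rV[R]_n) c :
  \int[mu]_x (lap x * cos (dotp x w + c)) = cos c * (2 ^+ n * weight w).
Proof.
elim: n w c => [|n ih] w c.
  rewrite /Rintegral integral_mu0 /lap /weight /dotp !big_ord0 /= add0r expr0 !mulr1.
  by rewrite mul1r.
have : exists t y, w = rcons_mx (t, y) by exists (runcons w).1, (runcons w).2; rewrite runconsK.
move=> [t [y ->]].
rewrite /Rintegral (integral_muS (integrable_lap_cos _ _)) weight_rcons.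
have e s : (\int[mu]_x (lap (rcons_mx (s, x)) * cos (dotp (rcons_mx (s, x)) (rcons_mx (t, y)) + c))%:E)%E
   = (2 ^+ n * weight y * (lap1 s * cos (t * s + c)))%:E.
  have h := ih y (t * s + c).
  have i := integrable_lap_cos y (t * s + c).
  under eq_integral do rewrite lap_rcons dotp_rcons -mulrA EFinM.
  under eq_integral => x _.
    rewrite (_ : s * t + dotp x y + c = dotp x y + (t * s + c)); last by ring.
    over.
  rewrite /= (integralZl measurableT i).
  have := integrable_fin_num measurableT i => fi.
  by rewrite -(fineK fi) -EFinM; move: h; rewrite /Rintegral => ->; congr EFin; ring.
under eq_integral do rewrite e.
have i := integrable_lap1_cos c t.
rewrite -/(Rintegral leb setT (fun s => 2 ^+ n * weight y * (lap1 s * cos (t * s + c)))).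
rewrite RintegralZl// integral_lap1_cos [2 ^+ n.+1]exprS.
move: ((1 + t ^+ 2)^-1) => v; ring.
Qed.

End laplace_kernel.

(** * The sign of Gamma(-q/2) *)

Section gamma_sign.
Variable R : realType.
Notation leb := (@lebesgue_measure R).

Let integral_gamma_gt0 (a : R) : -1 < a <= 0 ->
  0 < \int[leb]_(t in [set t : R | 0 < t]) (t `^ a * expR (- t)).
Proof.
move=> /andP[a1 a0].
have mP : measurable [set t : R | 0 < t].
  by rewrite -set_itvoy; exact: measurable_itv.
have E t : ((fun t : R => t `^ a * expR (- t)) \_ [set t : R | 0 < t]) t = ppow a t * expR (- t).
  rewrite patchE /ppow; case: ifPn => [|]; first by rewrite inE/= => ->.
  by rewrite notin_setE/= => /negP/negbTE ->; rewrite mul0r.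
rewrite Rintegral_mkcond.
under eq_Rintegral do rewrite E.
have mexp : measurable_fun setT (fun t : R => expR (- t)).
  by apply: continuous_measurable_fun => x; apply: continuous_comp;
    [exact: opp_continuous|exact: continuous_expR].
have i : leb.-integrable setT (EFin \o (fun t => ppow a t * expR (- t))).
  (* For t > 1 the majorant comes from t^2 <= 4 exp(t), the case k = 2 of u^k <= k^k exp(u). *)
  have i2 : leb.-integrable setT (EFin \o (fun t => 4 * ppow2 a (a - 2) t)).
    by apply: (integrableZl measurableT 4 (integrable_ppow2 _ _)) => //; lra.
  apply: (le_integrable measurableT _ _ i2).
    by apply/measurable_EFinP; apply: measurable_funM => //; exact: measurable_ppow.
  move=> t _ /=; rewrite lee_fin ger0_norm ?mulr_ge0 ?ppow_ge0 ?expR_ge0//.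
  rewrite (le_trans _ (ler_norm _))//.
  have [t0|t0] := leP t 0; first by rewrite ppow_le0E// mul0r mulr_ge0// ppow2_ge0.
  rewrite /ppow2; case: ifPn => t1.
    rewrite mulrC ler_pM ?expR_ge0 ?ppow_ge0//.
    apply: (@le_trans _ _ (expR 0)); first by rewrite ler_expR oppr_le0 ltW.
    by rewrite expR0 ler1n.
  rewrite expRN ler_pdivrMr ?expR_gt0//.
  have := exprn_le_expR 2 (ltW t0) => h.
  have -> : ppow a t = ppow (a - 2) t * t ^+ 2.
    by rewrite {1}(_ : a = a - 2 + 1 + 1) ?ppow_mul ?mulrA//; ring.
  rewrite [4 * _]mulrC -mulrA ler_wpM2l ?ppow_ge0//.
  by rewrite (le_trans h)// -natrX.
pose A : set R := `]0, 1]%classic.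
have mA : measurable (A : set (measurableTypeR R)) by exact: measurable_itv.
have lA : leb A = 1%:E by rewrite /A lebesgue_measure_itv/= lte_fin ltr01 oppr0 adde0.
apply: (@lt_le_trans _ _ (\int[leb]_(s in A) (expR (-1)))).
  by rewrite Rintegral_cst// [X in fine X]lA /= mulr1 expR_gt0.
have iA : leb.-integrable A (EFin \o cst (expR (-1) : R)).
  apply/integrableP; split; first by apply/measurable_EFinP.
  rewrite [X in (X < _)%E](_ : _ = \int[leb]_(s in A) (expR (-1))%:E)%E; last first.
    by apply: eq_integral => s _ /=; rewrite ger0_norm ?expR_ge0.
  by rewrite integral_cst// [X in (_ * X)%E]lA -EFinM ltry.
rewrite Rintegral_mkcond; apply: le_Rintegral => //.
  have := (integrable_mkcond (mu := leb) _ mA).1 iA.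
  by apply: eq_integrable => // s _; rewrite restrict_EFin.
move=> s _; rewrite patchE; case: ifPn => [|_]; last by rewrite mulr_ge0 ?ppow_ge0 ?expR_ge0.
rewrite inE/A/= in_itv/= => /andP[s0 s1].
rewrite (@le_trans _ _ (expR (- s)))//; first by rewrite ler_expR lerN2.
rewrite ler_peMl ?expR_ge0// ppow_gt0E//.
rewrite -[a]opprK powRN -[leLHS]invr1 lef_pV2 ?posrE ?powR_gt0//.
have := @ge0_ler_powR R (- a) _ s 1; rewrite powR1 oppr_ge0 !nnegrE => h.
by apply: h; lra.
Qed.

(** In [Gamma] the shift is m + 1, so the Euler integral has t-exponent m - q/2 in (-1, 0) and is
    positive, while each of the m + 1 factors j - q/2 with j <= m in the denominator is negative. *)
Lemma Gamma_neg_half_sign (q : R) (m : nat) : m%:R * 2 < q < m.+1%:R * 2 ->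
  0 < (-1) ^+ m.+1 * Gamma (- (q / 2)).
Proof.
move=> /andP[q1 q2].
have m0 : (0 : R) <= m%:R by rewrite ler0n.
have h0 : 0 <= q / 2 by lra.
have k : Num.truncn `|- (q / 2)| = m.
  rewrite normrN ger0_norm//; apply: truncn_def; rewrite -natr1 in q2 *.
  by apply/andP; split; lra.
rewrite /Gamma k mulrCA mulr_gt0//.
  have -> : - (q / 2) + m.+1%:R - 1 = m%:R - q / 2 by rewrite -natr1; ring.
  by apply: integral_gamma_gt0; rewrite -natr1 in q2; apply/andP; split; lra.
rewrite -[X in X ^+ _]invrN1 exprVn -invfM invr_gt0.
have -> : (-1) ^+ m.+1 = \prod_(j < m.+1) (-1 : R) by rewrite prodr_const card_ord.
rewrite -big_split/=; apply: prodr_gt0 => j _.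
rewrite mulN1r opprD opprK subr_gt0.
have : (j%:R : R) <= m%:R by rewrite ler_nat -ltnS.
by lra.
Qed.
End gamma_sign.

(** * Fourier transform of test functions supported away from 0 *)

Section test_functions.
Variables (R : realType) (n : nat).
Notation V := 'rV[R]_n.
Implicit Types (f g : V -> R).

(** Test functions supported off the origin, without the sign condition: derivatives, products with
    smooth functions and linear combinations stay in this class. *)
Definition tc f := [/\ smooth_on setT f,
  exists M, forall x, M < enorm x -> f x = 0 &
  exists2 e, 0 < e & forall x, enorm x < e -> f x = 0].

Lemma open_enorm_gt (M : R) : open [set x : V | M < enorm x].
Proof.
apply: (@open_comp _ _ (@enorm R n) [set r | M < r]); last exact: open_gt.
by move=> x _; exact: continuous_enorm.
Qed.

Lemma tcM f g : tc f -> smooth_on setT g -> tc (fun x => f x * g x).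
Proof.
move=> [sf [M fM] [e e0 fe]] sg; split.
- by apply: smoothM => //; exact: openT.
- by exists M => x /fM ->; rewrite mul0r.
- by exists e => // x /fe ->; rewrite mul0r.
Qed.

Lemma tcD f g : tc f -> tc g -> tc (fun x => f x + g x).
Proof.
move=> [sf [M fM] [e e0 fe]] [sg [N gN] [d d0 gd]]; split.
- by apply: smoothD => //; exact: openT.
- exists (Num.max M N) => x; rewrite gt_max => /andP[/fM -> /gN ->]; exact: addr0.
- exists (Num.min e d); first by rewrite lt_min e0.
  by move=> x; rewrite lt_min => /andP[/fe -> /gd ->]; exact: addr0.
Qed.

Lemma tcZ (c : R) f : tc f -> tc (fun x => c * f x).
Proof.
move=> tf; have := tcM tf (@smooth_cst R n setT c openT).
by rewrite (_ : (fun x => f x * c) = (fun x => c * f x))//; apply/funext => x; rewrite mulrC.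
Qed.

Lemma tc0 : tc (fun=> 0).
Proof. by split; [exact: smooth_cst openT|exists 0|exists 1]. Qed.

Lemma tc_sum m (F : 'I_m -> V -> R) : (forall i, tc (F i)) -> tc (fun x => \sum_(i < m) F i x).
Proof.
elim: m F => [|m ih] F tF.
  by rewrite (_ : (fun x => _) = fun=> 0); [exact: tc0|apply/funext => x; rewrite big_ord0].
rewrite (_ : (fun x => _) = fun x => F ord0 x + \sum_(i < m) F (lift ord0 i) x).
  by apply: tcD => //; exact: ih.
by apply/funext => x; rewrite big_ord_recl.
Qed.

Let derive_open0 f v (U : set V) : open U -> (forall x, U x -> f x = 0) ->
  forall x, U x -> 'D_v f x = 0.
Proof.
move=> oU f0 x Ux; rewrite (@near_eq_derive _ _ _ _ (cst 0)) ?derive_cst//.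
by apply: (@filterS _ (nbhs x) _ U); [exact: f0|exact: open_nbhs_nbhs].
Qed.

Lemma tc_derive v f : tc f -> tc (fun x => 'D_v f x).
Proof.
move=> [sf [M fM] [e e0 fe]]; split; first exact: smooth_derive.
- exists M => x Mx; apply: (@derive_open0 f v [set x | M < enorm x]) => //.
  exact: open_enorm_gt.
- exists e => // x xe; apply: (@derive_open0 f v [set x | enorm x < e]) => //.
  exact: open_enorm_lt.
Qed.

Lemma tc_dotp v f : tc f -> tc (fun x => f x * dotp x v).
Proof. by move=> tf; apply: tcM => //; apply: smooth_dotp; exact: openT. Qed.

Lemma tc_bounded f : tc f -> exists C, forall x, `|f x| <= C.
Proof.
move=> [sf [M fM] _].
have [|C [C0 fC]] := continuous_bounded_ball (f := f) (@compact_ball R n M).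
  by move=> x _; exact: (smooth_continuous sf).
exists C => x; have [/fC//|/fM ->] := leP (enorm x) M.
by rewrite normr0.
Qed.

Lemma tc_measurable f : tc f -> measurable_fun setT f.
Proof.
by move=> [sf _ _]; apply: continuousT_measurable => x; exact: (smooth_continuous sf).
Qed.

Lemma tc_dominated f : tc f -> dominated f.
Proof.
move=> tf; have [C fC] := tc_bounded tf; have [_ [M fM] _] := tf.
exact: (dominated_bounded (tc_measurable tf) fC fM).
Qed.

Lemma tc_integrable f : tc f -> mu.-integrable setT (EFin \o f).
Proof. by move=> /tc_dominated; exact: dominated_integrable. Qed.

Lemma is_derive_line_at f (x v : V) (t : R) : derivable f (t *: v + x) v ->
  is_derive t 1 (fun s : R => f (s *: v + x)) ('D_v f (t *: v + x)).
Proof.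
move=> df.
have d0 := (is_derive_line f (t *: v + x) v _).1 (derivableP df).
have ds : is_derive t 1 (fun s : R => s - t) 1.
  by have := is_deriveB (is_derive_id t 1) (is_derive_cst t t 1); rewrite subr0.
have d0' : is_derive ((fun s : R => s - t) t) 1 (fun h : R => f (h *: v + (t *: v + x))) ('D_v f (t *: v + x)).
  by rewrite /= subrr.
have := @is_derive1_comp R (fun h : R => f (h *: v + (t *: v + x))) (fun s : R => s - t) t _ _ d0' ds.
rewrite mulr1.
congr is_derive; apply/funext => s /=.
by rewrite addrA -scalerDl subrK.
Qed.

(** By translation invariance, the integral of f(t v + y) over y does not depend on t;
    differentiating it under the integral sign at t = 0 gives the integral of 'D_v f. *)
Lemma integral_derive0 v f : tc f -> \int[mu]_x 'D_v f x = 0.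
Proof.
move=> tf; have [sf [M fM] _] := tf.
have [C DC] := tc_bounded (tc_derive v tf).
have [_ [N DN] _] := tc_derive v tf.
pose F (t : R) (y : V) := f (t *: v + y).
have dF (t : R) (y : V) : is_derive t 1 (fun s => F s y) ('D_v f (t *: v + y)).
  by apply: is_derive_line_at; apply: (smooth_derivable sf).
have dFE (t : R) (y : V) : partial1of2 F t y = 'D_v f (t *: v + y).
  by rewrite partial1of2E; have := dF t y => h; rewrite derive_val.
have n1 : (1 : R) != 0 by exact: oner_neq0.
(* One majorant for all |t| < 1: 'D_v f vanishes beyond radius N, and |y|^2 <= 2 |t v + y|^2 + 2 |t
   v|^2 bounds those y whose translate stays within that radius. *)
pose G (y : V) : R := if enorm y <= Num.sqrt (2 * N ^+ 2 + 2 * dotp v v) then C else 0.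
have C0 : 0 <= C by apply: le_trans (DC 0).
have mG : measurable_fun setT G.
  apply: measurable_fun_ifT => //.
  by apply: (measurable_fun_ler (g := cst _)) => //; exact: measurable_enorm.
have iG : mu.-integrable setT (EFin \o G).
  apply: dominated_integrable.
  apply: (@dominated_bounded _ _ _ (Num.sqrt (2 * N ^+ 2 + 2 * dotp v v)) C) => // y.
    by rewrite /G; case: ifP; rewrite ?normr0// ger0_norm.
  by rewrite /G leNgt => ->.
have GE x y : x \in `](-1), 1[%R -> `|partial1of2 F x y| <= G y.
  rewrite in_itv/= dFE => /andP[x1 x2]; rewrite /G; case: ifPn => // yN.
  rewrite DN ?normr0//.
  rewrite ltNge; apply: contra yN => h.
  have N0 : 0 <= N by exact: le_trans (enorm_ge0 _) h.
  have h2 : dotp (x *: v + y) (x *: v + y) <= N ^+ 2.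
    by rewrite -sqr_enorm ler_sqr ?nnegrE ?enorm_ge0.
  rewrite -[enorm y]/(Num.sqrt _) ler_sqrt; last first.
    by rewrite addr_ge0// mulr_ge0 ?sqr_ge0 ?dotp_ge0.
  have p1 := dotp_ge0 (x *: v + (x *: v + y)).
  have x21 : x ^+ 2 <= 1 by rewrite -real_normK ?num_real// exprn_ile1// ler_norml; apply/andP; split; lra.
  have v0 := dotp_ge0 v.
  have xv : x ^+ 2 * dotp v v <= dotp v v by rewrite ler_piMl.
  move: h2 p1 xv; rewrite !(dotpDl, dotpDr, dotpZl, dotpZr) (dotpC y v) => h2 p1 xv.
  have : x * (x * dotp v v) = x ^+ 2 * dotp v v by rewrite expr2 mulrA.
  move=> e; rewrite e in h2 p1; lra.
have iF x : mu.-integrable setT (EFin \o F x).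
  have := integrable_affine (x *: v) n1 (tc_integrable tf).
  by apply: eq_integrable => // y _; rewrite /F /= scale1r addrC.
have I0 : `](-1), 1[%classic (0 : R) by rewrite /= in_itv/= ltrN10 ltr01.
have := @differentiation_under_integral R _ V mu F setT measurableT 0 (-1) 1 I0
  (fun x _ => iF x) (fun x y _ _ => @ex_derive _ _ _ _ _ _ _ (dF x y)) G _ iG _.
have G0 y : 0 <= G y by rewrite /G; case: ifP.
move=> /(_ G0 (fun x y Ix _ => GE x y Ix)).
have -> : (fun x' : R => \int[mu]_y F x' y) = cst (\int[mu]_y f y).
  apply/funext => t /=.
  have := Rintegral_affine (t *: v) n1 (tc_integrable tf).
  rewrite normr1 expr1n invr1 mul1r => <-.
  by apply: eq_Rintegral => y _; rewrite /F scale1r addrC.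
rewrite derive1_cst => /esym h; rewrite -[RHS]h.
by apply: eq_Rintegral => y _; rewrite dFE scale0r add0r.
Qed.

(* The phase c keeps the family closed under derivation: cos' = cos(. + pi/2).
   Phases 0 and -pi/2 give the real part and minus the imaginary part of the transform. *)
Definition K (c : R) f (x : V) : R := \int[mu]_y (f y * cos (dotp x y + c)).

Lemma is_derive_cosD (c t : R) : is_derive t 1 (fun s : R => cos (s + c)) (cos (t + (c + pi / 2))).
Proof.
have ds : is_derive t 1 (fun s : R => s + c) 1.
  by have := is_deriveD (is_derive_id t 1) (is_derive_cst c t 1); rewrite addr0.
have := @is_derive1_comp R cos (fun s : R => s + c) t _ _ (is_derive_cos (t + c)) ds.
by rewrite mulr1 addrA cosDpihalf.
Qed.

Lemma smooth_cos_dotp (c : R) (x : V) : smooth_on setT (fun y => cos (dotp x y + c)).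
Proof.
have := @smooth_comp R n (fun b => exists c, b = fun t => cos (t + c)) setT setT
  (fun y => dotp y x) openT _ (smooth_dotp x openT) (fun _ _ => I) (fun t => cos (t + c)).
rewrite (_ : (fun y => cos (dotp x y + c)) = (fun t => cos (t + c)) \o (fun y : V => dotp y x)).
  apply; last by exists c.
  move=> _ [d ->]; exists (fun t => cos (t + (d + pi / 2))); first by exists (d + pi / 2).
  by move=> t _; exact: is_derive_cosD.
by apply/funext => y /=; rewrite dotpC.
Qed.

Lemma tc_cos c x f : tc f -> tc (fun y => f y * cos (dotp x y + c)).
Proof. by move=> tf; apply: tcM => //; exact: smooth_cos_dotp. Qed.

Lemma K_eq c f g x : (forall y, f y = g y) -> K c f x = K c g x.
Proof. by move=> fg; apply: eq_Rintegral => y _; rewrite fg. Qed.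

Lemma KD c f g x : tc f -> tc g -> K c (fun y => f y + g y) x = K c f x + K c g x.
Proof.
move=> tf tg; rewrite /K -RintegralD//; try by apply: tc_integrable; exact: tc_cos.
by apply: eq_Rintegral => y _; rewrite mulrDl.
Qed.

Lemma KZ c a f x : tc f -> K c (fun y => a * f y) x = a * K c f x.
Proof.
move=> tf; rewrite /K -RintegralZl//; last by apply: tc_integrable; exact: tc_cos.
by apply: eq_Rintegral => y _; rewrite mulrA.
Qed.

Lemma K_sum c m (F : 'I_m -> V -> R) x : (forall i, tc (F i)) ->
  K c (fun y => \sum_(i < m) F i y) x = \sum_(i < m) K c (F i) x.
Proof.
elim: m F => [|m ih] F tF.
  have z := Rintegral_cst mu (@measurableT _ V) 0; rewrite mul0r in z.
  rewrite big_ord0 /K -[RHS]z.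
  by apply: eq_Rintegral => y _; rewrite big_ord0 mul0r.
rewrite big_ord_recl -ih// -KD//; last by apply: tc_sum.
by apply: K_eq => y; rewrite big_ord_recl.
Qed.

Lemma KDpi c f x : tc f -> K (c + pi) f x = - K c f x.
Proof.
move=> tf; rewrite -mulN1r -RintegralZl//; last by apply: tc_integrable; exact: tc_cos.
by apply: eq_Rintegral => y _; rewrite addrA cosDpi mulrN mulN1r.
Qed.

Lemma derive_cos_dotp c (x y v : V) :
  is_derive y v (fun y => cos (dotp x y + c)) (cos (dotp x y + (c + pi / 2)) * dotp v x).
Proof.
have h := is_derive_comp1 (b := fun t => cos (t + c)) (u := fun y => dotp y x)
  (@ex_derive _ _ _ _ _ _ _ (is_derive_dotp x y v)) (is_derive_cosD c (dotp y x)).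
have e : 'D_v (fun y : V => dotp y x) y = dotp v x.
  by have := is_derive_dotp x y v => d; rewrite derive_val.
rewrite e dotpC in h.
rewrite (_ : (fun y => _) = (fun t => cos (t + c)) \o (fun y : V => dotp y x))//.
by apply/funext => z /=; rewrite dotpC.
Qed.

(** Integration by parts: the integral over y of the derivative of f(y) cos(x . y + c) along v is
    zero. *)
Lemma K_derive c f v x : tc f ->
  K c (fun y => 'D_v f y) x = - dotp v x * K (c + pi / 2) f x.
Proof.
move=> tf; have [sf _ _] := tf.
have := integral_derive0 v (tc_cos c x tf).
have e (y : V) : 'D_v (fun y => f y * cos (dotp x y + c)) y =
    'D_v f y * cos (dotp x y + c) + dotp v x * (f y * cos (dotp x y + (c + pi / 2))).
  have df : derivable f y v by apply: (smooth_derivable sf).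
  have := is_deriveM (derivableP df) (derive_cos_dotp c x y v) => h.
  by rewrite derive_val /GRing.scale/=; ring.
under eq_Rintegral do rewrite e.
rewrite RintegralD//; last 2 first.
- by apply: tc_integrable; apply: tc_cos; exact: tc_derive.
- by apply: tc_integrable; apply: tcZ; exact: tc_cos.
rewrite RintegralZl//; last by apply: tc_integrable; exact: tc_cos.
by move=> /eqP; rewrite addr_eq0 mulNr => /eqP.
Qed.

Lemma is_derive_K c f (x v : V) : tc f ->
  is_derive x v (K c f) (K (c + pi / 2) (fun y => f y * dotp y v) x).
Proof.
move=> tf; apply/is_derive_line.
pose F (t : R) (y : V) := f y * cos (dotp (t *: v + x) y + c).
have dF (t : R) (y : V) : is_derive t 1 (fun s => F s y) (f y * dotp y v * cos (dotp (t *: v + x) y + (c + pi / 2))).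
  have d1 : is_derive t 1 (fun s : R => cos (dotp (s *: v + x) y + c))
      (cos (dotp (t *: v + x) y + (c + pi / 2)) * dotp v y).
    have h := derive_cos_dotp c y (t *: v + x) v.
    have h' := @is_derive_line_at (fun z => cos (dotp y z + c)) x v t (@ex_derive _ _ _ _ _ _ _ h).
    rewrite (dotpC _ y).
    have -> : (fun s : R => cos (dotp (s *: v + x) y + c)) = (fun s => cos (dotp y (s *: v + x) + c)).
      by apply/funext => s; rewrite dotpC.
    by apply: (is_derive_eq h'); rewrite derive_val.
  have := is_deriveZ (f y) d1; rewrite /GRing.scale/=.
  by rewrite (dotpC v y) [cos _ * _]mulrC mulrA.
have dFE (t : R) (y : V) : partial1of2 F t y = f y * dotp y v * cos (dotp (t *: v + x) y + (c + pi / 2)).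
  by rewrite partial1of2E; have := dF t y => h; rewrite derive_val.
pose G y := `|f y * dotp y v|.
have iG : mu.-integrable setT (EFin \o G).
  by apply: integrable_norm; apply: tc_integrable; exact: tc_dotp.
have I0 : `](-1), 1[%classic (0 : R) by rewrite /= in_itv/= ltrN10 ltr01.
have GE t y : `](-1), 1[%classic t -> setT y -> `|partial1of2 F t y| <= G y.
  by move=> _ _; rewrite dFE normrM ler_piMr// cos_max.
have iF t : mu.-integrable setT (EFin \o F t) by apply: tc_integrable; exact: tc_cos.
have dd t y : `](-1), 1[%classic t -> setT y -> derivable (F ^~ y) t 1.
  by move=> _ _; exact: (@ex_derive _ _ _ _ _ _ _ (dF t y)).
have G0 y : 0 <= G y by rewrite /G.
have D := @derivable_under_integral R _ V mu F setT measurableT 0 (-1) 1 I0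
  (fun x _ => iF x) dd G G0 iG GE.
have E := @differentiation_under_integral R _ V mu F setT measurableT 0 (-1) 1 I0
  (fun x _ => iF x) dd G G0 iG GE.
apply: DeriveDef; first exact: D.
rewrite -derive1E [LHS]E; apply: eq_Rintegral => y _.
by rewrite dFE scale0r add0r.
Qed.

Lemma K_bound c f x : tc f -> `|K c f x| <= \int[mu]_y `|f y|.
Proof.
move=> tf; rewrite (le_trans (le_normr_Rintegral measurableT _))//.
  by apply: tc_integrable; exact: tc_cos.
apply: le_Rintegral => //.
- by apply: integrable_norm; apply: tc_integrable; exact: tc_cos.
- by apply: integrable_norm; exact: tc_integrable.
- by move=> y _; rewrite normrM ler_piMr// cos_max.
Qed.

(** The operator 1 - Laplacian. On the transform side it multiplies by 1 + |x|^2, which never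
    vanishes, so it can be iterated and divided out to obtain decay. *)
Definition bessel f y := f y + \sum_(i < n) (-1) * 'D_(delta_mx 0 i) (fun z => 'D_(delta_mx 0 i) f z) y.

Lemma tc_bessel f : tc f -> tc (bessel f).
Proof.
move=> tf; apply: tcD => //; apply: tc_sum => i; apply: tcZ.
by apply: tc_derive; exact: tc_derive.
Qed.

Lemma K_derive2 c f v x : tc f ->
  K c (fun y => 'D_v (fun z => 'D_v f z) y) x = - dotp x v ^+ 2 * K c f x.
Proof.
move=> tf; rewrite K_derive; last exact: tc_derive.
rewrite K_derive// -addrA (_ : pi / 2 + pi / 2 = pi); last by lra.
by rewrite KDpi// (dotpC v x); ring.
Qed.

Lemma K_bessel c f x : tc f -> K c (bessel f) x = (1 + dotp x x) * K c f x.
Proof.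
move=> tf.
have tdd i : tc (fun y => 'D_(delta_mx 0 i) (fun z => 'D_(delta_mx 0 i) f z) y).
  by apply: tc_derive; exact: tc_derive.
rewrite /bessel KD//; last by apply: tc_sum => i; exact: tcZ.
rewrite K_sum; last by move=> i; exact: tcZ.
rewrite mulrDl mul1r; congr (_ + _).
rewrite [in RHS]/dotp mulr_suml; apply: eq_bigr => i _.
by rewrite KZ// K_derive2// dotp_delta; ring.
Qed.

(** Each application of 1 - Laplacian to f gains one factor 1 + |x|^2. The constant M does not
    depend on the phase c. *)
Lemma K_decay N f : tc f ->
  exists2 M, 0 <= M & forall c x, `|K c f x| <= M * (1 + dotp x x) ^- N.
Proof.
elim: N f => [|N ih] f tf.
  exists (\int[mu]_y `|f y|); first by apply: Rintegral_ge0 => y _; exact: normr_ge0.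
  by move=> c x; rewrite expr0 invr1 mulr1; exact: K_bound.
have [M M0 hM] := ih _ (tc_bessel tf); exists M => // c x.
have p : 0 < 1 + dotp x x by rewrite ltr_pwDl// dotp_ge0.
have := hM c x; rewrite K_bessel// normrM (gtr0_norm p) exprS invfM mulrCA.
by rewrite mulrC -ler_pdivlMr// mulrC.
Qed.

Lemma weight_ge (x : V) : (1 + dotp x x) ^- n <= weight x.
Proof.
have p : 0 < 1 + dotp x x by rewrite ltr_pwDl// dotp_ge0.
have := weight_lb (M := enorm x) (lexx _).
by rewrite sqr_enorm exprVn.
Qed.

(** Fubini yields measurability of a parametric integral when the integrand is integrable in both
    variables. Multiplying by [weight] x makes it so, and this positive factor is divided out
    afterwards. *)
Lemma measurable_K c f : tc f -> measurable_fun setT (K c f).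
Proof.
move=> tf.
have m : measurable_fun setT (fun p : V * V => (weight p.1 * (f p.2 * cos (dotp p.1 p.2 + c)))).
  apply: measurable_funM; first exact: (measurableT_comp (@measurable_weight R n) measurable_fst).
  apply: measurable_funM; first exact: (measurableT_comp (tc_measurable tf) measurable_snd).
  apply: (measurableT_comp (f := @cos R)).
    by apply: continuous_measurable_fun; exact: continuous_cos.
  by apply: measurable_funD => //; exact: measurable_dotp.
have := @integrable_Rintegral1 _ _ V V R mu mu (fun x y => weight x * (f y * cos (dotp x y + c)))
  (@weight R n) (fun y => `|f y|) m (integrable_weight _ _) _ _.
move=> /(_ (integrable_norm (tc_integrable tf))).
have b x y : `|weight x * (f y * cos (dotp x y + c))| <= weight x * `|f y|.
  by rewrite normrM gtr0_norm ?weight_gt0// ler_wpM2l ?(ltW (weight_gt0 _))// normrM ler_piMr// cos_max.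
move=> /(_ b) /(measurable_int _) /measurable_EFinP mK.
have -> : K c f = fun x => (weight x)^-1 * \int[mu]_y (weight x * (f y * cos (dotp x y + c))).
  apply/funext => x; rewrite RintegralZl//; last by apply: tc_integrable; exact: tc_cos.
  by rewrite mulKf// gt_eqF// weight_gt0.
apply: measurable_funM => //.
rewrite (_ : (fun x => _) = fun x : V => \prod_(i < n) (1 + x ord0 i ^+ 2)); last first.
  by apply/funext => x; rewrite /weight prodfV invrK.
apply: measurable_prod => i _; apply: measurable_funD => //.
by apply: measurable_funX; exact: measurable_coord.
Qed.
End test_functions.

Section dominated_Rintegral.
Context d (T : measurableType d) (R : realType) (m : {measure set T -> \bar R}).

Lemma Rintegral_dominated_cvg (h_ : nat -> T -> R) (h g : T -> R) :
  (forall k, measurable_fun setT (h_ k)) -> measurable_fun setT h ->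
  m.-integrable setT (EFin \o g) -> (forall k x, `|h_ k x| <= g x) ->
  (forall x, h_ k x @[k --> \oo] --> h x) ->
  \int[m]_x h_ k x @[k --> \oo] --> \int[m]_x h x.
Proof.
move=> mh_ mh ig hg cv.
have cvE : {ae m, forall x, setT x -> (h_ k x)%:E @[k --> \oo] --> (h x)%:E}.
  by apply: aeW => x _; apply/fine_cvgP; split; [exact: nearW|exact: cv].
have mE k : measurable_fun setT (fun x => (h_ k x)%:E) by apply/measurable_EFinP.
have mE' : measurable_fun setT (fun x => (h x)%:E) by apply/measurable_EFinP.
have dE : {ae m, forall x k, setT x -> (`|(h_ k x)%:E| <= (EFin \o g) x)%E}.
  by apply: aeW => x k _; rewrite lee_fin.
have [ih _ cvi] := dominated_convergence measurableT mE mE' cvE ig dE.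
apply/fine_cvg; rewrite fineK//.
exact: integrable_fin_num.
Qed.
End dominated_Rintegral.

(** * Fourier inversion for the cosine transform of test functions *)

Section inversion.
Variables (R : realType) (n : nat).
Notation V := 'rV[R]_n.
Implicit Types (f : V -> R).

Lemma continuous_lap : continuous (@lap R n).
Proof.
rewrite /lap; apply: continuous_big => [|i _ x]; first exact: mul_continuous.
apply: (@continuous_comp _ _ _ (fun x : V => x ord0 i) (@lap1 R)).
  exact: coord_continuous.
exact: continuous_lap1.
Qed.

Lemma lap0 : lap (0 : V) = 1.
Proof. by rewrite /lap big1// => i _; rewrite mxE /lap1 normr0 oppr0 expR0. Qed.

Let cvg_line (x z : V) : z + k.+1%:R^-1 *: x @[k --> \oo] --> z.
Proof.
rewrite -[X in _ --> X]addr0; apply: cvgD; first exact: cvg_cst.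
rewrite -(scale0r x); apply: cvgZr_tmp; exact: cvg_harmonic.
Qed.

Lemma tc_K_integrable c f : tc f -> mu.-integrable setT (EFin \o K c f).
Proof.
move=> tf; apply: dominated_integrable; split; first exact: measurable_K.
have [M M0 hM] := K_decay n tf; exists M => x.
by rewrite (le_trans (hM c x))// ler_wpM2l// weight_ge.
Qed.

Let cvg_fweight f (z : V) : tc f ->
  \int[mu]_u (f (z + k.+1%:R^-1 *: u) * weight u) @[k --> \oo] --> f z * pi ^+ n.
Proof.
move=> tf; have [C fC] := tc_bounded tf; have [sf _ _] := tf.
have -> : f z * pi ^+ n = \int[mu]_u (f z * weight (u : V)).
  rewrite RintegralZl//; last exact: integrable_weight.
  by rewrite /Rintegral integral_weight.
apply: (@Rintegral_dominated_cvg _ _ _ _ _ _ (fun u => C * weight u)).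
- move=> k; apply: measurable_funM; last exact: measurable_weight.
  apply: (measurableT_comp (tc_measurable tf)).
  rewrite (_ : (fun u => _) = fun u => k.+1%:R^-1 *: u + z); last by apply/funext => u; rewrite addrC.
  exact: measurable_affine.
- by apply: measurable_funM => //; exact: measurable_weight.
- exact: (integrableZl measurableT C (integrable_weight R n)).
- by move=> k u; rewrite normrM (gtr0_norm (weight_gt0 u)) ler_wpM2r// ltW// weight_gt0.
- move=> u; apply: cvgM; last exact: cvg_cst.
  have cf : {for z, continuous f} by exact: (smooth_continuous sf).
  have hh := (@continuous_cvg nat V R \oo _ (fun k => z + k.+1%:R^-1 *: u) f z cf (@cvg_line u z)). exact: hh.
Qed.

(** The factor 2^n comes from the transform of [lap], pi^n is the total mass of [weight], and 1/2
    comes from the product-to-sum formula for cosines. *)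
Definition kappa : R := (2 * pi) ^+ n / 2.

Lemma kappa_gt0 : 0 < kappa.
Proof. by rewrite divr_gt0// exprn_gt0// mulr_gt0// pi_gt0. Qed.

Let lap_scaled (A : R) (w : V) : 0 < A ->
  \int[mu]_x (lap (A^-1 *: x) * cos (dotp x w)) = A ^+ n * (2 ^+ n * weight (A *: w)).
Proof.
move=> A0; have Ai : A^-1 != 0 by rewrite invr_eq0 gt_eqF.
have := Rintegral_affine 0 Ai (integrable_lap_cos (A *: w) 0).
rewrite integral_lap_cos cos0 mul1r gtr0_norm ?invr_gt0// exprVn invrK => <-.
apply: eq_Rintegral => x _; rewrite !addr0 dotpZl dotpZr mulKf ?gt_eqF//.
Qed.

Let lap_scaled_integrable (A : R) : 0 < A ->
  mu.-integrable setT (EFin \o (fun x : V => lap (A^-1 *: x))).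
Proof.
move=> A0; have Ai : A^-1 != 0 by rewrite invr_eq0 gt_eqF.
have := integrable_affine 0 Ai (integrable_lap R n).
by apply: eq_integrable => // x _ /=; rewrite addr0.
Qed.

(** Substitution u = A (y - z): as A grows, the functions A^n weight(A (y - z)) concentrate at z
    while keeping mass pi^n. *)
Let shift_weight f (A : R) (z : V) : 0 < A -> tc f ->
  \int[mu]_y (f y * (A ^+ n * weight (A *: (y - z)))) = \int[mu]_u (f (z + A^-1 *: u) * weight u).
Proof.
move=> A0 tf; have A1 : A != 0 by rewrite gt_eqF.
have [C fC] := tc_bounded tf.
have ih : mu.-integrable setT (EFin \o (fun u => f (z + A^-1 *: u) * weight u)).
  apply: (le_integrable measurableT _ _ (integrableZl measurableT C (integrable_weight R n))).
    apply/measurable_EFinP; apply: measurable_funM; last exact: measurable_weight.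
    apply: (measurableT_comp (tc_measurable tf)).
    rewrite (_ : (fun u => _) = fun u => A^-1 *: u + z); last by apply/funext => u; rewrite addrC.
    exact: measurable_affine.
  move=> x _ /=; rewrite lee_fin normrM (gtr0_norm (weight_gt0 x)) (le_trans _ (ler_norm _))//.
  by rewrite ler_wpM2r// ltW// weight_gt0.
have h := Rintegral_affine (- (A *: z)) A1 ih.
have An : A ^+ n != 0 by rewrite expf_neq0.
rewrite gtr0_norm// in h.
have -> : \int[mu]_u (f (z + A^-1 *: u) * weight u) =
   A ^+ n * \int[mu]_x (f (z + A^-1 *: (A *: x - A *: z)) * weight (A *: x - A *: z)).
  by rewrite h mulrA divff// mul1r.
rewrite -RintegralZl//; last exact: (integrable_affine (- (A *: z)) A1 ih).
apply: eq_Rintegral => y _; rewrite -scalerBr scalerA mulVf// scale1r [z + _]addrC subrK.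
by rewrite mulrCA.
Qed.

Let scaled_weight_ge0 (A : R) (y : V) : 0 < A -> 0 <= A ^+ n * weight (A *: y).
Proof. by move=> A0; rewrite mulr_ge0// ?exprn_ge0 ?(ltW A0)// ltW// weight_gt0. Qed.

Let lap_scaled_cos_integrable (A : R) (w : V) : 0 < A ->
  mu.-integrable setT (EFin \o (fun x : V => lap (A^-1 *: x) * cos (dotp x w))).
Proof.
move=> A0; have iA := lap_scaled_integrable A0.
have mw : measurable_fun setT (fun x : V => cos (dotp x w)).
  by have := measurable_cos_dotp w 0; under eq_fun do rewrite addr0.
apply: (le_integrable measurableT _ _ iA).
  apply/measurable_EFinP; apply: measurable_funM mw.
  exact: ((measurable_EFinP _ _).1 (measurable_int _ iA)).
by move=> x _; rewrite lee_fin normrM ler_piMr ?cos_max ?normr_ge0.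
Qed.

(** The product of cosines becomes half of cos(x . (y - z)) + cos(x . (y + z)), so two kernels
    appear, centred at z and at -z. *)
Let regularized_inner (A c : R) (y z : V) : 0 < A ->
  \int[mu]_x (lap (A^-1 *: x) * cos (dotp x z + 0) * (c * cos (dotp x y + 0))) =
  2 ^+ n / 2 * (c * (A ^+ n * weight (A *: (y - z))) + c * (A ^+ n * weight (A *: (y - (- z))))).
Proof.
move=> A0.
have prodcos (l a b : R) : l * cos b * (c * cos a) = c / 2 * (l * cos (a - b) + l * cos (a + b)).
  by rewrite cosB cosD; move: (cos a) (cos b) (sin a) (sin b) => ? ? ? ?; field.
transitivity (\int[mu]_x (c / 2 * (lap (A^-1 *: x) * cos (dotp x (y - z)) +
      lap (A^-1 *: x) * cos (dotp x (y + z))))).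
  by apply: eq_Rintegral => x _; rewrite !addr0 prodcos dotpDr dotpNr dotpDr.
have i1 := lap_scaled_cos_integrable (y - z) A0.
have i2 := lap_scaled_cos_integrable (y + z) A0.
have i12 : mu.-integrable setT (EFin \o (fun x : V => lap (A^-1 *: x) * cos (dotp x (y - z)) +
      lap (A^-1 *: x) * cos (dotp x (y + z)))).
  exact: (integrableD measurableT i1 i2).
rewrite (RintegralZl _ measurableT i12) (RintegralD measurableT i1 i2) !lap_scaled// opprK.
move: (weight _) (weight _) (A ^+ n) (2 ^+ n) => ? ? ? ?; by field.
Qed.

Let shifted_weight_integrable f (A : R) (w : V) : 0 < A -> tc f ->
  mu.-integrable setT (EFin \o (fun y => f y * (A ^+ n * weight (A *: (y - w))))).
Proof.
move=> A0 tf; have [C fC] := tc_bounded tf; have A1 : A != 0 by rewrite gt_eqF.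
have i0 := integrable_affine (- (A *: w)) A1 (integrable_weight R n).
have i1 : mu.-integrable setT (EFin \o (fun y : V => weight (A *: (y - w)))).
  by apply: eq_integrable i0 => // y _; rewrite /= scalerBr.
have i := integrableZl measurableT (C * A ^+ n) i1.
apply: (le_integrable measurableT _ _ i).
  apply/measurable_EFinP; apply: measurable_funM; first exact: tc_measurable.
  apply: measurable_funM; first exact: measurable_cst.
  exact: ((measurable_EFinP _ _).1 (measurable_int _ i1)).
move=> y _; rewrite lee_fin (le_trans _ (ler_norm _))//.
have p := scaled_weight_ge0 (y - w) A0.
by rewrite normrM -mulrA (ger0_norm p) ler_wpM2r.
Qed.

Let regularized f z (A : R) : 0 < A -> tc f ->
  \int[mu]_x (lap (A^-1 *: x) * (K 0 f x * cos (dotp x z))) =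
  2 ^+ n / 2 * (\int[mu]_u (f (z + A^-1 *: u) * weight u) + \int[mu]_u (f (- z + A^-1 *: u) * weight u)).
Proof.
move=> A0 tf.
pose F (x y : V) : R := lap (A^-1 *: x) * cos (dotp x z + 0) * (f y * cos (dotp x y + 0)).
have iA := lap_scaled_integrable A0.
have mF : measurable_fun setT (fun p : V * V => F p.1 p.2).
  apply: measurable_funM.
    apply: measurable_funM.
      exact: (measurableT_comp ((measurable_EFinP _ _).1 (measurable_int _ iA)) measurable_fst).
    exact: (measurableT_comp (measurable_cos_dotp z 0) measurable_fst).
  apply: measurable_funM; first exact: (measurableT_comp (tc_measurable tf) measurable_snd).
  apply: (measurableT_comp (f := @cos R)).
    by apply: continuous_measurable_fun; exact: continuous_cos.
  apply: measurable_funD; last exact: measurable_cst.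
  by apply: measurable_dotp; [exact: measurable_fst|exact: measurable_snd].
have bF x y : `|F x y| <= lap (A^-1 *: x) * `|f y|.
  rewrite /F !normrM (gtr0_norm (lap_gt0 _)) -mulrA ler_wpM2l ?(ltW (lap_gt0 _))//.
  by rewrite mulrCA ler_piMr// -normrM normrM mulr_ile1// cos_max.
transitivity (\int[mu]_x \int[mu]_y F x y).
  apply: eq_Rintegral => x _; rewrite /F (RintegralZl _ measurableT (tc_integrable (tc_cos 0 x tf))).
  by rewrite addr0 -mulrA [cos _ * _]mulrC.
rewrite (Rintegral_fubini mF iA (integrable_norm (tc_integrable tf)) bF).
have i1 := shifted_weight_integrable z A0 tf.
have i2 := shifted_weight_integrable (- z) A0 tf.
transitivity (\int[mu]_y (2 ^+ n / 2 *
    (f y * (A ^+ n * weight (A *: (y - z))) + f y * (A ^+ n * weight (A *: (y - (- z))))))).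
  by apply: eq_Rintegral => y _; exact: regularized_inner.
by rewrite (RintegralZl _ measurableT (integrableD measurableT i1 i2))
  (RintegralD measurableT i1 i2) !shift_weight.
Qed.

(** The factor lap(x / A) makes the double integral absolutely convergent, so the order of
    integration may be exchanged. With A = k + 1 tending to infinity, the left side converges by
    domination by |K 0 f| and the right side by concentration of the kernels. Phase 0 retains only
    the even part of f. *)
Lemma K_inversion f z : tc f ->
  \int[mu]_x (K 0 f x * cos (dotp x z)) = kappa * (f z + f (- z)).
Proof.
move=> tf.
have mcz : measurable_fun setT (fun x : V => cos (dotp x z)).
  by have := measurable_cos_dotp z 0; under eq_fun do rewrite addr0.
have mK := measurable_K 0 tf.
have c1 : \int[mu]_x (lap (k.+1%:R^-1 *: x) * (K 0 f x * cos (dotp x z))) @[k --> \oo] -->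
    \int[mu]_x (K 0 f x * cos (dotp x z)).
  apply: (@Rintegral_dominated_cvg _ _ _ _ _ _ (fun x => `|K 0 f x|)).
  - move=> k; apply: measurable_funM; last exact: measurable_funM.
    by have /measurable_EFinP := measurable_int _ (@lap_scaled_integrable k.+1%:R (ltr0Sn _ _)).
  - exact: measurable_funM.
  - by apply: integrable_norm; exact: tc_K_integrable.
  - move=> k x; rewrite normrM (gtr0_norm (lap_gt0 _)) (@le_trans _ _ (1 * `|K 0 f x * cos (dotp x z)|))//.
      by rewrite ler_wpM2r// lap_le1.
    by rewrite mul1r normrM ler_piMr// cos_max.
  - move=> x; rewrite -[X in _ --> X]mul1r; apply: cvgM; last exact: cvg_cst.
    rewrite -[X in _ --> X]lap0; have h : k.+1%:R^-1 *: x @[k --> \oo] --> (0 : V).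
      by have := @cvg_line x 0; under eq_fun do rewrite add0r.
    exact: (@continuous_cvg nat V R \oo _ (fun k => k.+1%:R^-1 *: x) (@lap R n) 0 (@continuous_lap 0) h).
have c2 : \int[mu]_x (lap (k.+1%:R^-1 *: x) * (K 0 f x * cos (dotp x z))) @[k --> \oo] -->
    kappa * (f z + f (- z)).
  under eq_fun do rewrite (@regularized f z _ (ltr0Sn _ _) tf).
  have -> : kappa * (f z + f (- z)) = 2 ^+ n / 2 * (f z * pi ^+ n + f (- z) * pi ^+ n).
    by rewrite /kappa exprMn; field.
  apply: cvgM; first exact: cvg_cst.
  by apply: cvgD; exact: cvg_fweight.
by rewrite -(cvg_lim _ c1)// (cvg_lim _ c2).
Qed.
End inversion.

(** * Integration by parts against powers on the half line *)

Section half_line_ibp.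
Variable R : realType.
Notation leb := (@lebesgue_measure R).

Variables (e M : R).
Hypotheses (e0 : 0 < e) (eM : e < M).
Let D : set R := `[e / 2, M + 1]%classic.

Definition inner_support (f : R -> R) := forall s, 0 < s -> s < e \/ M < s -> f s = 0.

Lemma inner_support_restrict (a : R) (f : R -> R) : inner_support f ->
  (fun s => s `^ a * f s) \_ D = (fun s => ppow a s * f s).
Proof.
move=> fs; apply/funext => s; rewrite patchE; case: ifPn => [|].
  rewrite inE /D /= in_itv/= => /andP[h _]; rewrite ppow_gt0E//.
  by apply: lt_le_trans h; rewrite divr_gt0.
move/negP; rewrite inE /D /= in_itv/= => /negP; rewrite negb_and -!ltNge => h.
have [s0|s0] := leP s 0; first by rewrite ppow_le0E// mul0r.
rewrite fs ?mulr0//; case/orP: h => h; [left|right]; lra.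
Qed.

Lemma inner_support_integrable (a : R) (f : R -> R) : continuous f ->
  inner_support f -> leb.-integrable setT (EFin \o (fun s => ppow a s * f s)).
Proof.
move=> cf fs; rewrite -(inner_support_restrict a fs).
have mD : measurable (D : set (measurableTypeR R)) by exact: measurable_itv.
have h : leb.-integrable D (EFin \o (fun s => s `^ a * f s)).
  apply: continuous_compact_integrable; first exact: segment_compact.
  apply: continuous_in_subspaceT => s; rewrite inE /D /= in_itv/= => /andP[h _].
  have s0 : 0 < s by apply: lt_le_trans h; rewrite divr_gt0.
  have c : {for s, continuous (fun s : R => s `^ a * f s)}.
    by apply: continuousM; [exact: continuous_powR|exact: cf].
  exact: c.
have := (integrable_mkcond (mu := leb) _ mD).1 h.
by apply: eq_integrable => // s _; rewrite restrict_EFin.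
Qed.

(** The product s^a g is differentiated on [e/2, M + 1], whose endpoints lie strictly outside
    [e, M]; hence there are no boundary terms, whatever the exponent a. *)
Lemma ppow_ibp (a : R) (g g' : R -> R) : (forall s : R, is_derive s 1 g (g' s)) ->
  continuous g' -> inner_support g -> inner_support g' ->
  \int[leb]_s (ppow a s * g' s) = - a * \int[leb]_s (ppow (a - 1) s * g s).
Proof.
move=> dg cg' sg sg'.
have cg : continuous g.
  by move=> s; apply: differentiable_continuous; apply/derivable1_diffP; have := dg s.
have i1 := inner_support_integrable a cg' sg'.
have i2 := inner_support_integrable (a - 1) cg sg.
have i2' := integrableZl measurableT a i2.
have mD : measurable (D : set (measurableTypeR R)) by exact: measurable_itv.
suff h : \int[leb]_s (ppow a s * g' s + a * (ppow (a - 1) s * g s)) = 0.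
  rewrite (RintegralD measurableT i1 i2') (RintegralZl _ measurableT i2) in h.
  by move/eqP: h; rewrite addr_eq0 mulNr => /eqP.
have e0' := e0; have eM' := eM.
have dl : e / 2 < M + 1 by lra.
have p (s : R) : e / 2 <= s -> 0 < s by move=> h; apply: lt_le_trans h; rewrite divr_gt0.
pose F (s : R) : R := s `^ a * g s.
pose F' (s : R) : R := s `^ a * g' s + a * (s `^ (a - 1) * g s).
have dF (s : R) : 0 < s -> is_derive s 1 F (F' s).
  move=> s0; have d1 := is_derive_powR 1 a s0.
  have d1' : is_derive s 1 (fun t : R => t `^ a) (a * s `^ (a - 1)).
    by move: d1; rewrite mul1r; congr is_derive; apply/funext => t; rewrite mul1r.
  have := is_deriveM d1' (dg s); congr is_derive.
  by rewrite /F' /GRing.scale/= [g s * _]mulrC -mulrA.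
have cF (s : R) : 0 < s -> {for s, continuous F}.
  by move=> s0; apply: differentiable_continuous; apply/derivable1_diffP; have := dF s s0.
have ftc := @continuous_FTC2 R F' F (e / 2) (M + 1) dl.
have {}ftc : (\int[leb]_(x in `[(e / 2)%R, (M + 1)%R]) (F' x)%:E = (F (M + 1)%R)%:E - (F (e / 2)%R)%:E)%E.
  apply: ftc.
  - apply: continuous_in_subspaceT => s; rewrite inE/= in_itv/= => /andP[/p s0 _].
    have c : {for s, continuous F'}.
      apply: continuousD; first by apply: continuousM; [exact: continuous_powR|exact: cg'].
      apply: continuousM; first exact: cst_continuous.
      by apply: continuousM; [exact: continuous_powR|exact: cg].
    exact: c.
  - split.
    + by move=> s; rewrite in_itv/= => /andP[h _]; have := dF s (p _ (ltW h)).
    + by apply: cvg_at_right_filter; apply: cF; exact: p.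
    + by apply: cvg_at_left_filter; apply: cF; apply: p; exact: ltW.
  - move=> s; rewrite in_itv/= => /andP[h _]; have := dF s (p _ (ltW h)).
    by move=> d; rewrite derive1E derive_val.
have z1 : F (M + 1) = 0 by rewrite /F sg ?mulr0//; [lra|right; lra].
have z2 : F (e / 2) = 0 by rewrite /F sg ?mulr0//; [exact: p|left; lra].
rewrite z1 z2 subee// in ftc.
transitivity (\int[leb]_(s in D) F' s); last by rewrite /Rintegral ftc.
rewrite [RHS]Rintegral_mkcond; apply: eq_Rintegral => s _.
have := congr1 (fun f => f s) (inner_support_restrict a sg').
have := congr1 (fun f => f s) (inner_support_restrict (a - 1) sg).
rewrite /= !patchE /F'; case: ifPn => _ <- <- //.
by rewrite mulr0 addr0.
Qed.
End half_line_ibp.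

Lemma inner_support_mono (R : realType) (e M e' M' : R) (f : R -> R) : e' <= e -> M <= M' ->
  inner_support e M f -> inner_support e' M' f.
Proof. by move=> ee MM sf s s0 [h|h]; apply: sf => //; [left|right]; lra. Qed.

Section slice.
Variables (R : realType) (n : nat).
Notation V := 'rV[R]_n.
Notation leb := (@lebesgue_measure R).
Implicit Types (f : V -> R).

Definition even_line f (xi : V) (s : R) : R := f (s *: xi) + f (- (s *: xi)).

Let is_derive_ray f (xi : V) (s : R) : tc f ->
  is_derive s 1 (fun s : R => f (s *: xi)) ('D_xi f (s *: xi)).
Proof.
move=> [sf _ _].
have := @is_derive_line_at R n f 0 xi s; rewrite addr0 => h.
have d : derivable f (s *: xi) xi by apply: (smooth_derivable sf).
by have := h d; under eq_fun do rewrite addr0.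
Qed.

Let odd_line f (xi : V) (s : R) : R := f (s *: xi) - f (- (s *: xi)).

Let is_derive_neg_ray f (xi : V) (s : R) : tc f ->
  is_derive s 1 (fun s : R => f (- (s *: xi))) (- 'D_xi f (- (s *: xi))).
Proof.
move=> tf; have d := is_derive_ray xi (- s) tf.
have dn : is_derive s 1 (fun s : R => - s) (-1) by exact: is_deriveNid.
have := @is_derive1_comp R (fun s : R => f (s *: xi)) (fun s : R => - s) s _ _ d dn.
rewrite mulrN1 scaleNr; congr is_derive.
by apply/funext => t /=; rewrite scaleNr.
Qed.

Let is_derive_even_line f (xi : V) (s : R) : tc f ->
  is_derive s 1 (even_line f xi) (odd_line (fun x => 'D_xi f x) xi s).
Proof. by move=> tf; exact: (is_deriveD (is_derive_ray xi s tf) (is_derive_neg_ray xi s tf)). Qed.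

Let is_derive_odd_line f (xi : V) (s : R) : tc f ->
  is_derive s 1 (odd_line f xi) (even_line (fun x => 'D_xi f x) xi s).
Proof.
move=> tf; have := is_deriveB (is_derive_ray xi s tf) (is_derive_neg_ray xi s tf).
by rewrite opprK.
Qed.

Let even_line_continuous f (xi : V) : tc f -> continuous (even_line f xi).
Proof.
move=> tf s; apply: differentiable_continuous; apply/derivable1_diffP.
by have := is_derive_even_line xi s tf.
Qed.

Let odd_line_continuous f (xi : V) : tc f -> continuous (odd_line f xi).
Proof.
move=> tf s; apply: differentiable_continuous; apply/derivable1_diffP.
by have := is_derive_odd_line xi s tf.
Qed.

Let tc_line_support f (xi : V) : xi != 0 -> tc f -> exists e M, [/\ 0 < e, e < M,
  inner_support e M (even_line f xi) & inner_support e M (odd_line f xi)].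
Proof.
move=> xi0 [_ [M fM] [e e0 fe]].
have x0 : 0 < enorm xi by rewrite enorm_gt0.
exists (e / enorm xi), (`|M| / enorm xi + e / enorm xi + 1).
have p : 0 < e / enorm xi by rewrite divr_gt0.
have q : 0 <= `|M| / enorm xi by rewrite divr_ge0// ltW.
have H (s : R) : 0 < s -> s < e / enorm xi \/ `|M| / enorm xi + e / enorm xi + 1 < s ->
    f (s *: xi) = 0 /\ f (- (s *: xi)) = 0.
  move=> s0 [h|h].
    have es : enorm (s *: xi) < e by rewrite enormZ gtr0_norm// -ltr_pdivlMr.
    by rewrite !fe// enormN.
  have es : M < enorm (s *: xi).
    rewrite (le_lt_trans (ler_norm M))// enormZ [`|s|]gtr0_norm// -ltr_pdivrMr//; lra.
  by rewrite !fM// enormN.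
split => //; first lra.
- by move=> s s0 /(H s s0)[h1 h2]; rewrite /even_line h1 h2 addr0.
- by move=> s s0 /(H s s0)[h1 h2]; rewrite /odd_line h1 h2 subr0.
Qed.

(** Derivation along xi exchanges the even and odd parts of f on the line, so two integrations by
    parts return to the even part. *)
Let even_line_ibp (a : R) f (xi : V) : xi != 0 -> tc f ->
  \int[leb]_s (ppow a s * even_line (fun x => 'D_xi (fun z => 'D_xi f z) x) xi s) =
  a * (a - 1) * \int[leb]_s (ppow (a - 1 - 1) s * even_line f xi s).
Proof.
move=> xi0 tf.
have tDf := tc_derive xi tf; have tDDf := tc_derive xi tDf.
have [e1 [M1 [e10 eM1 h1 _]]] := tc_line_support xi0 tf.
have [e2 [M2 [e20 eM2 _ h2]]] := tc_line_support xi0 tDf.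
have [e3 [M3 [e30 eM3 h3 _]]] := tc_line_support xi0 tDDf.
(* The supports of f and of its first two derivatives are placed in one common interval. *)
pose e := Num.min e1 (Num.min e2 e3); pose M := Num.max M1 (Num.max M2 M3).
have [ee1 ee2 ee3] : [/\ e <= e1, e <= e2 & e <= e3].
  by split; rewrite /e !ge_min lexx ?orbT.
have [MM1 MM2 MM3] : [/\ M1 <= M, M2 <= M & M3 <= M].
  by split; rewrite /M !le_max lexx ?orbT.
have e0 : 0 < e by rewrite /e !lt_min e10 e20.
have eM : e < M by lra.
have {}h1 := inner_support_mono ee1 MM1 h1.
have {}h2 := inner_support_mono ee2 MM2 h2.
have {}h3 := inner_support_mono ee3 MM3 h3.
rewrite (ppow_ibp e0 eM a (fun s => is_derive_odd_line xi s tDf) (even_line_continuous tDDf) h2 h3).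
rewrite (ppow_ibp e0 eM (a - 1) (fun s => is_derive_even_line xi s tf) (odd_line_continuous tDf) h1 h2).
by rewrite mulrA; congr (_ * _); ring.
Qed.

(* For 0 < q < 2, write |t|^q as a multiple of int_0^oo s^(-1-q) (1 - cos (s t)) ds and invert
   the Fourier transform along the line R xi.  For larger q, replace f by its second
   derivative along xi, which lowers q by 2, and integrate by parts on the line. *)
Lemma slice_formula (m : nat) (q : R) : m%:R * 2 < q < m.+1%:R * 2 ->
  exists2 c, 0 < c & forall f (xi : V), tc f -> xi != 0 ->
    mu.-integrable setT (EFin \o (fun x => `|dotp x xi| `^ q * K 0 f x)) /\
    \int[mu]_x (`|dotp x xi| `^ q * K 0 f x) =
      (-1) ^+ m.+1 * c * \int[leb]_s (ppow (-1 - q) s * even_line f xi s).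
Proof.
elim: m q => [|m ih] q.
  rewrite mul0r mul1r => q02.
  exists (kappa R n / coskern_cst q).
    by rewrite divr_gt0 ?coskern_cst_gt0// kappa_gt0.
  move=> f xi tf xi0.
  have c0 := coskern_cst_gt0 q02.
  (* The kernel bound grows like 1 + (x . xi)^2. That factor is absorbed into the transform of f
     minus its second derivative along xi, which is integrable, and the result is a product majorant
     for Fubini. *)
  pose f2 y := f y - 'D_xi (fun z => 'D_xi f z) y.
  have tDD : tc (fun y => 'D_xi (fun z => 'D_xi f z) y) by apply: tc_derive; exact: tc_derive.
  have tf2 : tc f2.
    have := tcD tf (tcZ (-1) tDD); congr tc.
    by apply/funext => y; rewrite mulN1r.
  have Kf2 x : K 0 f2 x = (1 + dotp x xi ^+ 2) * K 0 f x.
    have -> : K 0 f2 x = K 0 (fun y => f y + (-1) * 'D_xi (fun z => 'D_xi f z) y) x.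
      by apply: K_eq => y; rewrite mulN1r.
    rewrite KD//; last exact: tcZ.
    by rewrite KZ// K_derive2//; ring.
  pose F (x : V) (s : R) := coskern q (dotp x xi) s * K 0 f x.
  pose a (x : V) := 2 * `|K 0 f2 x|.
  have ia : mu.-integrable setT (EFin \o a).
    exact: (integrableZl measurableT 2 (integrable_norm (tc_K_integrable 0 tf2))).
  have ib : leb.-integrable setT (EFin \o ppow2 (1 - q) (-1 - q)).
    by have /andP[q0 q2] := q02; apply: integrable_ppow2; lra.
  have mF : measurable_fun setT (fun p : V * measurableTypeR R => F p.1 p.2).
    apply: measurable_funM; last exact: (measurableT_comp (measurable_K 0 tf) measurable_fst).
    apply: measurable_funM.
      exact: (measurableT_comp (@measurable_ppow R _) measurable_snd).
    apply: measurable_funB; first exact: measurable_cst.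
    apply: (measurableT_comp (f := @cos R)).
      by apply: continuous_measurable_fun; exact: continuous_cos.
    apply: measurable_funM; first exact: measurable_snd.
    by apply: measurable_dotp; [exact: measurable_fst|exact: measurable_cst].
  have bF x s : `|F x s| <= a x * ppow2 (1 - q) (-1 - q) s.
    rewrite /F normrM (ger0_norm (coskern_ge0 _ _ _)) /a Kf2 normrM [`|1 + _|]ger0_norm; last first.
      by rewrite addr_ge0// sqr_ge0.
    rewrite [leRHS](_ : _ = 2 * (1 + dotp x xi ^+ 2) * ppow2 (1 - q) (-1 - q) s * `|K 0 f x|); last by ring.
    by rewrite ler_wpM2r// coskern_le.
  have E1 x : `|dotp x xi| `^ q * K 0 f x = (coskern_cst q)^-1 * \int[leb]_s F x s.
    rewrite /F (RintegralZr _ measurableT (integrable_coskern (dotp x xi) q02)).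
    by rewrite integral_coskern//; field; rewrite gt_eqF.
  have iF1 := integrable_Rintegral1 mF ia ib bF.
  have E0 : (fun x => `|dotp x xi| `^ q * K 0 f x) = (fun x => (coskern_cst q)^-1 * \int[leb]_s F x s).
    by apply/funext => x; exact: E1.
  rewrite E0; split; first exact: (integrableZl measurableT (coskern_cst q)^-1 iF1).
  rewrite (RintegralZl _ measurableT iF1) (Rintegral_fubini mF ia ib bF).
  have iKc (z : V) : mu.-integrable setT (EFin \o (fun x => K 0 f x * cos (dotp x z))).
    apply: (le_integrable measurableT _ _ (tc_K_integrable 0 tf)).
      apply/measurable_EFinP; apply: measurable_funM; first exact: measurable_K.
      by have := measurable_cos_dotp z 0; under eq_fun do rewrite addr0.
    by move=> x _; rewrite lee_fin normrM ler_piMr ?cos_max ?normr_ge0.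
  (* The constant 1 in 1 - cos is treated as cos(x . 0): inversion sends it to a multiple of f 0,
     which vanishes. Only the term -cos remains, whence the sign (-1)^1 for m = 0. *)
  have E2 s : \int[mu]_x F x s = - kappa R n * (ppow (-1 - q) s * even_line f xi s).
    transitivity (\int[mu]_x (ppow (-1 - q) s * (K 0 f x * cos (dotp x 0) - K 0 f x * cos (dotp x (s *: xi))))).
      apply: eq_Rintegral => x _; rewrite /F /coskern dotp0r cos0 dotpZr.
      by move: (cos _) (K 0 f x) (ppow _ _) => ? ? ?; ring.
    rewrite (RintegralZl _ measurableT (integrableB measurableT (iKc 0) (iKc (s *: xi)))).
    rewrite (RintegralB measurableT (iKc 0) (iKc (s *: xi))) !K_inversion//.
    have f0 : f 0 = 0 by have [_ _ [e e0 fe]] := tf; rewrite fe// enorm0.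
    by rewrite oppr0 f0 /even_line; ring.
  have [e [M [e0 eM h _]]] := tc_line_support xi0 tf.
  have ie := inner_support_integrable e0 (-1 - q) (even_line_continuous tf) h.
  transitivity ((coskern_cst q)^-1 * \int[leb]_s (- kappa R n * (ppow (-1 - q) s * even_line f xi s))).
    by congr (_ * _); apply: eq_Rintegral => s _; exact: E2.
  by rewrite (RintegralZl _ measurableT ie) expr1; ring.
move=> /andP[q1 q2].
have [|c c0 hc] := ih (q - 2).
  by rewrite -!natr1 in q1 q2 *; apply/andP; split; lra.
have m0 : (0 : R) <= m%:R by rewrite ler0n.
have q0 : 2 < q by rewrite -natr1 in q1; lra.
(* Two integrations by parts with exponent a = 1 - q give a (a - 1) = (q - 1) q, positive since q >
   2. The extra sign comes from the second derivative, which acts as -(x . xi)^2 on the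
   transform. *)
exists (c * ((q - 1) * q)).
  by rewrite mulr_gt0// mulr_gt0; lra.
move=> f xi tf xi0.
have tDD : tc (fun y => 'D_xi (fun z => 'D_xi f z) y) by apply: tc_derive; exact: tc_derive.
have [iDD eDD] := hc _ xi tDD xi0.
have E x : `|dotp x xi| `^ q * K 0 f x =
    -1 * (`|dotp x xi| `^ (q - 2) * K 0 (fun y => 'D_xi (fun z => 'D_xi f z) y) x).
  rewrite K_derive2//.
  have -> : `|dotp x xi| `^ q = `|dotp x xi| `^ (q - 2) * dotp x xi ^+ 2.
    rewrite -[dotp x xi ^+ 2]real_normK ?num_real// -powR_mulrn// -powRD; last first.
      by apply/implyP; rewrite subrK => /eqP h; exfalso; lra.
    by rewrite subrK.
  by ring.
have E0 : (fun x => `|dotp x xi| `^ q * K 0 f x) =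
    (fun x => -1 * (`|dotp x xi| `^ (q - 2) * K 0 (fun y => 'D_xi (fun z => 'D_xi f z) y) x)).
  by apply/funext => x; exact: E.
rewrite E0; split; first exact: (integrableZl measurableT (-1) iDD).
rewrite (RintegralZl _ measurableT iDD) eDD even_line_ibp//.
rewrite (_ : -1 - (q - 2) - 1 - 1 = -1 - q); last by ring.
by rewrite [(-1) ^+ m.+2]exprS; ring.
Qed.

End slice.

(** * Smoothness and homogeneity of the radial integrals of a transform *)

Section radial_integral.
Variables (R : realType) (n : nat).
Notation V := 'rV[R]_n.
Notation leb := (@lebesgue_measure R).
Implicit Types (f : V -> R) (c a : R).

(* Meaningful for x <> 0 only: at x = 0 the integrand is not integrable in general and the value is junk. *)
Definition radint c a f (x : V) : R := \int[leb]_s (ppow a s * K c f (s *: x)).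

Lemma measurable_K_ray c a f (x : V) : tc f ->
  measurable_fun setT (fun s : R => ppow a s * K c f (s *: x)).
Proof.
move=> tf; apply: measurable_funM; first exact: measurable_ppow.
apply: (measurableT_comp (measurable_K c tf)).
by apply: measurable_scale; [exact: measurable_id|exact: measurable_cst].
Qed.

(** Near s = 0 the transform is bounded and a > -1 suffices; for large s its decay gives s^(-2N).
    The majorant is uniform over |x|^2 >= d, as needed for differentiation in x. *)
Lemma K_ray_dominated (a d : R) f : -1 < a -> 0 < d -> tc f ->
  exists2 G : R -> R, leb.-integrable setT (EFin \o G) &
    forall c x s, d <= dotp x x -> `|ppow a s * K c f (s *: x)| <= G s.
Proof.
move=> a1 d0 tf.
(* N > a and N >= 1 give a - 2N < -N <= -1, which is integrability at infinity. *)
pose N := (Num.truncn `|a|).+1.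
have aN : a < N%:R by rewrite (le_lt_trans (ler_norm _))//; exact: truncnS_gt.
have [M M0 hM] := K_decay N tf.
exists (fun s => M * (1 + d ^- N) * ppow2 a (a - (2 * N)%:R) s).
  have h : leb.-integrable setT (EFin \o ppow2 a (a - (2 * N)%:R)).
    have N1 : (1 : R) <= N%:R by rewrite ler1n.
    by apply: integrable_ppow2 => //; rewrite natrM; lra.
  exact: (integrableZl measurableT (M * (1 + d ^- N)) h).
move=> c x s dx; rewrite normrM ger0_norm ?ppow_ge0//.
have dN : 0 <= d ^- N by rewrite invr_ge0 exprn_ge0// ltW.
have [s0|s0] := leP s 0.
  by rewrite ppow_le0E// mul0r mulr_ge0 ?ppow2_ge0// mulr_ge0// addr_ge0.
rewrite (le_trans (ler_wpM2l (ppow_ge0 _ _) (hM c (s *: x))))//.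
rewrite mulrCA -[leRHS]mulrA ler_wpM2l// /ppow2; case: ifPn => s1.
  rewrite mulrC ler_wpM2r ?ppow_ge0// (@le_trans _ _ 1)//; last by rewrite lerDl.
  by rewrite invf_le1 ?exprn_gt0 ?exprn_ege1 ?lerDl ?dotp_ge0// ltr_pwDl// dotp_ge0.
have q : (1 + dotp (s *: x) (s *: x)) ^- N <= d ^- N * s ^- (2 * N).
  rewrite -invfM exprM -exprMn lef_pV2; last 2 first.
  - by rewrite posrE exprn_gt0// ltr_pwDl// dotp_ge0.
  - by rewrite posrE exprn_gt0// mulr_gt0// exprn_gt0.
  have p : d * s ^+ 2 <= 1 + dotp (s *: x) (s *: x).
    rewrite dotpZl dotpZr mulrA -expr2 mulrC ler_wpDl// ler_wpM2l// sqr_ge0//.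
  apply: lerXn2r => //; rewrite nnegrE.
    by rewrite mulr_ge0 ?sqr_ge0// ltW.
  by rewrite addr_ge0// dotp_ge0.
rewrite (le_trans (ler_wpM2l (ppow_ge0 _ _) q))//.
rewrite !ppow_gt0E// powRB; last by apply/implyP => _; rewrite gt_eqF.
rewrite powR_mulrn ?(ltW s0)// mulrCA ler_wpM2r ?lerDr// divr_ge0 ?powR_ge0//.
by rewrite exprn_ge0// ltW.
Qed.

Lemma radint_integrable a c f (x : V) : -1 < a -> tc f -> x != 0 ->
  leb.-integrable setT (EFin \o (fun s => ppow a s * K c f (s *: x))).
Proof.
move=> a1 tf x0; have d0 : 0 < dotp x x by rewrite dotp_gt0.
have [G iG hG] := K_ray_dominated a1 d0 tf.
apply: (le_integrable measurableT _ _ iG).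
  by apply/measurable_EFinP; exact: measurable_K_ray.
by move=> s _; rewrite lee_fin (le_trans (hG c x s (lexx _)))// ler_norm.
Qed.

Lemma dotp_half (x w : V) : dotp x x / 2 <= dotp (w + x) (w + x) + dotp w w.
Proof.
have := dotp_ge0 (w + (w + x)).
by rewrite !(dotpDl, dotpDr) (dotpC x w) => h; lra.
Qed.

(** The derivative of K at s x along v brings out a factor s, which raises the exponent to a + 1;
    the condition a > -1 is thus preserved. *)
Lemma is_derive_radint a c f (x v : V) : -1 < a -> tc f -> x != 0 ->
  is_derive x v (radint c a f) (radint (c + pi / 2) (a + 1) (fun y => f y * dotp y v) x).
Proof.
move=> a1 tf x0; apply/is_derive_line.
have d0 : 0 < dotp x x by rewrite dotp_gt0.
(* For |t| <= u one has |t v| <= |x|/2, hence |t v + x|^2 >= |x|^2/4: the whole interval stays in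
   the region where one majorant holds. *)
pose u := enorm x / (2 * (1 + enorm v)).
have v1 : 0 < 1 + enorm v by rewrite ltr_pwDl// enorm_ge0.
have u0 : 0 < u by rewrite divr_gt0 ?enorm_gt0// mulr_gt0.
have tfv := tc_dotp v tf.
have dpos (t : R) : t \in `](- u), u[ -> dotp x x / 4 <= dotp (t *: v + x) (t *: v + x).
  rewrite in_itv/= => /andP[t1 t2].
  have := dotp_half x (t *: v); set D := dotp (_ + _) _.
  rewrite dotpZl dotpZr mulrA -expr2 -sqr_enorm -[dotp v v]sqr_enorm -exprMn => h.
  have : (t * enorm v) ^+ 2 <= (enorm x / 2) ^+ 2.
    rewrite -[leLHS]real_normK ?num_real//; apply: lerXn2r; rewrite ?nnegrE ?divr_ge0 ?enorm_ge0//.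
    rewrite normrM (ger0_norm (enorm_ge0 v)).
    have tu : `|t| <= u by rewrite ler_norml; apply/andP; split; apply: ltW.
    apply: (le_trans (ler_wpM2r (enorm_ge0 v) tu)).
    rewrite (_ : u * enorm v = enorm x / 2 * (enorm v / (1 + enorm v))); last first.
      by rewrite /u; field; rewrite gt_eqF.
    by rewrite ler_piMr ?divr_ge0 ?enorm_ge0// ler_pdivrMr// mul1r lerDr.
  by rewrite expr_div_n; lra.
have d4 : 0 < dotp x x / 4 by rewrite divr_gt0.
have a11 : -1 < a + 1 by lra.
have [G iG hG] := K_ray_dominated a11 d4 tfv.
have nz (t : R) : t \in `](- u), u[ -> t *: v + x != 0.
  by move=> tu; rewrite -dotp_gt0; exact: lt_le_trans (dpos t tu).
pose F (t s : R) := ppow a s * K c f (s *: (t *: v + x)).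
have dF (t s : R) : is_derive t 1 (fun t => F t s)
   (ppow (a + 1) s * K (c + pi / 2) (fun y => f y * dotp y v) (s *: (t *: v + x))).
  have h := is_derive_K c (t *: (s *: v) + s *: x) (s *: v) tf.
  have h1 := is_derive_line_at (@ex_derive _ _ _ _ _ _ _ h).
  have h2 := is_deriveZ (ppow a s) h1.
  have -> : (fun t => F t s) = ppow a s \*: (fun t : R => K c f (t *: (s *: v) + s *: x)).
    by apply/funext => r; rewrite /F /= scalerDr !scalerA (mulrC s).
  have vE : s *: (t *: v + x) = t *: (s *: v) + s *: x by rewrite scalerDr !scalerA (mulrC s).
  apply: (is_derive_eq h2); rewrite derive_val ppow_mul vE.
  set z := _ + s *: x; rewrite -[LHS]/(ppow a s * _) -mulrA; congr (_ * _).
  rewrite -KZ//; apply: K_eq => y; rewrite dotpZr; ring.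
have dFE (t s : R) : partial1of2 F t s =
   ppow (a + 1) s * K (c + pi / 2) (fun y => f y * dotp y v) (s *: (t *: v + x)).
  by rewrite partial1of2E; have := dF t s => h; rewrite derive_val.
have I0 : `](- u), u[%classic (0 : R) by rewrite /= in_itv/= oppr_lt0 u0.
have iF (t : R) : `](- u), u[%classic t -> leb.-integrable setT (EFin \o F t).
  by move=> tu; apply: radint_integrable => //; exact: nz.
have dd (t s : R) : `](- u), u[%classic t -> setT s -> derivable (F ^~ s) t 1.
  by move=> _ _; exact: (@ex_derive _ _ _ _ _ _ _ (dF t s)).
pose G' s := `|G s|.
have G0 s : 0 <= G' s by exact: normr_ge0.
have iG' : leb.-integrable setT (EFin \o G') by exact: integrable_norm.
have GE (t s : R) : `](- u), u[%classic t -> setT s -> `|partial1of2 F t s| <= G' s.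
  by move=> tu _; rewrite dFE (le_trans (hG _ _ _ (dpos t tu)))// ler_norm.
have D := @derivable_under_integral R _ (measurableTypeR R) leb F setT measurableT 0 (- u) u I0
  iF dd G' G0 iG' GE.
have E := @differentiation_under_integral R _ (measurableTypeR R) leb F setT measurableT 0 (- u) u I0
  iF dd G' G0 iG' GE.
apply: DeriveDef; first exact: D.
rewrite -derive1E [LHS]E; apply: eq_Rintegral => s _.
by rewrite dFE scale0r add0r.
Qed.

(** The integral is linear in the direction w; expanding w in coordinates reduces the bound to n
    fixed majorants, one for each basis vector. *)
Let radint_lipschitz a c f (d : R) : -1 < a -> tc f -> 0 < d ->
  exists2 B, 0 <= B & forall (z w : V), d <= dotp z z ->
    `|radint c a (fun y => f y * dotp y w) z| <= B * enorm w.
Proof.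
move=> a1 tf d0.
have td i := tc_dotp (delta_mx 0 i) tf.
have /choice[G hG] : forall i : 'I_n, exists G : R -> R, leb.-integrable setT (EFin \o G) /\
    forall c x s, d <= dotp x x ->
    `|ppow a s * K c (fun y => f y * dotp y (delta_mx 0 i)) (s *: x)| <= G s.
  by move=> i; have [G iG h] := K_ray_dominated a1 d0 (td i); exists G.
pose S s := \sum_(i < n) `|G i s|.
have iS : leb.-integrable setT (EFin \o S).
  have h := @integrable_sum _ _ _ leb setT measurableT _ (index_enum 'I_n) xpredT
    (fun i => EFin \o (fun s => `|G i s|)) (fun i _ => integrable_norm (hG i).1).
  by apply: eq_integrable h => // s _; rewrite /= sumEFin.
exists (\int[leb]_s S s).
  by apply: Rintegral_ge0 => s _; apply: sumr_ge0.
move=> z w dz.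
have z0 : z != 0 by rewrite -dotp_gt0 (lt_le_trans d0).
have iw := radint_integrable c a1 (tc_dotp w tf) z0.
rewrite mulrC -(RintegralZl _ measurableT iS).
rewrite (le_trans (le_normr_Rintegral measurableT iw))//.
apply: le_Rintegral => //; first exact: integrable_norm.
  exact: (integrableZl measurableT (enorm w) iS).
move=> s _.
have -> : K c (fun y => f y * dotp y w) (s *: z) =
    \sum_(i < n) w ord0 i * K c (fun y => f y * dotp y (delta_mx 0 i)) (s *: z).
  have -> : K c (fun y => f y * dotp y w) (s *: z) =
      K c (fun y => \sum_(i < n) w ord0 i * (f y * dotp y (delta_mx 0 i))) (s *: z).
    apply: K_eq => y; rewrite {1}/dotp mulr_sumr; apply: eq_bigr => i _.
    by rewrite dotp_delta; ring.
  rewrite K_sum; last by move=> i; exact: tcZ.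
  by apply: eq_bigr => i _; rewrite KZ.
rewrite mulr_sumr (le_trans (ler_norm_sum _ _ _))// /S mulr_sumr; apply: ler_sum => i _.
rewrite mulrCA normrM ler_pM// ?normr_coord_le//.
by rewrite (le_trans ((hG i).2 c z s dz))// ler_norm.
Qed.

(** Directional derivatives alone do not imply continuity. Near x they are bounded by B |w|
    uniformly in the direction w, and the mean value theorem on the segment from x to y then gives a
    Lipschitz estimate. *)
Lemma continuous_radint a c f (x : V) : -1 < a -> tc f -> x != 0 ->
  {for x, continuous (radint c a f)}.
Proof.
move=> a1 tf x0.
have d0 : 0 < dotp x x by rewrite dotp_gt0.
have d4 : 0 < dotp x x / 4 by rewrite divr_gt0.
have a11 : -1 < a + 1 by lra.
have [B B0 hB] := radint_lipschitz (c + pi / 2) a11 tf d4.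
have main y : dotp (y - x) (y - x) <= dotp x x / 4 ->
    `|radint c a f x - radint c a f y| <= B * enorm (y - x).
  move=> yx; set w := y - x.
  have dpos (t : R) : 0 <= t <= 1 -> dotp x x / 4 <= dotp (t *: w + x) (t *: w + x).
    move=> /andP[t0 t1].
    have := dotp_half x (t *: w); set D := dotp (_ + _) _.
    rewrite dotpZl dotpZr mulrA => h.
    have : t * t * dotp w w <= 1 * dotp w w.
      by rewrite ler_wpM2r ?dotp_ge0// mulr_ile1.
    move: yx; rewrite -/w; lra.
  have nz (t : R) : 0 <= t <= 1 -> t *: w + x != 0.
    by move=> tu; rewrite -dotp_gt0; exact: lt_le_trans (dpos t tu).
  pose h (t : R) : R := radint c a f (t *: w + x).
  pose h' (t : R) : R := radint (c + pi / 2) (a + 1) (fun y => f y * dotp y w) (t *: w + x).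
  have dh (t : R) : 0 <= t <= 1 -> is_derive t 1 h (h' t).
    move=> t01; have d := is_derive_radint c w a1 tf (nz t t01).
    have d' := is_derive_line_at (@ex_derive _ _ _ _ _ _ _ d).
    by apply: (is_derive_eq d'); rewrite derive_val.
  have ch : {within `[0, 1], continuous h}.
    apply: continuous_in_subspaceT => t; rewrite inE/= in_itv/= => t01.
    have c1 : {for t, continuous h}.
      by apply: differentiable_continuous; apply/derivable1_diffP; have := dh t t01.
    exact: c1.
  have dh' (t : R) : t \in `]0, 1[%R -> is_derive t 1 h (h' t).
    by rewrite in_itv/= => /andP[t0 t1]; apply: dh; rewrite !ltW.
  have [t t01] := MVT ltr01 dh' ch.
  have tt : 0 <= t <= 1 by move: t01; rewrite in_itv/= => /andP[t0 t1]; rewrite !ltW.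
  rewrite subr0 mulr1 /h scale1r scale0r add0r subrK distrC => ->.
  exact: hB (dpos t tt).
apply/(@cvgrPdist_le _ _ _ (nbhs x) (nbhs_filter x)) => e e0; near=> y.
have yx1 : enorm (y - x) < Num.min (enorm x / 2) (e / (B + 1)).
  near: y.
  have cn : {for x, continuous (fun y : V => enorm (y - x))}.
    have c1 : {for x, continuous (fun y : V => y - x)}.
      by apply: continuousB; [exact: (@cvg_id _ (nbhs x))|exact: cst_continuous].
    exact: (@continuous_comp V V R (fun y : V => y - x) (@enorm R n) x c1 (@continuous_enorm R n _)).
  move: cn; rewrite /prop_for /continuous_at subrr enorm0 => cn.
  have pos : 0 < Num.min (enorm x / 2) (e / (B + 1)).
    by rewrite lt_min !divr_gt0// ?enorm_gt0// ltr_wpDl.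
  exact: (@cvgr_lt R V (nbhs x) (nbhs_filter x) (fun y : V => enorm (y - x)) 0 cn _ pos).
move: yx1; rewrite lt_min => /andP[yx1 yx2].
have p1 : 0 < B + 1 by rewrite ltr_wpDl.
rewrite (le_trans (main y _))//.
  rewrite -!sqr_enorm (_ : enorm x ^+ 2 / 4 = (enorm x / 2) ^+ 2); last by rewrite expr_div_n; field.
  by apply: lerXn2r; rewrite ?nnegrE ?divr_ge0 ?enorm_ge0// ltW.
rewrite (@le_trans _ _ ((B + 1) * enorm (y - x)))//.
  by rewrite ler_wpM2r ?enorm_ge0// lerDl.
by rewrite mulrC -ler_pdivlMr// ltW.
Unshelve. all: by end_near. Qed.

(** The family over all phases c, exponents a > -1 and test functions is closed under derivation, so
    coinduction applies. *)
Lemma smooth_radint a c f : -1 < a -> tc f -> smooth_on [set x : V | x != 0] (radint c a f).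
Proof.
move=> a1 tf.
apply: (@smooth_coind R n (fun g => exists c a f, [/\ -1 < a, tc f & g = radint c a f])).
- exact: open_neq0.
- move=> _ [d [b [g [b1 tg ->]]]] x x0; split; first exact: continuous_radint.
  by move=> v; exact: (@ex_derive _ _ _ _ _ _ _ (is_derive_radint d v b1 tg x0)).
- move=> _ v [d [b [g [b1 tg ->]]]].
  exists (radint (d + pi / 2) (b + 1) (fun y => g y * dotp y v)).
    by exists (d + pi / 2), (b + 1), (fun y => g y * dotp y v); split => //; [lra|exact: tc_dotp].
  move=> x x0; have h := is_derive_radint d v b1 tg x0.
  by rewrite derive_val.
- by exists c, a, f.
Qed.

Lemma radintZ a c f (l : R) (x : V) : -1 < a -> tc f -> x != 0 -> 0 < l ->
  radint c a f (l *: x) = l `^ (- a - 1) * radint c a f x.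
Proof.
move=> a1 tf x0 l0; have l1 : l != 0 by rewrite gt_eqF.
have i := radint_integrable c a1 tf x0.
have i2 := integrable_affine1 0 l1 i.
have h := Rintegral_affine1 0 l1 i.
rewrite gtr0_norm// in h.
have -> : radint c a f (l *: x) =
    \int[leb]_s (l `^ (- a) * (ppow a (l * s + 0) * K c f ((l * s + 0) *: x))).
  apply: eq_Rintegral => s _; rewrite addr0 ppowM// !mulrA -powRD; last by apply/implyP.
  by rewrite addNr powRr0 mul1r scalerA (mulrC s).
rewrite (RintegralZl _ measurableT i2) h mulrA; congr (_ * _).
by rewrite powRB; [rewrite powRr1// ltW|apply/implyP].
Qed.

Lemma radintN a f (x : V) : tc f -> radint 0 a f (- x) = radint 0 a f x.
Proof.
move=> tf; apply: eq_Rintegral => s _; congr (_ * _).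
by apply: eq_Rintegral => y _; rewrite !addr0 scalerN dotpNl cosN.
Qed.

(** By homogeneity of degree -a - 1, the radial extension is k |x|^(a+1) times the radial integral
    itself, a product of functions that are smooth off the origin. *)
Lemma Ce_inf_radint a f (k : R) : -1 < a -> tc f -> Ce_inf (fun x => k * radint 0 a f x).
Proof.
move=> a1 tf; split; first by move=> x _; rewrite radintN.
have o := @open_neq0 R n.
have s1 := smoothM o (@smooth_enorm_pow R n (a + 1)) (smooth_radint 0 a1 tf).
have := smoothM o (smooth_cst k o) s1.
apply: smooth_on_eq => // x x0; rewrite /radial.
have e0 : 0 < enorm x by rewrite enorm_gt0.
rewrite radintZ// ?invr_gt0//; congr (_ * (_ * _)).
rewrite -powR_inv1 ?enorm_ge0// -powRrM; congr (_ `^ _); ring.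
Qed.
End radial_integral.

(** * Polar coordinates and integrals over the sphere *)

Section polar.
Variables (R : realType) (n : nat).
Notation V := 'rV[R]_n.
Notation leb := (@lebesgue_measure R).
Implicit Types (f : V -> R).

Definition normal (x : V) : V := (enorm x)^-1 *: x.
(* The origin is removed because [normal 0 = 0] is not on the sphere. *)
Definition uball (x : V) : R := (0 < enorm x <= 1)%R%:R.

Lemma measurable_normal : measurable_fun setT normal.
Proof.
apply: measurable_scale; last exact: measurable_id.
rewrite (_ : (fun x : V => (enorm x)^-1) = (@powR R ^~ (-1)) \o @enorm R n); last first.
  by apply/funext => x /=; rewrite powR_inv1// enorm_ge0.
by apply: measurableT_comp; [exact: measurable_powR|exact: measurable_enorm].
Qed.

Lemma measurable_bool_natr d (T : measurableType d) (b : T -> bool) :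
  measurable_fun setT b -> measurable_fun setT (fun x => (b x)%:R : R).
Proof.
move=> mb; rewrite (_ : (fun x => _) = (fun x => if b x then 1 else 0 : R)); last first.
  by apply/funext => x; case: (b x).
exact: measurable_fun_ifT.
Qed.

Lemma measurable_uball : measurable_fun setT uball.
Proof.
apply: measurable_bool_natr; apply: measurable_and.
  by apply: measurable_fun_ltr; [exact: measurable_cst|exact: measurable_enorm].
by apply: measurable_fun_ler; [exact: measurable_enorm|exact: measurable_cst].
Qed.

(** The sphere is represented by the punctured unit ball through [normal], in line with
    [sphere_int]; s is the independent radial variable and s^(n-1) the Jacobian. *)
Definition pol f (x : V) (s : R) := uball x * (ppow (n%:R - 1) s * f (s *: normal x)).

Let pol2 f (x : V) (r : R) := uball x * enorm x ^+ n * (ppow (n%:R - 1) r * f (r *: x)).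

Let pol3 f (y : V) (r : R) :=
  ppow (- n%:R - 1) r * ((0 < enorm y <= r)%R%:R * (enorm y ^+ n * f y)).

Let measurable_pol f : measurable_fun setT f ->
  measurable_fun setT (fun p : V * measurableTypeR R => pol f p.1 p.2).
Proof.
move=> mf; apply: measurable_funM.
  exact: (measurableT_comp measurable_uball measurable_fst).
apply: measurable_funM; first exact: (measurableT_comp (measurable_ppow _) measurable_snd).
apply: (measurableT_comp mf); apply: measurable_scale; first exact: measurable_snd.
exact: (measurableT_comp measurable_normal measurable_fst).
Qed.

Let measurable_pol2 f : measurable_fun setT f ->
  measurable_fun setT (fun p : V * measurableTypeR R => pol2 f p.1 p.2).
Proof.
move=> mf; apply: measurable_funM.
  apply: measurable_funM; first exact: (measurableT_comp measurable_uball measurable_fst).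
  apply: measurable_funX; exact: (measurableT_comp (@measurable_enorm R n) (@measurable_fst _ _ V R)).
apply: measurable_funM; first exact: (measurableT_comp (measurable_ppow _) measurable_snd).
by apply: (measurableT_comp mf); apply: measurable_scale; [exact: measurable_snd|exact: measurable_fst].
Qed.

Let measurable_pol3 f : measurable_fun setT f ->
  measurable_fun setT (fun p : V * measurableTypeR R => pol3 f p.1 p.2).
Proof.
move=> mf; apply: measurable_funM.
  exact: (measurableT_comp (measurable_ppow _) measurable_snd).
apply: measurable_funM.
  have me := measurableT_comp (@measurable_enorm R n) (@measurable_fst _ _ V R).
  apply: measurable_bool_natr; apply: measurable_and.
    by apply: measurable_fun_ltr; [exact: measurable_cst|exact: me].
  by apply: measurable_fun_ler; [exact: me|exact: measurable_snd].
apply: measurable_funM; last exact: (measurableT_comp mf measurable_fst).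
apply: measurable_funX; exact: (measurableT_comp (@measurable_enorm R n) (@measurable_fst _ _ V R)).
Qed.

Let sec1 (F : V -> R -> R) x : measurable_fun setT (fun p : V * measurableTypeR R => F p.1 p.2) ->
  measurable_fun setT (F x).
Proof. by move=> m; exact: (measurableT_comp m (pair1_measurable x)). Qed.

Let sec2 (F : V -> R -> R) s : measurable_fun setT (fun p : V * measurableTypeR R => F p.1 p.2) ->
  measurable_fun setT (F^~ s).
Proof. by move=> m; exact: (measurableT_comp m (pair2_measurable s)). Qed.

(* After s = r |x| the order of integration is exchanged, x is rescaled to y = r x, and
   the remaining integral of r^(-n-1) over r >= |y| is |y|^(-n) / n. *)
Lemma ge0_polar f : measurable_fun setT f -> (forall x, 0 <= f x) -> f 0 = 0 ->
  (\int[mu]_x (f x)%:E = n%:R%:E * \int[mu]_x \int[leb]_s (pol f x s)%:E)%E.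
Proof.
move=> mf f0 f00.
(* For n = 0 the only vector is 0, where f vanishes, and the right side carries the factor 0. *)
have [n0|n0] := posnP n.
  have -> : n%:R = 0 :> R by rewrite n0.
  rewrite mul0e; apply: integral0_eq => x _.
  by rewrite (_ : x = 0) ?f00//; apply/rowP => -[j jn]; have := jn; rewrite [in X in X -> _]n0.
have p2_ge0 x r : 0 <= pol2 f x r.
  by rewrite /pol2 !mulr_ge0 ?exprn_ge0 ?enorm_ge0 ?ppow_ge0.
have p_ge0 x r : 0 <= pol f x r.
  by rewrite /pol !mulr_ge0 ?ppow_ge0.
have p3_ge0 x r : 0 <= pol3 f x r.
  by rewrite /pol3 !mulr_ge0 ?exprn_ge0 ?enorm_ge0 ?ppow_ge0.
have E1 x : (\int[leb]_s (pol f x s)%:E = \int[leb]_r (pol2 f x r)%:E)%E.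
  have [->|x0] := eqVneq x 0.
    by apply: eq_integral => s _; rewrite /pol /pol2 /normal !scaler0 f00 !mulr0.
  have e0 : 0 < enorm x by rewrite enorm_gt0.
  have e1 : enorm x != 0 by rewrite gt_eqF.
  have m1 : measurable_fun setT (EFin \o pol f x).
    by apply/measurable_EFinP; apply: sec1; exact: measurable_pol.
  have := ge0_integral_affine1 0 e1 m1 (fun s => p_ge0 x s).
  rewrite gtr0_norm// => h.
  transitivity ((enorm x)%:E * \int[leb]_r (pol f x (enorm x * r + 0))%:E)%E.
    by rewrite [X in (_ * X)%E]h muleA -EFinM divff// mul1e.
  rewrite -ge0_integralZl//; last 3 first.
  - apply/measurable_EFinP; apply: (measurableT_comp (sec1 x (measurable_pol mf))).
    by apply: measurable_funD => //; exact: measurable_funM.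
  - by move=> r _; rewrite lee_fin.
  - by rewrite lee_fin ltW.
  apply: eq_integral => r _; rewrite -EFinM; congr EFin.
  rewrite /pol /pol2 /normal addr0 ppowM// scalerA [_ * r * _]mulrAC divff// mul1r.
  rewrite (_ : enorm x ^+ n = enorm x * enorm x `^ (n%:R - 1)); first by ring.
  rewrite -{2}[enorm x]powRr1 ?enorm_ge0// -powRD; last by rewrite e1 implybT.
  by rewrite addrC subrK powR_mulrn// enorm_ge0.
rewrite (eq_integral _ _ (fun x _ => E1 x)).
have m2 : measurable_fun setT (EFin \o (fun p : V * measurableTypeR R => pol2 f p.1 p.2)).
  by apply/measurable_EFinP; exact: measurable_pol2.
have F2 : (\int[mu]_x \int[leb]_r (pol2 f x r)%:E = \int[leb]_r \int[mu]_x (pol2 f x r)%:E)%E.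
  by apply: (fubini_tonelli (m1 := mu) (m2 := leb) _ m2) => p; rewrite lee_fin.
have E2 r : (\int[mu]_x (pol2 f x r)%:E = \int[mu]_y (pol3 f y r)%:E)%E.
  have [r0|r0] := leP r 0.
    by apply: eq_integral => x _; rewrite /pol2 /pol3 !ppow_le0E// !mul0r mulr0.
  have r1 : r != 0 by rewrite gt_eqF.
  have m3 : measurable_fun setT (EFin \o (fun y => pol3 f y r)).
    by apply/measurable_EFinP; apply: sec2; exact: measurable_pol3.
  have h := ge0_integral_affine 0 r1 m3 (fun y => p3_ge0 y r).
  rewrite gtr0_norm// in h.
  have rn : r ^+ n != 0 by rewrite expf_neq0.
  transitivity ((r ^+ n)%:E * \int[mu]_x (pol3 f (r *: x + 0) r)%:E)%E; last first.
    by rewrite [X in (_ * X)%E]h muleA -EFinM divff// mul1e.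
  rewrite -ge0_integralZl//; last 3 first.
  - apply/measurable_EFinP; apply: (measurableT_comp (sec2 r (measurable_pol3 mf))).
    exact: measurable_affine.
  - by move=> x _; rewrite lee_fin.
  - by rewrite lee_fin exprn_ge0// ltW.
  apply: eq_integral => x _; rewrite -EFinM; congr EFin.
  rewrite /pol2 /pol3 /uball addr0 enormZ gtr0_norm// pmulr_rgt0// ger_pMr// exprMn !ppow_gt0E//.
  have -> : r `^ (n%:R - 1) = r ^+ n * r `^ (- n%:R - 1) * r ^+ n; last by ring.
  rewrite -!powR_mulrn ?(ltW r0)// -!powRD ?r1 ?implybT//; congr (_ `^ _); ring.
have m3 : measurable_fun setT (EFin \o (fun p : V * measurableTypeR R => pol3 f p.1 p.2)).
  by apply/measurable_EFinP; exact: measurable_pol3.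
have F3 : (\int[mu]_x \int[leb]_r (pol3 f x r)%:E = \int[leb]_r \int[mu]_x (pol3 f x r)%:E)%E.
  by apply: (fubini_tonelli (m1 := mu) (m2 := leb) _ m3) => p; rewrite lee_fin.
have F23 : (\int[leb]_r \int[mu]_x (pol2 f x r)%:E = \int[leb]_r \int[mu]_x (pol3 f x r)%:E)%E.
  by apply: eq_integral => r _; exact: E2.
rewrite F2 F23 -F3.
have E3 (y : V) : (\int[leb]_r (pol3 f y r)%:E = (n%:R^-1)%:E * (f y)%:E)%E.
  have [->|y0] := eqVneq y 0.
    rewrite f00 mule0; apply: integral0_eq => s _; by rewrite /pol3 f00 !mulr0.
  have e0 : 0 < enorm y by rewrite enorm_gt0.
  have n1 : (- n%:R - 1 : R) < -1 by rewrite ltrBlDr addrC subrr oppr_lt0 ltr0n.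
  have h := integral_powR_far n1 e0.
  have mD : measurable (`[enorm y, +oo[%classic : set (measurableTypeR R)) by exact: measurable_itv.
  transitivity ((enorm y ^+ n * f y)%:E * \int[leb]_(s in `[enorm y, +oo[) (s `^ (- n%:R - 1))%:E)%E.
    rewrite -ge0_integralZl//; last 3 first.
    - by apply/measurable_EFinP; apply: measurable_funTS; exact: measurable_powR.
    - by move=> x _; rewrite lee_fin powR_ge0.
    - by rewrite lee_fin mulr_ge0// exprn_ge0// enorm_ge0.
    rewrite [RHS]integral_mkcond; apply: eq_integral => s _.
    rewrite /patch mem_setE in_itv/= andbT /pol3 e0 andTb; case: ifPn => ys.
      by rewrite ppow_gt0E ?(lt_le_trans e0)// mul1r -EFinM mulrC.
    by rewrite mul0r mulr0.
  rewrite h -!EFinM; congr EFin.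
  rewrite subrK.
  rewrite invrN opprK powRN powR_mulrn ?enorm_ge0//; field.
  have q1 : (n%:R : R) != 0 by rewrite pnatr_eq0 -lt0n.
  by have q2 : enorm y ^+ n != 0 by [rewrite expf_neq0// gt_eqF]; rewrite ?q1 ?q2.
rewrite (eq_integral _ _ (fun x _ => E3 x)) ge0_integralZl//.
- by rewrite muleA -EFinM divff ?mul1e// pnatr_eq0 -lt0n.
- exact/measurable_EFinP.
- by move=> x _; rewrite lee_fin.
Qed.

Section signed.
Variables (f : V -> R) (a : V -> R) (b : R -> R).
Hypotheses (i : mu.-integrable setT (EFin \o f)) (f00 : f 0 = 0).
Hypotheses (ia : mu.-integrable setT (EFin \o a)) (ib : leb.-integrable setT (EFin \o b)).
Hypothesis (hab : forall x s, `|pol f x s| <= a x * b s).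

Let ge0_polarR (g : V -> R) : measurable_fun setT g -> (forall x, 0 <= g x) -> g 0 = 0 ->
  (forall x, g x <= `|f x|) ->
  \int[mu]_x g x = n%:R * \int[mu]_x \int[leb]_s pol g x s.
Proof.
move=> mg g0 g00 gf.
have hab' x s : `|pol g x s| <= a x * b s.
  apply: le_trans (hab x s); rewrite /pol !normrM !ler_wpM2l//.
  by rewrite ger0_norm.
rewrite /Rintegral ge0_polar// fineM//.
  congr (_ * fine _); apply: eq_integral => x _; rewrite fineK//.
  apply: (@integrable_fin_num _ _ _ leb) => //.
  exact: (integrable_section1 (m2 := leb) (measurable_pol mg) ib hab' x).
have j := integrable_Rintegral1 (measurable_pol mg) ia ib hab'.
have := integrable_fin_num measurableT j; rewrite (_ : (\int[mu]_x _)%E = (\int[mu]_x \int[leb]_s (pol g x s)%:E)%E)//.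
apply: eq_integral => x _; rewrite /= /Rintegral fineK//.
apply: (@integrable_fin_num _ _ _ leb) => //.
  exact: (integrable_section1 (m2 := leb) (measurable_pol mg) ib hab' x).
Qed.

(** The nonnegative case is applied to the positive and negative parts of f; both inherit the
    majorant a(x) b(s), so every integral involved is finite and can be subtracted. *)
Lemma polar : \int[mu]_x f x = n%:R * \int[mu]_x \int[leb]_s pol f x s.
Proof.
have mf : measurable_fun setT f := (measurable_EFinP _ _).1 (measurable_int _ i).
pose g1 x := Num.max (f x) 0; pose g2 x := Num.max (- f x) 0.
have fE x : f x = g1 x - g2 x.
  rewrite /g1 /g2 !maxEle oppr_le0.
  by case: (lerP (f x) 0) => h; case: (lerP 0 (f x)) => h'; lra.
have m1 : measurable_fun setT g1 by apply: measurable_maxr.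
have m2 : measurable_fun setT g2 by apply: measurable_maxr => //; exact: (measurableT_comp (@oppr_measurable R setT)).
have b1 x : 0 <= g1 x <= `|f x| by rewrite /g1 le_max lexx orbT ge_max normr_ge0 ler_norm.
have b2 x : 0 <= g2 x <= `|f x|.
  by rewrite /g2 le_max lexx orbT ge_max normr_ge0 -normrN ler_norm.
have i1 : mu.-integrable setT (EFin \o g1).
  apply: (le_integrable measurableT _ _ i); first exact/measurable_EFinP.
  by move=> x _; rewrite lee_fin/=; have /andP[p1 p2] := b1 x; rewrite ger0_norm.
have i2 : mu.-integrable setT (EFin \o g2).
  apply: (le_integrable measurableT _ _ i); first exact/measurable_EFinP.
  by move=> x _; rewrite lee_fin/=; have /andP[p1 p2] := b2 x; rewrite ger0_norm.
have hab1 x s : `|pol g1 x s| <= a x * b s.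
  apply: le_trans (hab x s); rewrite /pol !normrM !ler_wpM2l//.
  by have /andP[p1 p2] := b1 (s *: normal x); rewrite ger0_norm.
have hab2 x s : `|pol g2 x s| <= a x * b s.
  apply: le_trans (hab x s); rewrite /pol !normrM !ler_wpM2l//.
  by have /andP[p1 p2] := b2 (s *: normal x); rewrite ger0_norm.
transitivity (\int[mu]_x (g1 x - g2 x)); first by apply: eq_Rintegral => x _.
rewrite (RintegralB measurableT i1 i2).
have g10 : g1 0 = 0 by rewrite /g1 f00 maxxx.
have g20 : g2 0 = 0 by rewrite /g2 f00 oppr0 maxxx.
have b1l x : 0 <= g1 x by case/andP: (b1 x).
have b1r x : g1 x <= `|f x| by case/andP: (b1 x).
have b2l x : 0 <= g2 x by case/andP: (b2 x).
have b2r x : g2 x <= `|f x| by case/andP: (b2 x).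
rewrite (ge0_polarR m1 b1l g10 b1r) (ge0_polarR m2 b2l g20 b2r).
rewrite -mulrBr; congr (_ * _).
rewrite -(RintegralB measurableT); last 2 first.
- exact: (integrable_Rintegral1 (measurable_pol m1) ia ib hab1).
- exact: (integrable_Rintegral1 (measurable_pol m2) ia ib hab2).
apply: eq_Rintegral => x _; rewrite -(RintegralB measurableT).
- by apply: eq_Rintegral => s _; rewrite /pol fE; ring.
- exact: (integrable_section1 (measurable_pol m1) ib hab1).
- exact: (integrable_section1 (measurable_pol m2) ib hab2).
Qed.
End signed.
End polar.

(** * Integration over the sphere and pairing with homogeneous functions *)

Section sphere.
Variables (R : realType) (n : nat).
Notation V := 'rV[R]_n.
Notation leb := (@lebesgue_measure R).
Implicit Types (f g h : V -> R).

Lemma normal0 : normal (0 : V) = 0. Proof. exact: scaler0. Qed.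

Lemma enorm_normal (x : V) : x != 0 -> enorm (normal x) = 1.
Proof. exact: enorm_normalize. Qed.

Lemma normal_id (x : V) : enorm x = 1 -> normal x = x.
Proof. by move=> x1; rewrite /normal x1 invr1 scale1r. Qed.

Lemma normalZ (s : R) (x : V) : 0 < s -> normal (s *: x) = normal x.
Proof.
move=> s0; rewrite /normal enormZ gtr0_norm// scalerA invfM.
by rewrite mulrAC mulVf ?gt_eqF// mul1r.
Qed.

Lemma normalN (x : V) : normal (- x) = - normal x.
Proof. by rewrite /normal enormN scalerN. Qed.

Lemma uball_ge0 (x : V) : 0 <= uball x. Proof. exact: ler0n. Qed.

Lemma uball_neq0 (x : V) : uball x != 0 -> x != 0.
Proof. by apply: contra => /eqP->; rewrite /uball enorm0 ltxx. Qed.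

Lemma uball_le1 (x : V) : uball x <= 1.
Proof. by rewrite /uball -(mulr1n 1) ler_nat; case: (_ <= _)%R; rewrite ?andbF//; case: (_ < _)%R. Qed.

Lemma uball_ball (x : V) : 1 < enorm x -> uball x = 0.
Proof. by rewrite ltNge /uball => /negbTE ->; rewrite andbF. Qed.

(** Broad enough to contain |(x, xi)|^q, which need not be smooth on the sphere, along with the
    elements of [Ce_inf]. *)
Definition sphere_bounded f :=
  measurable_fun setT (f \o @normal R n) /\ exists C, forall x, `|f (normal x)| <= C.

(** The spherical integral written against [mu] with the origin excluded, so that only the values of
    f on the sphere enter. *)
Definition sp f := n%:R * \int[mu]_x (uball x * f (normal x)).

Lemma eq_sp f g : (forall x, enorm x = 1 -> f x = g x) -> sp f = sp g.
Proof.
move=> fg; congr (_ * _); apply: eq_Rintegral => x _.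
have [->|/uball_neq0 x0] := eqVneq (uball x) 0; first by rewrite !mul0r.
by rewrite fg// enorm_normal.
Qed.

Lemma sphere_boundedM f g : sphere_bounded f -> sphere_bounded g ->
  sphere_bounded (fun x => f x * g x).
Proof.
move=> [mf [C fC]] [mg [D gD]]; split; first exact: measurable_funM.
by exists (C * D) => x; rewrite normrM ler_pM.
Qed.

Lemma sphere_bounded_dominated f : sphere_bounded f -> dominated (fun x => uball x * f (normal x)).
Proof.
move=> [mf [C fC]]; apply: (@dominated_bounded R n _ 1 C).
- by apply: measurable_funM => //; exact: measurable_uball.
- move=> x; rewrite normrM -[C]mul1r ler_pM// ger0_norm ?uball_ge0//; exact: uball_le1.
- by move=> x x1; rewrite uball_ball// mul0r.
Qed.

Lemma dominated_uball : dominated (@uball R n).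
Proof.
apply: (@dominated_bounded R n _ 1 1); first exact: measurable_uball.
  by move=> x; rewrite ger0_norm ?uball_ge0// uball_le1.
exact: uball_ball.
Qed.

(* A point is null because it is invariant under the scaling by 2, which multiplies [mu] by 2^n. *)
Lemma Rintegral_at0 (c : R) : (0 < n)%N ->
  let u := fun x : V => (enorm x <= 0)%R%:R * c in dominated u /\ \int[mu]_x u x = 0.
Proof.
move=> n0 u.
have du : dominated u.
  apply: (@dominated_bounded R n _ 0 `|c|).
  - apply: measurable_funM; last exact: measurable_cst.
    apply: measurable_bool_natr; apply: measurable_fun_ler; last exact: measurable_cst.
    exact: measurable_enorm.
  - by move=> x; rewrite /u; case: (enorm x <= 0)%R; rewrite ?mul1r ?mul0r ?normr0.
  - by move=> x x0; rewrite /u leNgt x0 mul0r.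
split => //.
have t0 : (2 : R) != 0 by [].
have := Rintegral_affine 0 t0 (dominated_integrable du).
have -> : \int[mu]_x u (2 *: x + 0) = \int[mu]_x u x.
  by apply: eq_Rintegral => x _; rewrite /u addr0 enormZ ger0_norm// pmulr_rle0.
rewrite ger0_norm//; move: (\int[mu]_x u x) => J /eqP.
rewrite -subr_eq0 -{1}[J]mul1r -mulrBl mulf_eq0 => /orP[|/eqP//].
rewrite subr_eq0 => /eqP h; have : (2 : R) ^+ n = 1 by rewrite -[LHS]invrK -h invr1.
by move/eqP; rewrite gt_eqF// exprn_egt1// ?ltr1n// -lt0n.
Qed.

Lemma sphere_intE f : sphere_bounded f -> sphere_int f = sp f.
Proof.
move=> bf; rewrite /sphere_int /sp.
have [n0|n0] := posnP n; first by rewrite (_ : n%:R = 0 :> R) ?mul0r// n0.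
congr (_ * _).
have [mf [C fC]] := bf.
rewrite intRn_Rintegral; last first.
  apply: (@dominated_bounded R n _ 1 C).
  - apply: measurable_fun_ifT => //.
      by apply: measurable_fun_ler; [exact: measurable_enorm|exact: measurable_cst].
  - by move=> x; case: ifP => // _; rewrite ?fC// normr0 (le_trans _ (fC 0)).
  - by move=> x; rewrite ltNge => /negbTE ->.
have [d0 i0] := Rintegral_at0 (f 0) n0.
transitivity (\int[mu]_x (uball x * f (normal x) + (enorm x <= 0)%R%:R * f 0)).
  apply: eq_Rintegral => x _; have [->|x0] := eqVneq x 0.
    by rewrite /uball enorm0 ltxx ler01 lexx mul0r mul1r add0r /radial scaler0.
  have e0 : 0 < enorm x by rewrite enorm_gt0.
  rewrite /uball e0 [enorm x <= 0]leNgt e0 /= mul0r addr0.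
  by case: ifP; rewrite ?mul1r ?mul0r.
rewrite (RintegralD measurableT (dominated_integrable (sphere_bounded_dominated bf)) (dominated_integrable d0)).
by rewrite i0 addr0.
Qed.

Lemma Ce_inf_sphere_bounded f : Ce_inf f -> sphere_bounded f.
Proof.
move=> [_ sf].
have cf (x : V) : x != 0 -> {for x, continuous (radial f)} by move=> x0; exact: (sf [::] x x0).1.
split; first exact: (continuous_neq0_measurable cf).
have cS : compact ([set x : V | enorm x <= 1] `&` [set x : V | 1 <= enorm x]).
  apply: compact_closedI; first exact: compact_ball.
  apply: (@preimage_closed _ _ (@enorm R n) [set r | 1 <= r]); last exact: closed_ge.
  by move=> x _; exact: continuous_enorm.
have [C [C0 hC]] : exists C, 0 <= C /\ forall x,
    ([set x : V | enorm x <= 1] `&` [set x : V | 1 <= enorm x]) x -> `|radial f x| <= C.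
  apply: continuous_bounded_ball => // x [/= _ x1]; apply: cf.
  by rewrite -enorm_gt0 (lt_le_trans ltr01).
(* The summand |f 0| covers the default value [normal 0 = 0]; the compactness bound C concerns the
   sphere only. *)
exists (C + `|f 0|) => x; have [->|x0] := eqVneq x 0.
  by rewrite normal0 lerDr.
have e1 := enorm_normal x0.
have := hC (normal x); rewrite /= e1 lexx => /(_ (conj erefl erefl)).
rewrite /radial -/(normal (normal x)) (normal_id e1) => h.
by rewrite (le_trans h)// lerDl.
Qed.

Lemma sphere_bounded_dotp (q : R) (xi : V) : 0 < q ->
  sphere_bounded (fun x => `|dotp x xi| `^ q).
Proof.
move=> q0; split.
  apply: (measurableT_comp (@measurable_powR R q)); apply: (measurableT_comp (@normr_measurable R setT)).
  by apply: measurable_dotp; [exact: measurable_normal|exact: measurable_cst].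
exists (((1 + dotp xi xi) / 2) `^ q) => x; rewrite ger0_norm ?powR_ge0//.
have xi0 := dotp_ge0 xi.
apply: ge0_ler_powR; rewrite ?nnegrE ?(ltW q0)//; first by rewrite divr_ge0// addr_ge0.
rewrite (le_trans (dotp_le _ _))// ler_wpM2r// lerD2r -sqr_enorm.
have [->|x0] := eqVneq x 0; first by rewrite normal0 enorm0 expr0n.
by rewrite enorm_normal// expr1n.
Qed.

Section hrs.
Variables (q : R) (h : V -> R).
Hypotheses (q0 : 0 < q) (bh : sphere_bounded h).

Lemma measurable_hrs : measurable_fun setT (hrs h q).
Proof.
apply: measurable_funM; last exact: bh.1.
exact: (measurableT_comp (@measurable_powR R q) (@measurable_enorm R n)).
Qed.

Lemma hrs_K_dominated (c k : R) f : tc f -> dominated (fun x => k * hrs h q x * K c f x).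
Proof.
move=> tf; split.
  apply: measurable_funM; last exact: measurable_K.
  by apply: measurable_funM; [exact: measurable_cst|exact: measurable_hrs].
have [mh [C hC]] := bh.
pose N := (Num.truncn q).+1.
(* N powers of 1 + |x|^2 compensate the growth |x|^q; the other n give domination by the product
   weight. *)
have [M M0 hM] := K_decay (N + n) tf.
exists (`|k| * C * M) => x.
have C0 : 0 <= C by apply: le_trans (hC 0).
set d := 1 + dotp x x.
have d1 : 1 <= d by rewrite lerDl dotp_ge0.
have d0 : 0 < d by apply: lt_le_trans d1.
have ed : enorm x `^ q <= d ^+ N.
  apply: (@le_trans _ _ (d `^ q)).
    apply: ge0_ler_powR; rewrite ?nnegrE ?enorm_ge0 ?(ltW q0) ?(ltW d0)//.
    rewrite /d -sqr_enorm; have := sqr_ge0 (enorm x - 1); rewrite sqrrB mulr1 expr1n.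
    by move: (enorm_ge0 x) (enorm x ^+ 2) => e0 e2; lra.
  rewrite -powR_mulrn ?(ltW d0)//; apply: ler_powR => //.
  by rewrite ltW//; exact: truncnS_gt.
rewrite /hrs !normrM [`|_ `^ _|]ger0_norm ?powR_ge0//.
have hx : `|radial h x| <= C := hC x.
rewrite (@le_trans _ _ (`|k| * (d ^+ N * C) * (M / d ^+ (N + n))))//.
  apply: ler_pM => //; first by rewrite mulr_ge0// mulr_ge0// powR_ge0.
  rewrite ler_wpM2l//; apply: ler_pM => //; exact: powR_ge0.
rewrite exprD invfM.
rewrite (_ : _ * _ = `|k| * C * M * d ^- n * (d ^+ N / d ^+ N)); last by ring.
rewrite divff ?gt_eqF ?exprn_gt0// mulr1 ler_wpM2l ?mulr_ge0//.
exact: weight_ge.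
Qed.

(** In polar coordinates |x|^q contributes s^q and the Jacobian s^(n-1), whence the exponent q + n -
    1; the angular factor h leaves the integral over s. *)
Lemma polar_hrs f : tc f ->
  \int[mu]_x (hrs h q x * K 0 f x) = sp (fun x => h x * radint 0 (q + n%:R - 1) f x).
Proof.
move=> tf; pose a := q + n%:R - 1.
have a1 : -1 < a by rewrite /a; have := ler0n R n; move: q0; move: (n%:R : R) => r; lra.
pose F x := hrs h q x * K 0 f x.
have iF : mu.-integrable setT (EFin \o F).
  have := dominated_integrable (hrs_K_dominated 0 1 tf).
  by apply: eq_integrable => // x _; rewrite /F /= mul1r.
have F0 : F 0 = 0 by rewrite /F /hrs enorm0 powR0 ?gt_eqF// !mul0r.
have [mh [C hC]] := bh.
have C0 : 0 <= C by apply: le_trans (hC 0).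
have polE x s : pol F x s = uball x * (h (normal x) * (ppow a s * K 0 f (s *: normal x))).
  rewrite /pol; have [->|/uball_neq0 x0] := eqVneq (uball x) 0; first by rewrite !mul0r.
  congr (_ * _); have [s0|s0] := leP s 0; first by rewrite !ppow_le0E// !mul0r mulr0.
  rewrite /F /hrs enormZ enorm_normal// mulr1 gtr0_norm// /radial -/(normal _) normalZ//.
  rewrite normal_id ?enorm_normal// !ppow_gt0E//.
  have -> : s `^ a = s `^ q * s `^ (n%:R - 1); last by ring.
  by rewrite -powRD ?addrA//; apply/implyP => _; rewrite gt_eqF.
have [G iG hG] := K_ray_dominated a1 ltr01 tf.
have ia : mu.-integrable setT (EFin \o (fun x : V => C * uball x)).
  exact: (integrableZl measurableT C (dominated_integrable dominated_uball)).
rewrite -[LHS]/(\int[mu]_x F x) (polar iF F0 ia (integrable_norm iG)); last first.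
  move=> x s; rewrite polE !normrM (ger0_norm (uball_ge0 x)).
  have [->|/uball_neq0 x0] := eqVneq (uball x) 0; first by rewrite mulr0 !mul0r.
  rewrite mulrA [uball x * _]mulrC ler_pM ?mulr_ge0 ?uball_ge0//.
    by rewrite ler_wpM2r ?uball_ge0.
  rewrite -normrM (le_trans (hG _ _ _ _)) ?ler_norm//.
  by rewrite -sqr_enorm enorm_normal// expr1n.
congr (_ * _); apply: eq_Rintegral => x _.
have [x0|/uball_neq0 x0] := eqVneq (uball x) 0.
  by rewrite x0 mul0r /Rintegral integral0_eq// => s _; rewrite polE x0 mul0r.
have nx : normal x != 0 by rewrite -enorm_gt0 enorm_normal.
have iK := radint_integrable 0 a1 tf nx.
rewrite /radint -/a mulrA -(RintegralZl _ measurableT iK).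
by apply: eq_Rintegral => s _; rewrite polE mulrA.
Qed.
End hrs.
End sphere.

(** A nonpositive u with nonnegative integral vanishes almost everywhere, so v is negative only on a
    null set and may be replaced by its positive part. This is the measure-theoretic core of the
    converse. *)
Lemma Rintegral_ge0_sign d (T : measurableType d) (R : realType) (m : {measure set T -> \bar R})
    (u v : T -> R) : m.-integrable setT (EFin \o u) -> measurable_fun setT v ->
  (forall x, u x <= 0) -> 0 <= \int[m]_x u x -> (forall x, v x < 0 -> u x < 0) ->
  0 <= \int[m]_x v x.
Proof.
move=> iu mv u0 Iu vu.
have mu : measurable_fun setT (EFin \o u) := measurable_int _ iu.
have iw := integrableZl measurableT (-1) iu.
have ae : ae_eq m setT (EFin \o u) (cst 0%E).
  apply/(ae_eq_integral_abs m measurableT mu).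
  transitivity (\int[m]_x (-1 * u x)%:E)%E.
    by apply: eq_integral => x _ /=; rewrite mulN1r ler0_norm.
  rewrite -(fineK (integrable_fin_num measurableT iw)); congr EFin.
  rewrite -[LHS]/(\int[m]_x (-1 * u x)); apply/eqP; rewrite eq_le; apply/andP; split.
    by rewrite (RintegralZl _ measurableT iu) mulN1r oppr_le0.
  by apply: Rintegral_ge0 => x _; rewrite mulN1r oppr_ge0.
rewrite (_ : \int[m]_x v x = \int[m]_x Num.max (v x) 0); last first.
  congr fine; apply: ae_eq_integral => //.
  - exact/measurable_EFinP.
  - by apply/measurable_EFinP; apply: measurable_maxr.
  apply: filterS ae => x /= ux _; have := ux I => -[ux0].
  by rewrite max_l// leNgt; apply/negP => /vu; rewrite ux0 ltxx.
by apply: Rintegral_ge0 => x _; rewrite le_max lexx orbT.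
Qed.

(** * Symmetry of the cosine transform on the sphere *)

Section cosine.
Variables (R : realType) (n : nat) (q : R).
Notation V := 'rV[R]_n.
Notation leb := (@lebesgue_measure R).
Hypothesis q0 : 0 < q.
Implicit Types (f g h : V -> R).

Lemma spZ k f : sphere_bounded f -> sp (fun x => k * f x) = k * sp f.
Proof.
move=> bf; rewrite /sp mulrCA; congr (_ * _).
rewrite -(RintegralZl _ measurableT (dominated_integrable (sphere_bounded_dominated bf))).
by apply: eq_Rintegral => x _; rewrite mulrCA.
Qed.

Lemma normr_dotp_normal (x y : V) : `|dotp (normal x) (normal y)| <= 1.
Proof.
have h (z : V) : dotp (normal z) (normal z) <= 1.
  have [->|z0] := eqVneq z 0; first by rewrite normal0 dotp0l.
  by rewrite -sqr_enorm enorm_normal// expr1n.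
have := dotp_le (normal x) (normal y); have := h x; have := h y.
by set a := dotp _ _; set b := dotp _ _; set c := `|_| => *; lra.
Qed.

Let F f g x y := uball x * f (normal x) * (uball y * g (normal y)) *
  `|dotp (normal y) (normal x)| `^ q.

Let measurable_F f g : sphere_bounded f -> sphere_bounded g ->
  measurable_fun setT (fun p : V * V => F f g p.1 p.2).
Proof.
move=> bf bg; apply: measurable_funM.
  apply: measurable_funM.
    by apply: measurable_funM; [exact: (measurableT_comp (@measurable_uball R n) measurable_fst)
      |exact: (measurableT_comp bf.1 measurable_fst)].
  by apply: measurable_funM; [exact: (measurableT_comp (@measurable_uball R n) measurable_snd)
      |exact: (measurableT_comp bg.1 measurable_snd)].
apply: (measurableT_comp (@measurable_powR R q)); apply: (measurableT_comp (@normr_measurable R setT)).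
apply: measurable_dotp; first exact: (measurableT_comp (@measurable_normal R n) measurable_snd).
exact: (measurableT_comp (@measurable_normal R n) measurable_fst).
Qed.

Let F_le f g (C D : R) x y : (forall x, `|f (normal x)| <= C) -> (forall x, `|g (normal x)| <= D) ->
  `|F f g x y| <= C * uball x * (D * uball y).
Proof.
move=> fC gD; rewrite /F !normrM !(ger0_norm (uball_ge0 _)).
rewrite -[leRHS]mulr1; apply: ler_pM => //.
- by rewrite !mulr_ge0// uball_ge0.
- apply: ler_pM; rewrite ?mulr_ge0 ?uball_ge0//.
    by rewrite mulrC ler_wpM2r ?uball_ge0.
  by rewrite mulrC ler_wpM2r ?uball_ge0.
have p1 : (1 : R) `^ q = 1 by rewrite powR1.
rewrite ger0_norm ?powR_ge0// -[leRHS]p1.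
by apply: ge0_ler_powR; rewrite ?nnegrE ?(ltW q0)// normr_dotp_normal.
Qed.

Let iU (C : R) : mu.-integrable setT (EFin \o (fun x : V => C * uball x)).
Proof. exact: (integrableZl measurableT C (dominated_integrable (@dominated_uball R n))). Qed.

Lemma cosine_transformE f xi : sphere_bounded f ->
  cosine_transform q f xi = sp (fun x => `|dotp x xi| `^ q * f x).
Proof. by move=> bf; apply/sphere_intE/sphere_boundedM => //; exact: sphere_bounded_dotp. Qed.

Let cosine_F f g x : sphere_bounded f -> sphere_bounded g ->
  uball x * (f (normal x) * cosine_transform q g (normal x)) = n%:R * \int[mu]_y F f g x y.
Proof.
move=> bf bg; rewrite cosine_transformE// /sp mulrCA [_ * (n%:R * _)]mulrCA mulrCA; congr (_ * _).
have d := sphere_bounded_dominated (sphere_boundedM (sphere_bounded_dotp (normal x) q0) bg).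
rewrite mulrCA mulrA -(RintegralZl _ measurableT (dominated_integrable d)).
by apply: eq_Rintegral => y _; rewrite /F; ring.
Qed.

Lemma cosine_integrable f g : sphere_bounded f -> sphere_bounded g ->
  mu.-integrable setT (EFin \o (fun x => uball x * (f (normal x) * cosine_transform q g (normal x)))).
Proof.
move=> bf bg; have [_ [C fC]] := bf; have [_ [D gD]] := bg.
have i := integrable_Rintegral1 (measurable_F bf bg) (iU C) (iU D) (fun x y => F_le x y fC gD).
have := integrableZl measurableT n%:R i; apply: eq_integrable => // x _.
by rewrite /= cosine_F.
Qed.

(** Fubini for the symmetric kernel |(x, y)|^q, which is at most 1 on pairs of unit vectors. *)
Lemma sp_cosine f g : sphere_bounded f -> sphere_bounded g ->
  sp (fun x => f x * cosine_transform q g x) = sp (fun x => g x * cosine_transform q f x).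
Proof.
move=> bf bg; have [_ [C fC]] := bf; have [_ [D gD]] := bg.
rewrite /sp; congr (_ * _).
have mF := measurable_F bf bg; have hF x y := F_le x y fC gD.
have i1 := integrable_Rintegral1 mF (iU C) (iU D) hF.
have mF' := measurable_F bg bf; have hF' x y := F_le x y gD fC.
have i2 := integrable_Rintegral1 mF' (iU D) (iU C) hF'.
transitivity (n%:R * \int[mu]_x \int[mu]_y F f g x y).
  rewrite -(RintegralZl _ measurableT i1); by apply: eq_Rintegral => x _; rewrite [LHS](cosine_F x bf bg).
have E2 : \int[mu]_x \int[mu]_y F f g x y = \int[mu]_x \int[mu]_y F g f x y.
  apply: (etrans (Rintegral_fubini mF (iU C) (iU D) hF)).
  apply: eq_Rintegral => y _; apply: eq_Rintegral => x _.
  by rewrite /F dotpC; ring.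
rewrite E2 -(RintegralZl _ measurableT i2).
by apply: eq_Rintegral => x _; rewrite (cosine_F x bg bf).
Qed.
End cosine.

(** * Radial extensions cut off to an annulus *)

Section annular.
Variables (R : realType) (n : nat) (q : R).
Notation V := 'rV[R]_n.
Notation leb := (@lebesgue_measure R).
Implicit Types (f g h : V -> R).

(** Evaluated at |y|^2, this is positive exactly for 1 < |y| < 2; the square avoids differentiating
    the norm. *)
Definition annulus (t : R) : R := bump ((t - 1) * (4 - t)).

Definition annular g (y : V) : R := annulus (dotp y y) * radial g y.

Definition annular_cst : R := \int[leb]_s (ppow (-1 - q) s * annulus (s ^+ 2)).

Let annulus_out t : t <= 1 \/ 4 <= t -> annulus t = 0.
Proof. by move=> h; apply: bump_le0; case: h => h; [rewrite mulr_le0_ge0|rewrite mulr_ge0_le0]; lra. Qed.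

Lemma annular_ge0 g y : (forall x, 0 <= g x) -> 0 <= annular g y.
Proof. by move=> g0; rewrite mulr_ge0 ?bump_ge0 ?g0. Qed.

Lemma tc_annular g : smooth_on [set x : V | x != 0] (radial g) -> tc (annular g).
Proof.
move=> sg.
have z (x : V) : enorm x < 1 -> annular g x = 0.
  move=> x1; rewrite /annular annulus_out ?mul0r//; left.
  by rewrite -sqr_enorm expr_le1 ?enorm_ge0// ltW.
split.
- apply: (smooth_extend0 ltr01) z.
  have o := @open_neq0 R n.
  have s1 := smooth_sqrnorm o.
  have s4 := smoothD o (smooth_cst 4 o) (smoothM o (smooth_cst (-1) o) s1).
  have s5 := smoothM o (smoothD o s1 (smooth_cst (-1) o)) s4.
  apply: (smooth_on_eq o _ (smoothM o (smooth_bump o s5) sg)) => x _.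
  by rewrite /annular /annulus /= mulN1r.
- exists 2 => x x2; rewrite /annular annulus_out ?mul0r//; right.
  rewrite -sqr_enorm (_ : 4 = 2 ^+ 2); last by rewrite -natrX.
  by rewrite ler_pXn2r ?nnegrE ?enorm_ge0// ltW.
- by exists 1.
Qed.

Let continuous_annulus_sqr (s : R) : {for s, continuous (fun s : R => annulus (s ^+ 2))}.
Proof.
have cb (t : R) : {for t, continuous (@bump R)}.
  apply: differentiable_continuous; apply/derivable1_diffP.
  exact: (@ex_derive _ _ _ _ _ _ _ (is_derive_poly_bump 1 t)).
apply: (@continuous_comp _ _ _ (fun s : R => (s ^+ 2 - 1) * (4 - s ^+ 2)) (@bump R)); last exact: cb.
have c2 : {for s, continuous (fun s : R => s ^+ 2)} by exact: exprn_continuous.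
by apply: continuousM; apply: continuousB => //; exact: cst_continuous.
Qed.

Lemma integrable_annulus :
  leb.-integrable setT (EFin \o (fun s => ppow (-1 - q) s * annulus (s ^+ 2))).
Proof.
have lt12 : (1 : R) < 2 by rewrite ltr1n.
have cA : continuous (fun s : R => annulus (s ^+ 2)) by move=> s; exact: continuous_annulus_sqr.
have sA : inner_support 1 2 (fun s : R => annulus (s ^+ 2)).
  move=> s s0 [s1|s2]; apply: annulus_out; [left|right].
    by rewrite expr_le1 ?(ltW s0)// ltW.
  by rewrite (_ : 4 = 2 ^+ 2) ?ler_pXn2r ?nnegrE ?(ltW s0) ?(ltW s2)// -natrX.
exact: (inner_support_integrable ltr01 (-1 - q) cA sA).
Qed.

(** If the constant were <= 0, [Rintegral_ge0_sign] could be applied to minus the integrand, with v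
    equal to -1 on D = [3/2, 5/3] and 0 elsewhere. As the integrand is positive on D, of length 1/6,
    this would give -1/6 >= 0. *)
Lemma annular_cst_gt0 : 0 < annular_cst.
Proof.
rewrite ltNge; apply/negP => A0.
pose D : set R := `[1 + 2^-1, 1 + 3^-1 * 2]%classic.
have lD : leb D = (6^-1)%:E.
  rewrite /D lebesgue_measure_itv/= lte_fin ifT; last by lra.
  by rewrite -EFinB; congr EFin; field.
have mD : measurable (D : set (measurableTypeR R)) by exact: measurable_itv.
have i : leb.-integrable setT (EFin \o (fun s => -1 * (ppow (-1 - q) s * annulus (s ^+ 2)))).
  exact: (integrableZl measurableT (-1) integrable_annulus).
have h : 0 <= \int[leb]_s ((cst (-1) : R -> R) \_ D) s.
  apply: (Rintegral_ge0_sign (m := leb) i).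
  - apply/(measurable_restrictT _ mD); exact: measurable_cst.
  - by move=> s; rewrite mulN1r oppr_le0 mulr_ge0 ?ppow_ge0 ?bump_ge0.
  - by rewrite (RintegralZl _ measurableT integrable_annulus) mulN1r oppr_ge0.
  move=> s; rewrite patchE; case: ifPn => [|_]; last by rewrite ltxx.
  rewrite inE /D/= in_itv/= => /andP[s1 s2] _.
  have s0 : 0 < s by lra.
  rewrite mulN1r oppr_lt0 ppow_gt0E// mulr_gt0 ?powR_gt0// bump_gt0 mulr_gt0//.
    rewrite subr_gt0 exprn_egt1//; lra.
  rewrite subr_gt0 (_ : 4 = 2 ^+ 2); last by rewrite -natrX.
  by rewrite ltr_pXn2r ?nnegrE//; lra.
move: h; rewrite -Rintegral_mkcond Rintegral_cst// [X in fine X]lD /= mulN1r oppr_ge0.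
by apply/negP; rewrite -ltNge invr_gt0.
Qed.

(** On the ray through xi the radial extension is constantly g xi, and by evenness the opposite ray
    gives the same value; hence the factor 2. *)
Lemma even_line_annular g xi : (forall x, enorm x = 1 -> g (- x) = g x) -> enorm xi = 1 ->
  \int[leb]_s (ppow (-1 - q) s * even_line (annular g) xi s) = 2 * annular_cst * g xi.
Proof.
move=> eg xi1; rewrite mulrAC -(RintegralZl _ measurableT integrable_annulus).
apply: eq_Rintegral => s _; have [s0|s0] := leP s 0; first by rewrite ppow_le0E// !mul0r mulr0.
have sx : radial g (s *: xi) = g xi by rewrite /radial -/(normal _) normalZ// normal_id.
have sNx : radial g (- (s *: xi)) = g xi.
  by rewrite /radial -/(normal _) normalN normalZ// normal_id// eg.
rewrite /even_line /annular sx sNx dotpNl dotpNr opprK dotpZl dotpZr -sqr_enorm xi1.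
by rewrite expr1n mulr1 -expr2; ring.
Qed.
End annular.

(** * Positivity *)

Section main.
Variables (R : realType) (n : nat) (q : R).
Notation V := 'rV[R]_n.
Notation leb := (@lebesgue_measure R).
Hypotheses (q0 : 0 < q).
Implicit Types (f g h phi : V -> R).

Let G := Gamma (- (q / 2)).

Definition spherical phi (x : V) : R := G^-1 * radint 0 (q + n%:R - 1) phi x.

Lemma radial_exponent : -1 < q + n%:R - 1.
Proof. by have := ler0n R n; move: q0; move: (n%:R : R) => r; lra. Qed.

Lemma Ce_inf_spherical phi : tc phi -> Ce_inf (spherical phi).
Proof. exact: Ce_inf_radint radial_exponent. Qed.

Lemma radint_bounded phi : tc phi -> sphere_bounded (radint 0 (q + n%:R - 1) phi).
Proof.
move=> tf; have := Ce_inf_sphere_bounded (Ce_inf_radint 1 radial_exponent tf).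
by congr sphere_bounded; apply/funext => x; rewrite mul1r.
Qed.

(** Boundedness is all that is asked of h, so that the formula covers both the elements of [Ce_inf]
    and the cosine kernel. *)
Lemma sp_spherical h phi : sphere_bounded h -> tc phi ->
  sp (fun x => h x * spherical phi x) = G^-1 * \int[mu]_x (hrs h q x * K 0 phi x).
Proof.
move=> bh tf; rewrite (polar_hrs q0 bh tf) -spZ; last exact: sphere_boundedM (radint_bounded tf).
by apply: eq_sp => x _; rewrite mulrCA.
Qed.

(** The preceding pairing is taken with the kernel |(x, xi)|^q in the role of h: being homogeneous
    of degree q, it is its own extension [hrs]. *)
Lemma cosine_spherical_slice phi xi : tc phi -> enorm xi = 1 ->
  cosine_transform q (spherical phi) xi = G^-1 * \int[mu]_x (`|dotp x xi| `^ q * K 0 phi x).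
Proof.
move=> tf xi1.
have bF := Ce_inf_sphere_bounded (Ce_inf_spherical tf).
rewrite cosine_transformE// (sp_spherical (sphere_bounded_dotp xi q0) tf).
congr (_ * _); apply: eq_Rintegral => x _; congr (_ * _).
have [->|x0] := eqVneq x 0.
  by rewrite /hrs enorm0 dotp0l normr0 powR0 ?gt_eqF// mul0r.
have e0 : 0 < enorm x by rewrite enorm_gt0.
rewrite /hrs /radial -powRM ?enorm_ge0// dotpZl normrM gtr0_norm ?invr_gt0//.
by rewrite mulrA divff ?gt_eqF// mul1r.
Qed.

Lemma intRn_cos phi x : tc phi -> intRn (fun xi => phi xi * cos (dotp x xi)) = K 0 phi x.
Proof.
move=> tf; rewrite -[RHS](intRn_Rintegral (tc_dominated (tc_cos 0 x tf))).
by congr intRn; apply/funext => y; rewrite addr0.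
Qed.

Lemma intRn_sin phi x : tc phi -> intRn (fun xi => phi xi * sin (dotp x xi)) = K (- (pi / 2)) phi x.
Proof.
move=> tf; rewrite -[RHS](intRn_Rintegral (tc_dominated (tc_cos (- (pi / 2)) x tf))).
congr intRn; apply/funext => y; rewrite cosD cosN sinN cos_pihalf sin_pihalf mulr0 sub0r.
by rewrite mulrN1 opprK.
Qed.

Lemma fourier_cos h phi : sphere_bounded h -> tc phi ->
  intRn (fun x => G^-1 * hrs h q x * intRn (fun xi => phi xi * cos (dotp x xi))) =
  sp (fun x => h x * spherical phi x).
Proof.
move=> bh tf; rewrite sp_spherical//.
have d := hrs_K_dominated q0 bh 0 G^-1 tf.
have d1 := dominated_integrable (hrs_K_dominated q0 bh 0 1 tf).
have i1 : mu.-integrable setT (EFin \o (fun x => hrs h q x * K 0 phi x)).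
  by apply: eq_integrable d1 => // x _; rewrite /= mul1r.
rewrite -(RintegralZl _ measurableT i1).
transitivity (intRn (fun x => G^-1 * hrs h q x * K 0 phi x)).
  by congr intRn; apply/funext => x; rewrite intRn_cos.
by rewrite (intRn_Rintegral d); apply: eq_Rintegral => x _; rewrite mulrA.
Qed.

(** The extension of h is even and the sine transform of phi is odd, so the substitution x -> -x
    shows that the integral equals its opposite. *)
Lemma fourier_sin h phi : Ce_inf h -> tc phi ->
  intRn (fun x => G^-1 * hrs h q x * intRn (fun xi => phi xi * sin (dotp x xi))) = 0.
Proof.
move=> ch tf; have bh := Ce_inf_sphere_bounded ch.
have d := hrs_K_dominated q0 bh (- (pi / 2)) G^-1 tf.
transitivity (intRn (fun x => G^-1 * hrs h q x * K (- (pi / 2)) phi x)).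
  by congr intRn; apply/funext => x; rewrite intRn_sin.
rewrite (intRn_Rintegral d).
have i := dominated_integrable d.
have N1 : (-1 : R) != 0 by rewrite oppr_eq0 oner_eq0.
have := Rintegral_affine 0 N1 i; rewrite normrN1 expr1n invr1 mul1r.
have -> : \int[mu]_x (G^-1 * hrs h q (-1 *: x + 0) * K (- (pi / 2)) phi (-1 *: x + 0)) =
  \int[mu]_x (-1 * (G^-1 * hrs h q x * K (- (pi / 2)) phi x)).
  apply: eq_Rintegral => x _; rewrite addr0 scaleN1r.
  have -> : hrs h q (- x) = hrs h q x.
    rewrite /hrs enormN; congr (_ * _); rewrite /radial enormN scalerN.
    have [->|x0] := eqVneq x 0; first by rewrite scaler0 oppr0.
    by apply: ch.1; exact: enorm_normalize.
  have -> : K (- (pi / 2)) phi (- x) = - K (- (pi / 2)) phi x; last by ring.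
  rewrite -[RHS]mulN1r -KZ//; apply: eq_Rintegral => y _.
  rewrite dotpNl !cosD cosN !sinN cosN cos_pihalf sin_pihalf; ring.
rewrite (RintegralZl _ measurableT i) mulN1r.
by move: (\int[mu]_x _) => J h1; lra.
Qed.

Hypothesis q_odd : forall k : nat, q <> (2 * k.+1)%:R.

Lemma cosine_spherical : exists2 P : R, 0 < P & forall phi xi, tc phi -> enorm xi = 1 ->
  cosine_transform q (spherical phi) xi =
  P * \int[leb]_s (ppow (-1 - q) s * even_line phi xi s).
Proof.
(* This gives 2m <= q < 2m + 2. Equality on the left is excluded by q > 0 when m = 0 and by the
   hypothesis on even integers otherwise. *)
pose m := Num.truncn (q / 2).
have q2 : 0 <= q / 2 by rewrite divr_ge0// ltW.
have /andP[m1 m2] : m%:R <= q / 2 < m.+1%:R := truncn_itv q2.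
have mq : m%:R * 2 < q < m.+1%:R * 2.
  apply/andP; split; last by rewrite -ltr_pdivrMr.
  rewrite -ltr_pdivlMr// lt_neqAle m1 andbT.
  apply/eqP => mE; have qE : q = (2 * m)%:R by rewrite natrM mE; field.
  case: m qE {m1 m2 mE} => [|k] qE; last exact: (@q_odd k).
  by move: q0; rewrite qE ltxx.
have [c c0 slice] := slice_formula n mq.
have Gs := Gamma_neg_half_sign mq.
(* The sign (-1)^(m+1) of the slice formula is its own inverse and is absorbed into the positive
   number (-1)^(m+1) Gamma(-q/2). *)
exists (((-1) ^+ m.+1 * G)^-1 * c); first by rewrite mulr_gt0// invr_gt0.
move=> phi xi tf xi1.
have xi0 : xi != 0 by rewrite -enorm_gt0 xi1.
rewrite cosine_spherical_slice// (slice phi xi tf xi0).2 [((-1) ^+ _ * G)^-1]invfM invr_sign.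
by rewrite !mulrA [G^-1 * _]mulrC.
Qed.

Lemma Pos_Cq_fourier_pos h : Pos_Cq q h ->
  fourier_pos_off0 (fun x => G^-1 * hrs h q x).
Proof.
move=> [ch posh] phi [sphi [phi0 [cphi ophi]]].
have tf : tc phi by split.
split; last exact: fourier_sin.
have bh := Ce_inf_sphere_bounded ch.
rewrite fourier_cos//.
have [P P0 cosF] := cosine_spherical.
have cF := Ce_inf_spherical tf.
have bF := Ce_inf_sphere_bounded cF.
have := posh _ cF; rewrite (sphere_intE (sphere_boundedM bF bh)).
rewrite (eq_sp (g := fun x => h x * spherical phi x)); last by move=> x _; rewrite mulrC.
apply => xi xi1; rewrite cosF//; apply: mulr_ge0; first exact: ltW.
by apply: Rintegral_ge0 => s _; rewrite mulr_ge0 ?ppow_ge0// addr_ge0.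
Qed.

Lemma fourier_pos_Pos_Cq h : Ce_inf h -> fourier_pos_off0 (fun x => G^-1 * hrs h q x) ->
  Pos_Cq q h.
Proof.
move=> ch posh; split => // f cf Cf.
have bh := Ce_inf_sphere_bounded ch.
have bf := Ce_inf_sphere_bounded cf.
have [P P0 cosF] := cosine_spherical.
(* The constant is chosen before g: the same A has to serve for h and for the function g built from
   F0 below. *)
have [A A0 AE] : exists2 A : R, 0 < A & forall g xi, smooth_on [set x : V | x != 0] (radial g) ->
    (forall x, enorm x = 1 -> g (- x) = g x) -> enorm xi = 1 ->
    cosine_transform q (spherical (annular g)) xi = A * g xi.
  exists (P * (2 * annular_cst q)); first by rewrite !mulr_gt0// annular_cst_gt0.
  by move=> g xi sg eg xi1; rewrite (cosF _ _ (tc_annular sg) xi1) (even_line_annular q eg xi1) mulrA.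
pose F0 := spherical (annular h).
have cF0 : Ce_inf F0 by apply: Ce_inf_spherical; apply: tc_annular; exact: ch.2.
have bF0 := Ce_inf_sphere_bounded cF0.
have CF0 xi : enorm xi = 1 -> cosine_transform q F0 xi = A * h xi.
  by move=> xi1; apply: AE => //; [exact: ch.2|exact: ch.1].
(* A smooth even function, positive exactly where F0 < 0; cut off to an annulus it is an admissible
   nonnegative test function. *)
pose g x := bump (-1 * F0 x).
have sg : smooth_on [set x : V | x != 0] (radial g).
  have o := @open_neq0 R n.
  exact: (smooth_bump o (smoothM o (smooth_cst (-1) o) cF0.2)).
have eg x : enorm x = 1 -> g (- x) = g x by move=> x1; rewrite /g cF0.1.
have bg : sphere_bounded g by apply: Ce_inf_sphere_bounded; split.
have tpsi := tc_annular sg.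
pose F1 := spherical (annular g).
have cF1 : Ce_inf F1 := Ce_inf_spherical tpsi.
have bF1 := Ce_inf_sphere_bounded cF1.
have g0 x : 0 <= g x by exact: bump_ge0.
have testpsi : nonneg_test_fun_off0 (annular g).
  by case: tpsi => s1 s2 s3; split => //; split => // x; exact: annular_ge0.
have := (posh _ testpsi).1; rewrite fourier_cos// -/F1 => pos1.
have pos2 : 0 <= sp (fun x => F0 x * g x).
  (* With integrals over the sphere, A int F0 g = int F0 C_q(F1) = int F1 C_q(F0) = A int h F1, and
     the last integral is the Fourier pairing known to be nonnegative. *)
  have : 0 <= A * sp (fun x => F0 x * g x).
    rewrite -spZ; last exact: sphere_boundedM.
    rewrite (eq_sp (g := fun x => F0 x * cosine_transform q F1 x)); last first.
      by move=> x x1; rewrite AE// mulrCA.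
    rewrite sp_cosine//.
    rewrite (eq_sp (g := fun x => A * (h x * F1 x))); last first.
      by move=> x x1; rewrite CF0// mulrCA [F1 x * _]mulrC.
    rewrite spZ; last exact: sphere_boundedM.
    by apply: mulr_ge0 => //; exact: ltW.
  by rewrite pmulr_rge0.
rewrite sphere_intE; last exact: sphere_boundedM.
have : 0 <= A * sp (fun x => f x * h x); last by rewrite pmulr_rge0.
rewrite -spZ; last exact: sphere_boundedM.
rewrite (eq_sp (g := fun x => f x * cosine_transform q F0 x)); last first.
  by move=> x x1; rewrite CF0// mulrCA.
rewrite sp_cosine//.
(* For n = 0 the factor n makes the spherical integral zero; otherwise that factor is positive and
   can be removed. *)
have [n0|n0] := posnP n; first by rewrite /sp (_ : n%:R = 0 :> R) ?mul0r// n0.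
have n1 : 0 < n%:R :> R by rewrite ltr0n.
rewrite /sp pmulr_rge0//; move: pos2; rewrite /sp pmulr_rge0// => pos2.
(* Here u is F0 g and v is F0 C_q(f), both cut off to the punctured ball. That F0 >= 0 almost
   everywhere enters only through the implication from v < 0 to u < 0. *)
apply: Rintegral_ge0_sign pos2 _.
- exact: (dominated_integrable (sphere_bounded_dominated (sphere_boundedM bF0 bg))).
- exact: (measurable_EFinP _ _).1 (measurable_int _ (cosine_integrable q0 bF0 bf)).
- move=> x; apply: mulr_ge0_le0; first exact: uball_ge0.
  have [F0x|F0x] := leP 0 (F0 (normal x)).
    by rewrite /g bump_le0 ?mulr0// mulN1r oppr_le0.
  by rewrite mulr_le0_ge0// ltW.
move=> x; have [u0|u0] := eqVneq (uball x) 0; first by rewrite u0 mul0r ltxx.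
have x0 := uball_neq0 u0.
have up : 0 < uball x by rewrite lt_neqAle eq_sym u0 uball_ge0.
rewrite (pmulr_rlt0 _ up) => h1; rewrite (pmulr_rlt0 _ up).
(* Since C_q(f) >= 0 on the sphere, a negative product forces F0 < 0; there g > 0, hence F0 g <
   0. *)
have F0x : F0 (normal x) < 0.
  rewrite ltNge; apply/negP => F0x; move: h1; rewrite ltNge mulr_ge0// Cf// enorm_normal//.
by rewrite nmulr_rlt0// bump_gt0 mulN1r oppr_gt0.
Qed.
End main.

Theorem theorem2 (R : realType) (n : nat) (q : R) :
  0 < q -> (forall k : nat, q <> (2 * k.+1)%:R) ->
  forall h : 'rV[R]_n -> R,
    Pos_Cq q h <->
    (Ce_inf h /\
     fourier_pos_off0 (fun x => (Gamma (- (q / 2)))^-1 * hrs h q x)).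
Proof.
move=> q0 q_odd h; split=> [ph|[ch posh]]; first by split; [exact: ph.1|exact: Pos_Cq_fourier_pos].
exact: fourier_pos_Pos_Cq.
Qed.
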